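(* Let $p,q\ge1$ with $1/p+1/q>1$ and $q\le p$. Let $\omega:[0,1]\to\mathbb{R}$ be a continuous map with $V_p(\omega)<\infty$, and let $\mathbb{B}_{p,q,\omega}$ be the Banach space of functions $\rho:[0,1]\to\mathbb{R}$ such that $$\|\rho\|_{p,q,\omega}:=V_p(\rho)^{1/p}+V_q(\rho|\omega)^{1/q}+\sup|\rho|$$ is finite. Let $\eta:[0,1]\to\mathbb{R}^{d-1}$ be continuous with finite $q$-variation, and let $\xi=(\omega,\eta)$, with values in $\mathbb{R}^d$. Let $f$ be a $C^2$ function with bounded derivatives (of orders $1$ and $2$) from $\mathbb{R}^n$ into the space of linear maps $\mathcal{L}(\mathbb{R}^d,\mathbb{R}^n)$. For $x_0\in\mathbb{R}^n$, consider the equation $$x(t)=x_0+\int_0^tf(x(s))\,d\xi(s),\qquad 0\le t\le1,$$ where the integral is understood as the sum of the integrals with respect to each component of $\xi$, each one being defined as an integral on the tree of that component (see the context). Then this equation has a unique solution in the Banach space $\mathbb{B}_{p,q,\omega}^n$.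
   Context: $p$-variation: $V_p(f)=\sup\sum_i|f(t_{i+1})-f(t_i)|^p$ over subdivisions $(t_i)$ of $[0,1]$. Further, $V_q(\rho|\omega)=\sup\sum_k|\rho(t_{2k+2})-\rho(t_{2k+1})|^q$, the supremum being over subdivisions $(t_i)$ of $[0,1]$ such that $\omega(t_{2k+1})=\omega(t_{2k+2})$ for all $k$. Integral on the tree with respect to a continuous nonconstant real path $\theta:[0,1]\to\mathbb{R}$ (here $\theta$ is $\omega$ or a component of $\eta$; integrals with respect to a constant path are $0$): put $\delta(s,t)=\theta(s)+\theta(t)-2\inf_{[s,t]}\theta$. This is a semi-distance on $[0,1]$; the quotient metric space $\mathbb{T}=([0,1]/\delta,\delta)$ is a compact real tree, i.e. any two points $\tau_1,\tau_2$ are joined by a unique arc $[\tau_1,\tau_2]$, isometric to $[0,\delta(\tau_1,\tau_2)]$. Let $\pi:[0,1]\to\mathbb{T}$ be the projection, $O=\pi(U)$ where $U$ is a time at which $\theta$ attains its minimum, $A=\pi(0)$, $B=\pi(1)$. The tree is rooted at $O$; a leaf is a point $\tau$ such that $\tau\notin[O,\sigma]$ for all $\sigma\neq\tau$. The length measure $\lambda$ is the unique measure on $\mathbb{T}$ for which the set of leaves has measure zero and the measure of each arc is its length. Put $\tau^\nearrow=\inf\pi^{-1}(\tau)$, $\tau^\nwarrow=\sup\pi^{-1}(\tau)$, and $\Delta\rho(\tau)=\rho(\tau^\nearrow)-\rho(\tau^\nwarrow)$, with the convention that $\rho(\tau^\nearrow)$ is replaced by $0$ for $\tau\in[O,A]$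 and $\rho(\tau^\nwarrow)$ is replaced by $0$ for $\tau\in[O,B]$. When $\int_{\mathbb{T}}|\Delta\rho|\,d\lambda<\infty$, one defines $\int_0^1\rho\,d\theta=\int_{\mathbb{T}}\Delta\rho\,d\lambda$, and $\int_0^t\rho\,d\theta$ is defined in the same way with $\rho$ replaced by $\rho1_{(0,t]}$. (For bounded $\rho$ this integrability holds when $\theta=\omega$ and $V_p(\omega)<\infty$, $V_q(\rho|\omega)<\infty$; and when $V_q(\theta)<\infty$, $V_p(\rho)<\infty$, in which case the integral is the Young integral.) *)

(* Defs.v *)
From HB Require Import structures.
From mathcomp Require Import all_boot all_order all_algebra generic_quotient.
From mathcomp Require Import all_classical all_reals all_analysis.
From mathcomp Require Import measurable_realfun lra.

Set Implicit Arguments.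
Unset Strict Implicit.
Unset Printing Implicit Defensive.

Import Order.TTheory GRing.Theory Num.Theory.
Import numFieldNormedType.Exports.

Local Open Scope classical_set_scope.
Local Open Scope ring_scope.

(** Functions on [0, 1] are functions on R of which only the values on [0, 1]
    are used; [cpath R V] is the type of those that are continuous on [0, 1]. *)
Definition cpath (R : realType) (V : topologicalType) :=
  continuousType (subspace (`[0, 1] : set R)) V.

Section Variation.
Context {R : realType}.
Implicit Types (p q : R) (s : seq R).

(* Consecutive times may coincide. In [cond_variation] this allows the pairs
   of times to start at 0 and to end at 1. *)
Definition subdivision : set (seq R) :=
  [set s | sorted <=%R s /\ {subset s <= `[0, 1]}].

(* \sum_i |f(t_{i+1}) - f(t_i)|^p *)
Definition pvar_sum {V : normedModType R} p (f : R -> V) s : R :=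
  \sum_(i < (size s).-1) `|f s`_i.+1 - f s`_i| `^ p.

Definition pvariation {V : normedModType R} p (f : R -> V) : \bar R :=
  ereal_sup [set (pvar_sum p f s)%:E | s in subdivision].

(* s consists of t_0, ..., t_N with N = (size s).-1, and 2k+2 <= N holds if and
   only if k < N./2. *)
Definition level_subdivision (omega : R -> R) : set (seq R) :=
  [set s | subdivision s /\ forall k, (k < (size s).-1./2)%N ->
     omega s`_(k.*2.+1) = omega s`_(k.*2.+2)].

Definition cond_pvar_sum q (rho : R -> R) s : R :=
  \sum_(k < (size s).-1./2) `|rho s`_(k.*2.+2) - rho s`_(k.*2.+1)| `^ q.

(* V_q(rho | omega) *)
Definition cond_variation q (rho omega : R -> R) : \bar R :=
  ereal_sup [set (cond_pvar_sum q rho s)%:E | s in level_subdivision omega].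

Definition normB p q (omega rho : R -> R) : \bar R :=
  (pvariation p rho `^ p^-1 + cond_variation q rho omega `^ q^-1
   + ereal_sup [set `|rho t|%:E | t in `[0%R, 1%R]])%E.

Definition spaceB p q (omega : R -> R) : set (R -> R) :=
  [set rho | (normB p q omega rho < +oo)%E].

End Variation.

Section Tree.
Context {R : realType}.

Definition time := {t : R | t \in `[0, 1]}.

Fact time0_subproof : (0 : R) \in `[0, 1].
Proof. by rewrite in_itv /= lexx ler01. Qed.

Fact time1_subproof : (1 : R) \in `[0, 1].
Proof. by rewrite in_itv /= lexx ler01. Qed.

Definition time0 : time := exist _ 0 time0_subproof.
Definition time1 : time := exist _ 1 time1_subproof.

Variable theta : cpath R R.

Definition between (s t : time) : set R :=
  `[Num.min (val s) (val t), Num.max (val s) (val t)].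

Definition delta (s t : time) : R :=
  theta (val s) + theta (val t) - 2 * inf (theta @` between s t).

Let between_time (s t : time) (u : R) : between s t u -> u \in `[0, 1].
Proof.
case: s t => [s hs] [t ht]; rewrite /between /= !in_itv /=.
move: hs ht; rewrite !in_itv /= => /andP[s0 s1] /andP[t0 t1] /andP[mu uM].
rewrite (le_trans _ mu) ?le_min ?s0 //= (le_trans uM) //.
by rewrite ge_max s1.
Qed.

Let theta_min : exists c : R, forall u, u \in `[0, 1] -> theta c <= theta u.
Proof.
have := @EVT_min R theta 0 1 ler01 (@cts_fun _ _ theta).
by move=> [c _ hc]; exists c.
Qed.

Let inf_between (s t : time) u : between s t u ->
  inf (theta @` between s t) <= theta u.
Proof.
move=> su; apply: ge_inf; last by exists u.
have [c hc] := theta_min; exists (theta c) => _ [v /between_time/hc hv <-].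
exact: hv.
Qed.

Let betweenl (s t : time) : between s t (val s).
Proof. by rewrite /between /= in_itv /= ge_min le_max lexx. Qed.

Let betweenC (s t : time) : between s t = between t s.
Proof. by rewrite /between minC maxC. Qed.

Let betweenr (s t : time) : between s t (val t).
Proof. by rewrite betweenC; exact: betweenl. Qed.

Lemma delta_refl s : delta s s = 0.
Proof.
rewrite /delta /between minxx maxxx set_itv1 image_set1 inf1.
by rewrite mulr_natl mulr2n subrr.
Qed.

Lemma delta_sym s t : delta s t = delta t s.
Proof. by rewrite /delta betweenC [theta _ + _]addrC. Qed.

Lemma delta_triangle t s u : delta s u <= delta s t + delta t u.
Proof.
set a := inf (theta @` between s t); set b := inf (theta @` between t u).
have at_ : a <= theta (val t) by exact/inf_between/betweenr.
have bt : b <= theta (val t) by exact/inf_between/betweenl.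
have abu : Num.min a b <= inf (theta @` between s u).
  apply: lb_le_inf.
    by exists (theta (val s)), (val s) => //; exact: betweenl.
  move=> _ [w sw <-]; rewrite ge_min.
  have [stw|tuw] : between s t w \/ between t u w.
    move: sw; rewrite /between /= !in_itv /= !ge_min !le_max.
    move=> /andP[/orP hl /orP hr].
    case: (leP w (val t)) => wt; case: hl => hl; case: hr => hr;
      rewrite ?hl ?hr ?wt ?(ltW wt) ?orbT /=; solve [by left | by right].
  - by rewrite inf_between.
  - by rewrite [X in _ || X]inf_between ?orbT.
rewrite /delta -/a -/b; move: abu at_ bt.
set c := inf _; set x := theta _; set y := theta _; set z := theta _.
by case: (leP a b) => ab abu ay bz; lra.
Qed.

Lemma delta_ge0 s t : 0 <= delta s t.
Proof.
have := delta_triangle t s s; rewrite delta_refl [delta t s]delta_sym.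
by rewrite -mulr2n pmulrn_lge0.
Qed.

Definition delta_eq : rel time := fun s t => delta s t == 0.

Let delta_eq_refl : reflexive delta_eq.
Proof. by move=> s; rewrite /delta_eq delta_refl. Qed.

Let delta_eq_sym : symmetric delta_eq.
Proof. by move=> s t; rewrite /delta_eq delta_sym. Qed.

Let delta_eq_trans : transitive delta_eq.
Proof.
move=> t s u /eqP st /eqP tu; rewrite /delta_eq eq_le delta_ge0 andbT.
by rewrite (le_trans (delta_triangle t _ _)) // st tu addr0.
Qed.

Canonical delta_equiv :=
  EquivRel delta_eq delta_eq_refl delta_eq_sym delta_eq_trans.

Local Open Scope quotient_scope.

Definition tree : Type := {eq_quot delta_equiv}.

HB.instance Definition _ := Choice.on tree.
HB.instance Definition _ := EqQuotient.on tree.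

Definition tree_dist (sigma tau : tree) : R := delta (repr sigma) (repr tau).

Let tree_dist_refl tau : tree_dist tau tau = 0.
Proof. exact: delta_refl. Qed.

Let tree_dist_eq sigma tau : tree_dist sigma tau = 0 -> sigma = tau.
Proof.
by move=> /eqP d0; rewrite -[sigma]reprK -[tau]reprK; exact/eqmodP.
Qed.

Let tree_dist_sym sigma tau : tree_dist sigma tau = tree_dist tau sigma.
Proof. exact: delta_sym. Qed.

Let tree_dist_triangle tau sigma upsilon :
  tree_dist sigma upsilon <= tree_dist sigma tau + tree_dist tau upsilon.
Proof. exact: delta_triangle. Qed.

HB.instance Definition _ := isMetric.Build R tree
  tree_dist_refl tree_dist_eq tree_dist_sym tree_dist_triangle.

Definition proj (t : time) : tree := \pi_tree t.

Lemma mdist_proj s t : mdist (proj s) (proj t) = delta s t.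
Proof.
have E u : delta u (repr (proj u)) = 0.
  by apply/eqP; rewrite -[_ == 0]/(delta_equiv _ _) -eqmodE reprK.
apply/eqP; rewrite /mdist /= /tree_dist eq_le; apply/andP; split.
  rewrite (le_trans (delta_triangle s _ _))// delta_sym E add0r.
  by rewrite (le_trans (delta_triangle t _ _))// E addr0.
rewrite (le_trans (delta_triangle (repr (proj s)) _ _))// E add0r.
rewrite (le_trans (delta_triangle (repr (proj t)) _ _))//.
by rewrite [delta _ t]delta_sym E addr0.
Qed.

HB.instance Definition _ := isPointed.Build tree (proj time0).

(* All the times at which theta is minimal have the same projection. *)
Definition root : tree :=
  proj (xget time0 [set U | forall s : time, theta (val U) <= theta (val s)]).

(* [sigma, tau], the unique arc from sigma to tau, is the image of an isometric
   parametrization gamma by [0, mdist sigma tau]. *)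
Definition arc (sigma tau : tree) : set tree :=
  [set upsilon | exists gamma : R -> tree,
    [/\ gamma 0 = sigma, gamma (mdist sigma tau) = tau,
        {in `[0, mdist sigma tau] &, forall a b,
           mdist (gamma a) (gamma b) = `|a - b|}
      & (gamma @` `[0, mdist sigma tau]) upsilon]].

Definition leaves : set tree :=
  [set tau | forall sigma, sigma <> tau -> ~ arc root sigma tau].

(* Borel sigma-algebra of the tree *)
Definition btree := g_sigma_algebraType (@open tree).

Definition is_length_measure (lambda : {measure set btree -> \bar R}) : Prop :=
  lambda leaves = 0%E /\
  forall sigma tau : tree, lambda (arc sigma tau) = (mdist sigma tau)%:E.

(* Two such measures agree on the Borel sets. The default value mzero would
   only be used if there were none; [tree_integrable] excludes that case. *)
Definition length_measure : {measure set btree -> \bar R} :=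
  if pselect (exists lambda, is_length_measure lambda) is left h
  then projT1 (cid h) else mzero.

Definition fiber (tau : tree) : set R :=
  [set val t | t in [set t | proj t = tau]].

(* Delta rho (tau): inf (fiber tau) and sup (fiber tau) are the first and the
   last times at which the tree is visited at tau, and the corresponding value
   of rho is replaced by 0 on [O, A] and on [O, B] respectively, where O is the
   root, A = proj time0 and B = proj time1. *)
Definition jump (rho : R -> R) (tau : btree) : R :=
  (if `[< arc root (proj time0) tau >] then 0 else rho (inf (fiber tau)))
  - (if `[< arc root (proj time1) tau >] then 0 else rho (sup (fiber tau))).

Definition tree_integrable (rho : R -> R) : Prop :=
  is_length_measure length_measure /\
  length_measure.-integrable setT (EFin \o jump rho).

Definition tree_integral (rho : R -> R) : R :=
  \int[length_measure]_(tau in setT) jump rho tau.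

End Tree.

Arguments leaves {R} theta.
Arguments jump {R} theta rho tau.

Lemma length_measureP (R : realType) (theta : cpath R R) :
  (exists lambda, @is_length_measure R theta lambda) ->
  is_length_measure (length_measure theta).
Proof. by rewrite /length_measure; case: pselect => // h _; case: cid. Qed.

(* For a constant path the tree is a single point, which is a leaf: the length
   measure is 0 and all the integrals are equal to 0. *)
Lemma tree_integral_cst (R : realType) (theta : cpath R R) (rho : R -> R) :
  (forall s t : R, s \in `[0, 1] -> t \in `[0, 1] -> theta s = theta t) ->
  tree_integrable theta rho /\ tree_integral theta rho = 0.
Proof.
move=> hc.
have d0 (s t : time) : delta theta s t = 0.
  have -> : delta theta s t = delta theta s s; last exact: delta_refl.
  rewrite /delta (hc _ _ (valP t) (valP s)); congr (_ - 2 * _).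
  have E (u : time) : theta @` between s u = [set theta (val s)].
    apply/seteqP; split => [_ [v sv <-]|_ ->].
      apply: hc; last exact: valP.
      have := valP s; have := valP u; move: sv; rewrite /between /= !in_itv /=.
      move=> /andP[mv vM] /andP[u0 u1] /andP[s0 s1].
      by rewrite (le_trans _ mv) ?le_min ?s0 //= (le_trans vM) // ge_max s1.
    by exists (val s) => //; rewrite /between /= in_itv /= ge_min le_max lexx.
  by rewrite !E.
have tree1 (sigma tau : tree theta) : sigma = tau.
  by apply: (@mdist_positivity R); exact: d0.
have leavesT : leaves theta = [set: tree theta].
  by apply/seteqP; split => // tau _ sigma; case; exact: tree1.
have h0 : is_length_measure (length_measure theta).
  apply: length_measureP; exists mzero; split => // sigma tau.
  by rewrite /mdist /= /tree_dist d0.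
have muT : length_measure theta setT = 0%E.
  by rewrite -leavesT; case: h0.
pose c := jump theta rho point.
have jE : jump theta rho = cst c by apply/funext => tau; rewrite (tree1 tau point).
rewrite /tree_integrable /tree_integral jE; split; first split => //.
  apply/integrableP; split; first exact/measurable_EFinP/measurable_cst.
  by rewrite (eq_integral (cst `|c%:E|%E)) // integral_cst //= muT mule0.
by rewrite /Rintegral (eq_integral (cst c%:E)) // integral_cst //= muT mule0.
Qed.

Section Path.
Context {R : realType}.

Fact coord_path_subproof d (xi : cpath R 'cV[R]_d) (j : 'I_d) :
  {within `[0, 1], continuous (fun t => xi t j ord0)}.
Proof.
move=> t; apply: (@continuous_comp _ _ _ xi (fun M : 'cV[R]_d => M j ord0)).
  exact: cts_fun.
exact: coord_continuous.
Qed.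

Definition coord_path d (xi : cpath R 'cV[R]_d) (j : 'I_d) : cpath R R :=
  mkcts (@coord_path_subproof d xi j).

Fact joint_path_subproof m (omega : cpath R R) (eta : cpath R 'cV[R]_m) :
  {within `[0, 1],
    continuous (fun t => col_mx (omega t)%:M (eta t) : 'cV[R]_(1 + m))}.
Proof.
move=> t; apply/cvg_ballP => e e0.
have := @cts_fun _ _ omega t; move=> /cvg_ballP /(_ e e0) ho.
have := @cts_fun _ _ eta t; move=> /cvg_ballP /(_ e e0) he.
near=> s; split => // i j; rewrite !mxE.
have hos : ball (omega t) e (omega s) by near: s.
have hes : ball (eta t) e (eta s) by near: s.
case: splitP => k _; last by case: hes.
by rewrite !mxE (ord1 k) (ord1 j).
Unshelve. all: by end_near.
Qed.

(* xi = (omega, eta) *)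
Definition joint_path m (omega : cpath R R) (eta : cpath R 'cV[R]_m) :
  cpath R 'cV[R]_(1 + m) := mkcts (@joint_path_subproof m omega eta).

End Path.

(* A C^2 function whose derivatives of orders 1 and 2 are bounded. Since V and
   W are to be finite dimensional, the regularity of x |-> 'd f x, with values
   in the space of linear maps, is expressed on each vector v; the second
   differential of f at x is (u, v) |-> 'd (fun y => 'd f y v) x u. *)
Definition C2_bounded_derivatives (R : realType) (V W : normedModType R)
    (f : V -> W) : Prop :=
  [/\ forall x, differentiable f x,
      forall v x, differentiable (fun y => 'd f y v) x,
      forall u v, continuous (fun x => 'd (fun y => 'd f y v) x u),
      exists M : R, forall x v, `|'d f x v| <= M * `|v|
    & exists M : R, forall x u v,
        `|'d (fun y => 'd f y v) x u| <= M * `|u| * `|v| ].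

(* f x in L(R^d, R^n) is given by its matrix, and the integral from 0 to t of
   g d(xi_j) is that of g 1_(0,t]. All these integrals are required to exist. *)
Definition is_solution (R : realType) (n d : nat) (xi : cpath R 'cV[R]_d)
    (f : 'cV[R]_n -> 'M[R]_(n, d)) (x0 : 'cV[R]_n) (x : R -> 'cV[R]_n) : Prop :=
  forall t, t \in `[0, 1] ->
    let g i j := fun s => f (x s) i j * \1_(`]0, t]) s in
    (forall i j, tree_integrable (coord_path xi j) (g i j)) /\
    x t = x0 + \col_i \sum_j tree_integral (coord_path xi j) (g i j).

Definition spaceBn (R : realType) (n : nat) (p q : R) (omega : R -> R) :
    set (R -> 'cV[R]_n) :=
  [set x | forall i, spaceB p q omega (fun t => x t i ord0)].

(* Main.v *)
Require Import Defs.
From HB Require Import structures.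
From mathcomp Require Import all_boot all_order all_algebra generic_quotient.
From mathcomp Require Import all_classical all_reals all_analysis.
From mathcomp Require Import measurable_realfun ring lra.

(** Write gp sigma tau for the height of the branching point of two points of
    the tree; tau lies on [O, sigma] if and only if gp tau sigma = hgt tau, and
    this happens for sigma = pi u if and only if u lies between the first and
    the last visit of tau. Hence, outside the arc [pi s, pi t], the jump of
    rho 1_(s, t] at tau is the increment of rho over the interval of the visits
    of tau. Among the points at the same level modulo 4 eps above which the tree
    continues for a height comparable with eps, these intervals do not overlap,
    and theta varies by more than eps on each of them: there are at most
    c(s, t) eps^-P of them, where c is the P-variation of theta. Hoelder's
    inequality bounds the sum of the jumps of rho by its Q-variation at equal
    levels of theta; integrating over the levels modulo eps and summing over
    eps = c0 2^-k converges since 1/P + 1/Q > 1. This gives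
    |\int_s^t rho dtheta| <= C c^(1/P) (sup |rho| + w^(1/Q)), without the term
    sup |rho| when theta s = theta t, because the jumps at the two points of
    [pi s, pi t] of a given level then add up to an increment of rho between two
    times with equal values of theta. With (P, Q) = (p, q) for omega
    and (P, Q) = (q, p) for the components of eta, integration maps the space B
    into itself, with a norm proportional to the variation of the driver.
    A C^2 map with bounded derivatives acts on B by composition, and this action
    is Lipschitz on bounded sets. On intervals where the driver has small
    variation Picard's iteration therefore converges and solutions are unique;
    the size of these intervals may be chosen uniformly because the linear
    growth of f gives an a priori bound on all solutions. *)

Set Implicit Arguments.
Unset Strict Implicit.
Unset Printing Implicit Defensive.

Import Order.TTheory GRing.Theory Num.Theory.
Import numFieldNormedType.Exports.

Local Open Scope classical_set_scope.
Local Open Scope ring_scope.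

(** * The tree coded by a path *)

Section Clamp.
Context {R : realType}.

(** A solution has increments of the size of those of omega, hence only finite p-variation. For p >=
    2 the condition 1/p + 1/p > 1 fails, and Young's theory does not integrate such a function
    against omega. The term V_q(rho|omega) supplies the missing regularity: outside the arc between
    the two end times, the tree integral only compares rho at two times where omega takes the same
    value, and there the exponent is q. For an iteration to stay in B, the integral must inherit
    this property, so its increments between two times s < t of equal level must be of order
    w(s,t)^(1/q), where w is the q-variation of rho at equal levels. The general bound, of order
    c(s,t)^(1/p), is not of this kind because of its term in sup |rho|; that term comes only from
    the arc between pi s and pi t, and it cancels when both ends have the same height. This is why
    the estimate exists in two versions. All estimates are stated for abstract exponents (P, Q), so
    that omega and the components of eta are treated by the same argument. *)

Definition clamp (a b x : R) : R := Num.max a (Num.min x b).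

Lemma clamp_itv (a b x : R) : a <= b -> a <= clamp a b x <= b.
Proof. by move=> ab; rewrite /clamp le_max lexx /= ge_max ab ge_min lexx orbT. Qed.

Lemma clamp_id (a b x : R) : a <= x <= b -> clamp a b x = x.
Proof. by move=> /andP[ax xb]; rewrite /clamp (min_idPl xb) (max_idPr ax). Qed.

Lemma clamp_continuous (a b : R) : continuous (clamp a b).
Proof.
move=> x; apply: (@continuous_max R R (fun=> a) (fun y => Num.min y b) x).
  exact: cvg_cst.
by apply: (@continuous_min R R id (fun=> b) x); [exact: cvg_id|exact: cvg_cst].
Qed.

Lemma clamp_lip (a b x y : R) : a <= b -> `|clamp a b x - clamp a b y| <= `|x - y|.
Proof.
move=> ab; wlog xy : x y / x <= y.
  move=> h; have [/h//|/ltW/h] := leP x y.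
  by rewrite distrC [`|x - y|]distrC.
rewrite [leRHS]distrC [leLHS]distrC [leRHS]ger0_norm ?subr_ge0// /clamp.
have [xb|bx] := leP x b; have [yb|by_] := leP y b;
  rewrite ?(max_idPr ab);
  have [?|?] := leP a x; have [?|?] := leP a y;
  by rewrite ler_norml; apply/andP; split; lra.
Qed.

End Clamp.

(** * Arcs and distances in terms of heights and branching heights *)

Section TreeGeometry.
Context {R : realType}.
Variable theta : cpath R R.
Local Notation T := (tree theta).
Local Notation proj := (@Defs.proj R theta).
Local Notation arc := (@Defs.arc R theta).
Local Notation rt := (Defs.root theta).
Implicit Types (s t : time (R := R)) (x y z a : R) (sigma tau ups : T).

(** The extension of [theta] by constants is continuous on all of R, so that the extreme and
    intermediate value theorems apply on every interval. *)
Definition ctheta x := theta (clamp 0 1 x).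

Lemma cthetaE x : x \in `[0, 1] -> ctheta x = theta x.
Proof. by rewrite in_itv /= /ctheta => /clamp_id ->. Qed.

Lemma clamp01 x : clamp 0 1 x \in `[0, 1].
Proof. by rewrite in_itv /=; exact/clamp_itv/ler01. Qed.

Lemma ctheta_continuous : continuous ctheta.
Proof.
have h := @cts_fun _ _ theta.
move=> x; apply/cvg_ballP => e e0.
have c01 : (`[0, 1]%classic : set R) (clamp 0 1 x) by exact: clamp01.
have H : within `[0, 1]%classic (nbhs (clamp 0 1 x))
    [set y | ball (theta (clamp 0 1 x)) e (theta y)].
  by rewrite (nbhs_subspace_in c01); have /cvg_ballP/(_ _ e0) := h (clamp 0 1 x).
have H2 : \forall y \near x, `[0, 1]%classic (clamp 0 1 y) ->
  ball (theta (clamp 0 1 x)) e (theta (clamp 0 1 y)) := clamp_continuous H.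
near=> y; rewrite /ctheta; have hy : `[0, 1]%classic (clamp 0 1 y) ->
  ball (theta (clamp 0 1 x)) e (theta (clamp 0 1 y)) by near: y.
by apply: hy; exact: clamp01.
Unshelve. all: by end_near.
Qed.

Definition seg x y : set R := `[Num.min x y, Num.max x y].

Lemma segC x y : seg x y = seg y x.
Proof. by rewrite /seg minC maxC. Qed.

Lemma segl x y : seg x y x.
Proof. by rewrite /seg /= in_itv /= ge_min le_max lexx. Qed.

Lemma segr x y : seg x y y.
Proof. by rewrite segC; exact: segl. Qed.

Lemma segP x y z : seg x y z <-> (x <= z <= y \/ y <= z <= x).
Proof.
rewrite /seg /= in_itv /=; have [xy|yx] := leP x y.
  split=> [->|[->//|/andP[yz zx]]]; first by left.
  by rewrite (le_trans xy yz) (le_trans zx xy).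
split=> [->|[/andP[xz zy]|->//]]; first by right.
by rewrite (le_trans (ltW yx) xz) (le_trans zy (ltW yx)).
Qed.

Lemma seg_sub x y u z : seg x y u -> seg u y z -> seg x y z.
Proof.
move=> /segP[]/andP[h1 h2] /segP[]/andP[h3 h4]; apply/segP.
- by left; rewrite (le_trans h1 h3).
- by left; rewrite (le_trans (le_trans h1 h2) h3) (le_trans h4 h2).
- by right; rewrite (le_trans h1 h3) (le_trans h4 (le_trans h1 h2)).
- by right; rewrite h3 (le_trans h4 h2).
Qed.

Lemma seg_itv x y z : x \in `[0, 1] -> y \in `[0, 1] -> seg x y z -> z \in `[0, 1].
Proof.
rewrite !in_itv /= => /andP[x0 x1] /andP[y0 y1] /segP[]/andP[h1 h2].
  by rewrite (le_trans x0 h1) (le_trans h2 y1).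
by rewrite (le_trans y0 h1) (le_trans h2 x1).
Qed.

Definition pt x : time := exist _ (clamp 0 1 x) (clamp01 x).

Lemma ptK x : x \in `[0, 1] -> val (pt x) = x.
Proof. by rewrite in_itv /= => /clamp_id. Qed.

Lemma pt_val t : pt (val t) = t.
Proof. by apply/val_inj/ptK/valP. Qed.

Definition mt s t : R := inf (theta @` between s t).

Lemma mt_ex s t : exists2 x, seg (val s) (val t) x &
  theta x = mt s t /\ forall y, seg (val s) (val t) y -> mt s t <= theta y.
Proof.
have mM : Num.min (val s) (val t) <= Num.max (val s) (val t).
  by rewrite ge_min le_max lexx.
have [|c cst hc] := @EVT_min R ctheta _ _ mM.
  by apply: continuous_subspaceT; exact: ctheta_continuous.
have hcy y : seg (val s) (val t) y -> theta c <= theta y.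
  move=> sy; have := hc y sy.
  by rewrite !cthetaE //; apply: (seg_itv (valP s) (valP t)).
have E : theta c = mt s t.
  apply/eqP; rewrite eq_le; apply/andP; split.
    apply: lb_le_inf; first by exists (theta (val s)), (val s) => //; exact: segl.
    by move=> _ [y sy <-]; exact: hcy.
  apply: ge_inf; last by exists c.
  by exists (theta c) => _ [y sy <-]; exact: hcy.
by exists c => //; split => // y; rewrite -E; exact: hcy.
Qed.

Lemma mtP s t a : a <= mt s t <-> forall y, seg (val s) (val t) y -> a <= theta y.
Proof.
have [c sc [ec hc]] := mt_ex s t; split => [h y /hc|]; first exact: le_trans.
by move=> /(_ _ sc); rewrite ec.
Qed.

Lemma mt_sym s t : mt s t = mt t s.
Proof. by rewrite /mt /between minC maxC. Qed.

Lemma mt_le s t x : seg (val s) (val t) x -> mt s t <= theta x.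
Proof. by move=> h; exact: (mtP s t (mt s t)).1. Qed.

Lemma mt_lel s t : mt s t <= theta (val s).
Proof. by apply: mt_le; exact: segl. Qed.

Lemma mt_ler s t : mt s t <= theta (val t).
Proof. by apply: mt_le; exact: segr. Qed.

(** The interval between [s] and [u] is covered by the two others. This ultrametric inequality is
    the tree property: among three branching heights the two smallest are equal. *)
Lemma mt_ultra s t (u : time) : Num.min (mt s t) (mt t u) <= mt s u.
Proof.
apply/mtP => y sy; rewrite ge_min.
suff [h|h] : seg (val s) (val t) y \/ seg (val t) (val u) y.
- by rewrite mt_le.
- by rewrite (mt_le h) orbT.
move: sy => /segP[]/andP[h1 h2]; case: (leP y (val t)) => ty.
- by left; apply/segP; left; rewrite h1.
- by right; apply/segP; left; rewrite h2 ltW.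
- by right; apply/segP; right; rewrite h1.
- by left; apply/segP; right; rewrite h2 ltW.
Qed.

Lemma deltaE s t : delta theta s t = theta (val s) + theta (val t) - 2 * mt s t.
Proof. by []. Qed.

(* [gp] is the Gromov product based at the root, up to the height of the root.
   The point tau lies on [O, sigma] when gp tau sigma = hgt tau. *)
Definition hgt tau : R := theta (val (repr tau)).
Definition gp sigma tau : R := mt (repr sigma) (repr tau).

Lemma proj_repr tau : proj (repr tau) = tau :> T.
Proof. exact: reprK. Qed.

Lemma delta0P s t : delta theta s t = 0 <-> mt s t = theta (val s) /\ mt s t = theta (val t).
Proof.
have := mt_lel s t; have := mt_ler s t; rewrite deltaE => h1 h2.
by split => [|[]] *; [split|]; lra.
Qed.

Lemma projP s t : proj s = proj t :> T <-> delta theta s t = 0.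
Proof.
rewrite -mdist_proj; split => [->|]; first exact: mdistxx.
exact: mdist_positivity.
Qed.

Lemma delta_repr s : delta theta s (repr (proj s : T)) = 0.
Proof. by apply/projP; rewrite proj_repr. Qed.

Lemma hgt_proj s : hgt (proj s) = theta (val s).
Proof. by have /delta0P[<- ->] := delta_repr s. Qed.

Lemma gp_proj s t : gp (proj s) (proj t) = mt s t.
Proof.
(* It suffices to move one end point at a time within its class, and one inequality is enough by
   symmetry. *)
suff H s' t' u : delta theta s' t' = 0 -> mt s' u <= mt t' u.
  have ds := delta_repr s; have dt := delta_repr t.
  rewrite /gp; apply/eqP; rewrite eq_le; apply/andP; split.
    apply: (@le_trans _ _ (mt s (repr (proj t : T)))).
      by apply: H; rewrite delta_sym.
    by rewrite mt_sym [leRHS]mt_sym; apply: H; rewrite delta_sym.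
  apply: (@le_trans _ _ (mt s (repr (proj t : T)))); last exact: H.
  by rewrite mt_sym [leRHS]mt_sym; exact: H.
move=> /delta0P[h1 h2]; have := mt_ultra t' s' u; rewrite mt_sym h1.
by rewrite (min_idPr (mt_lel s' u)).
Qed.

Lemma gp_sym sigma tau : gp sigma tau = gp tau sigma.
Proof. exact: mt_sym. Qed.

Lemma gp_le sigma tau : gp sigma tau <= hgt sigma.
Proof. exact: mt_lel. Qed.

Lemma gp_ler sigma tau : gp sigma tau <= hgt tau.
Proof. exact: mt_ler. Qed.

Lemma gp_ultra sigma tau ups : Num.min (gp sigma tau) (gp tau ups) <= gp sigma ups.
Proof. exact: mt_ultra. Qed.

Lemma mdistE sigma tau : mdist sigma tau = hgt sigma + hgt tau - 2 * gp sigma tau.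
Proof. by []. Qed.

Lemma gpxx tau : gp tau tau = hgt tau.
Proof. by have := mdistxx tau; rewrite mdistE; lra. Qed.

Lemma gp_eq sigma tau : gp sigma tau = hgt sigma -> hgt sigma = hgt tau -> sigma = tau.
Proof. by move=> h1 h2; apply: (@mdist_positivity R); rewrite mdistE; lra. Qed.

Lemma rootP : exists2 U : time, rt = proj U & forall s, theta (val U) <= theta (val s).
Proof.
have [U hU] : exists U : time, forall s, theta (val U) <= theta (val s).
  have [c c01 hc] := @EVT_min R theta 0 1 ler01 (@cts_fun _ _ theta).
  by exists (exist _ c c01) => s; exact/hc/valP.
have h : [set U | forall s, theta (val U) <= theta (val s)] (xget (@time0 R)
    [set U | forall s, theta (val U) <= theta (val s)]) by apply: xgetPex; exists U.
by eexists; [reflexivity|exact: h].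
Qed.

Lemma root_le tau : hgt rt <= hgt tau.
Proof. by have [U -> hU] := rootP; rewrite -(proj_repr tau) !hgt_proj. Qed.

Lemma root_gp tau : gp rt tau = hgt rt.
Proof.
have [U -> hU] := rootP; apply/eqP; rewrite eq_le gp_le /=.
rewrite -(proj_repr tau) gp_proj hgt_proj; apply/mtP => y sy.
exact: (hU (exist _ y (seg_itv (valP _) (valP _) sy))).
Qed.

Lemma root_gp_le sigma tau : hgt rt <= gp sigma tau.
Proof.
have := gp_ultra sigma rt tau.
by rewrite gp_sym !root_gp minxx.
Qed.

(* the point of [w, e] closest to e where theta takes the value a *)
Lemma closest_level (w e : time) a : theta (val w) <= a <= theta (val e) ->
  exists2 u : time, seg (val w) (val e) (val u) & theta (val u) = a /\ mt u e = a.
Proof.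
move=> /andP[wa ae].
(* [u] will be the point of this compact set closest to [e]; strictly between [u] and [e] the path
   is above [a]. *)
pose K := seg (val w) (val e) `&` ctheta @^-1` [set y | y <= a].
have Kc : compact K.
  apply: compact_closedI; first exact: segment_compact.
  apply: preimage_closed => //.
  by move=> x _; exact: ctheta_continuous.
have K0 : K !=set0.
  by exists (val w); split; [exact: segl|rewrite /= cthetaE//; exact: valP].
have [|u] := @compact_EVT_min _ R (fun x => `|x - val e|) K K0 Kc.
  apply: continuous_subspaceT => x; apply: (@continuous_comp _ _ _ (fun x => x - val e) Num.norm).
    by apply: cvgB; [exact: cvg_id|exact: cvg_cst].
  exact: norm_continuous.
rewrite inE => -[su ua] hu.
have u01 := seg_itv (valP w) (valP e) su.
have hlt y : seg u (val e) y -> theta y <= a -> y = u.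
  move=> sy ya; have sy' := seg_sub su sy.
  have y01 := seg_itv (valP w) (valP e) sy'.
  have : y \in K by rewrite inE; split => //=; rewrite cthetaE.
  move=> /hu; move: sy => /segP[]/andP[? ?].
    by rewrite distrC [leRHS]distrC !ger0_norm ?subr_ge0//; lra.
  by rewrite !ger0_norm ?subr_ge0//; lra.
have ua' : theta u <= a by move: ua => /=; rewrite cthetaE.
(* The path takes the value [a] between [u] and [e], and by minimality it can only do so at [u]. *)
have tu : theta u = a.
  have : Num.min (ctheta (Num.min u (val e))) (ctheta (Num.max u (val e))) <= a
     <= Num.max (ctheta (Num.min u (val e))) (ctheta (Num.max u (val e))).
    have := valP e => e01.
    have [_|_] := leP u (val e); rewrite !cthetaE // ge_min le_max ua' ae ?orbT //.
  move=> /IVT[||c sc].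
  - by rewrite ge_min le_max lexx.
  - exact/continuous_subspaceT/ctheta_continuous.
  - have sc' : seg u (val e) c := sc.
    rewrite cthetaE; last exact: (seg_itv u01 (valP e)).
    by move=> ca; have := hlt c sc'; rewrite ca => /(_ (lexx _)) <-.
exists (exist _ u u01) => //; split => //.
apply/eqP; rewrite eq_le; apply/andP; split; first by rewrite -tu; exact: (mt_lel (exist _ u u01)).
apply/mtP => y sy; rewrite leNgt; apply/negP => ya.
by have := hlt y sy (ltW ya) => yu; move: ya; rewrite yu tu ltxx.
Qed.

Lemma anc_ex sigma a : hgt rt <= a <= hgt sigma ->
  exists tau, hgt tau = a /\ gp tau sigma = a.
Proof.
have [U -> hU] := rootP; rewrite -(proj_repr sigma) !hgt_proj => h.
have [u _ [h1 h2]] := closest_level h.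
by exists (proj u); rewrite hgt_proj gp_proj.
Qed.

(** The ancestor of [sigma] at height [a], that is, the point of [O, sigma] at this height. Clamping
    [a] makes it a total 1-Lipschitz function, hence a continuous parametrization of the branch. *)
Definition anc sigma a : T := xget rt
  [set tau | hgt tau = clamp (hgt rt) (hgt sigma) a /\
             gp tau sigma = clamp (hgt rt) (hgt sigma) a].

Lemma ancP sigma a : hgt (anc sigma a) = clamp (hgt rt) (hgt sigma) a /\
             gp (anc sigma a) sigma = clamp (hgt rt) (hgt sigma) a.
Proof.
have [tau htau] := anc_ex (clamp_itv a (root_le sigma)).
by rewrite /anc; case: xgetP => [t _|/(_ _ htau)].
Qed.

Lemma hgt_anc sigma a : hgt rt <= a <= hgt sigma -> hgt (anc sigma a) = a.
Proof. by move=> h; rewrite (ancP sigma a).1 clamp_id. Qed.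

Lemma gp_anc sigma a : hgt rt <= a <= hgt sigma -> gp (anc sigma a) sigma = a.
Proof. by move=> h; rewrite (ancP sigma a).2 clamp_id. Qed.

(** The branches [O, sigma] and [O, tau] coincide up to the height [gp sigma tau] and are disjoint
    above it. All distances between ancestors are read off from this formula. *)
Lemma gp_below sigma tau (s' t' : T) : gp s' sigma = hgt s' -> gp t' tau = hgt t' ->
  gp s' t' = Num.min (Num.min (hgt s') (hgt t')) (gp sigma tau).
Proof.
move=> h1 h2; apply/eqP; rewrite eq_le; apply/andP; split.
  rewrite !le_min gp_le gp_ler /=.
  have := gp_ultra sigma s' tau; apply: le_trans.
  rewrite le_min [gp sigma s']gp_sym h1 gp_le /=.
  have := gp_ultra s' t' tau; apply: le_trans.
  by rewrite le_min lexx h2 gp_ler.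
have := gp_ultra s' sigma t'; apply: le_trans.
rewrite le_min h1 !ge_min lexx /=.
have := gp_ultra sigma tau t'; rewrite [gp tau t']gp_sym h2 ge_min => /orP[h|h].
  by rewrite h !orbT.
by rewrite h !orbT.
Qed.

Lemma anc_unique sigma tau : gp tau sigma = hgt tau -> anc sigma (hgt tau) = tau.
Proof.
move=> h; have hr : hgt rt <= hgt tau <= hgt sigma.
  by rewrite root_le -h gp_ler.
have E := gp_below (etrans (gp_anc hr) (esym (hgt_anc hr))) h.
apply: gp_eq; rewrite ?hgt_anc // E gpxx hgt_anc // minxx.
by rewrite (min_idPl _) // -h gp_ler.
Qed.

Lemma mdist_anc sigma a b : `|clamp (hgt rt) (hgt sigma) a -
   clamp (hgt rt) (hgt sigma) b| = mdist (anc sigma a) (anc sigma b).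
Proof.
rewrite mdistE; have [h1 h1'] := ancP sigma a; have [h2 h2'] := ancP sigma b.
rewrite (gp_below (etrans h1' (esym h1)) (etrans h2' (esym h2))) gpxx h1 h2.
rewrite [Num.min _ (hgt sigma)](min_idPl _); last first.
  by rewrite ge_min; have /andP[_ ->] := clamp_itv a (root_le sigma).
have [|] := leP (clamp (hgt rt) (hgt sigma) a) (clamp (hgt rt) (hgt sigma) b) => h.
  by rewrite distrC ger0_norm ?subr_ge0//; lra.
by rewrite ger0_norm ?subr_ge0 1?ltW//; lra.
Qed.

Lemma arc_mdist sigma tau ups : arc sigma tau ups ->
  mdist sigma ups + mdist ups tau = mdist sigma tau.
Proof.
move=> [gam [g0 g1 giso [x xI <-]]]; set D := mdist sigma tau in g1 giso xI *.
have D0 : 0 <= D by exact: mdist_ge0.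
have xI' : x \in `[0, D] by [].
have /andP[x0 xD] : 0 <= x <= D by move: xI'; rewrite in_itv.
rewrite -{1}g0 -{1}g1 !giso ?in_itv /= ?lexx ?D0 ?x0 ?xD //.
by rewrite sub0r normrN ger0_norm // distrC ger0_norm ?subr_ge0//; lra.
Qed.

(** Ultrametricity leaves few possibilities for the order of the three branching heights, and in
    each of them the equivalence is linear arithmetic. *)
Lemma mdist_arcP sigma tau ups :
  mdist sigma ups + mdist ups tau = mdist sigma tau <->
  (gp ups sigma = hgt ups \/ gp ups tau = hgt ups) /\ gp sigma tau <= hgt ups.
Proof.
rewrite !mdistE [gp ups sigma]gp_sym; have := gp_ultra sigma ups tau.
have := gp_ultra sigma tau ups; have := gp_ultra ups sigma tau.
rewrite [gp tau ups]gp_sym [gp ups sigma]gp_sym !ge_min.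
have := gp_ler sigma ups; have := gp_le ups tau.
move: (gp sigma tau) (gp sigma ups) (gp ups tau) (hgt sigma) (hgt tau) (hgt ups) => A B C s t u.
move=> h1 h2 /orP h3 /orP h4 /orP h5.
split=> [E|[[]E le]].
- split; last lra.
  by case: h3 => ?; case: h4 => ?; case: h5 => ?; first [left; lra|right; lra].
- by case: h3 => ?; case: h4 => ?; case: h5 => ?; lra.
- by case: h3 => ?; case: h4 => ?; case: h5 => ?; lra.
Qed.

Lemma anc_hgt sigma : anc sigma (hgt sigma) = sigma.
Proof. by apply: anc_unique; exact: gpxx. Qed.

Lemma anc_gp sigma tau : anc sigma (gp sigma tau) = anc tau (gp sigma tau).
Proof.
have hs : hgt rt <= gp sigma tau <= hgt sigma by rewrite root_gp_le gp_le.
have ht : hgt rt <= gp sigma tau <= hgt tau by rewrite root_gp_le gp_ler.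
have E1 := etrans (gp_anc hs) (esym (hgt_anc hs)).
have E2 := etrans (gp_anc ht) (esym (hgt_anc ht)).
by apply: gp_eq; rewrite ?(gp_below E1 E2) !hgt_anc // !minxx.
Qed.

Lemma arcP sigma tau ups : arc sigma tau ups <->
  (gp ups sigma = hgt ups \/ gp ups tau = hgt ups) /\ gp sigma tau <= hgt ups.
Proof.
split=> [/arc_mdist/mdist_arcP//|[E le]].
(* The arc descends from [sigma] to the branching point, over a length [L], and then climbs along
   [O, tau]. *)
pose L := hgt sigma - gp sigma tau; pose m := gp sigma tau.
pose gam (x : R) := if x <= L then anc sigma (hgt sigma - x) else anc tau (m + (x - L)).
have Lr := gp_le sigma tau; have Mr := gp_ler sigma tau.
have rl := root_gp_le sigma tau.
have DE : mdist sigma tau = L + (hgt tau - m) by rewrite mdistE /L /m; lra.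
exists gam; split.
- by rewrite /gam /L subr_ge0 Lr subr0 anc_hgt.
- rewrite /gam DE; case: ifPn => [h|_].
    have -> : hgt sigma - (L + (hgt tau - m)) = gp sigma tau by rewrite /L /m in h *; lra.
    have em : hgt tau = gp sigma tau by rewrite /L /m in h; lra.
    by rewrite anc_gp -em anc_hgt.
  by have -> : m + (L + (hgt tau - m) - L) = hgt tau; [lra|rewrite anc_hgt].
- have key a b : a \in `[0, mdist sigma tau] -> b \in `[0, mdist sigma tau] -> a <= b ->
     mdist (gam a) (gam b) = `|a - b|.
    rewrite DE !in_itv /= => /andP[a0 a1] /andP[b0 b1] ab.
    rewrite /gam; case: ifPn => [aL|]; last rewrite -ltNge => aL.
      case: ifPn => [bL|].
        rewrite -mdist_anc !clamp_id; [|by rewrite /L /m in aL bL *; lra..].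
        by rewrite [RHS]distrC; congr `|_|; lra.
      rewrite -ltNge => bL.
      have h1 : hgt rt <= hgt sigma - a <= hgt sigma by rewrite /L /m in aL bL *; lra.
      have h2 : hgt rt <= m + (b - L) <= hgt tau by rewrite /L /m in aL bL b1 *; lra.
      rewrite mdistE.
      rewrite (gp_below (etrans (gp_anc h1) (esym (hgt_anc h1))) (etrans (gp_anc h2) (esym (hgt_anc h2)))).
      rewrite !hgt_anc // (min_idPr _); last by rewrite le_min; rewrite /L /m in aL bL *; apply/andP; split; lra.
      by rewrite distrC ger0_norm ?subr_ge0// /L /m; lra.
    have bL : L < b by exact: lt_le_trans ab.
    rewrite leNgt bL /= -mdist_anc !clamp_id; [|by rewrite /L /m in aL bL a1 b1 *; lra..].
    by congr `|_|; lra.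
  move=> a b aI bI; have [ab|/ltW ba] := leP a b; first exact: key.
  by rewrite metric_sym distrC; exact: key.
- have ru := root_le ups.
  case: E => E.
    exists (hgt sigma - hgt ups).
      rewrite /= in_itv /= DE subr_ge0 -{1}E gp_ler /=.
      by rewrite /L /m; have := Mr; lra.
    rewrite /gam /L ifT; last lra.
    by rewrite subKr anc_unique.
  have hu : hgt ups <= hgt tau by rewrite -E gp_ler.
  exists (L + (hgt ups - m)).
    by rewrite /= in_itv /= DE /L /m; apply/andP; split; lra.
  rewrite /gam; case: ifPn => h.
    have em : hgt ups = gp sigma tau by rewrite /L /m in h; lra.
    have -> : hgt sigma - (L + (hgt ups - m)) = gp sigma tau by rewrite /L /m; lra.
    by rewrite anc_gp -em anc_unique.
  have -> : m + (L + (hgt ups - m) - L) = hgt ups by lra.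
  by rewrite anc_unique.
Qed.

Lemma arc_rootP sigma tau : arc rt sigma tau <-> gp tau sigma = hgt tau.
Proof.
rewrite arcP root_gp; split=> [[[]//]|h].
  rewrite gp_sym root_gp => h _; have : gp rt tau = hgt rt by exact: root_gp.
  move=> h2; have <- : rt = tau by apply: gp_eq.
  by rewrite root_gp.
by split; [right|exact: root_le].
Qed.

Lemma arc_anc sigma a b tau : hgt rt <= a -> a <= b -> b <= hgt sigma ->
  arc (anc sigma a) (anc sigma b) tau <-> gp tau sigma = hgt tau /\ a <= hgt tau <= b.
Proof.
move=> ra ab bs.
have ha : hgt rt <= a <= hgt sigma by rewrite ra (le_trans ab).
have hb : hgt rt <= b <= hgt sigma by rewrite bs (le_trans ra).
have Ea := etrans (gp_anc ha) (esym (hgt_anc ha)).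
have Eb := etrans (gp_anc hb) (esym (hgt_anc hb)).
rewrite arcP (gp_below Ea Eb) gpxx !hgt_anc // [Num.min (Num.min _ _) _](min_idPl _); last first.
  by rewrite ge_min (le_trans ab).
rewrite (min_idPl ab).
have H c : hgt rt <= c <= hgt sigma ->
   gp tau (anc sigma c) = hgt tau -> gp tau sigma = hgt tau /\ hgt tau <= c.
  move=> hc h; split; last by rewrite -(hgt_anc hc) -h gp_ler.
  apply/eqP; rewrite eq_le gp_le -{1}h /=.
  have := gp_ultra tau (anc sigma c) sigma; apply: le_trans.
  by rewrite le_min lexx gp_anc // -[X in _ <= X](hgt_anc hc) gp_ler.
split=> [[[]/H[]// + + h]|[h /andP[h1 h2]]].
- by move=> -> h'; rewrite h (le_trans h').
- by move=> -> h'; rewrite h.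
- split=> //; right; rewrite (gp_below h Eb) hgt_anc // gpxx (min_idPl h2).
  by rewrite (min_idPl _) // -h gp_ler.
Qed.

Lemma nonleafP tau : ~ leaves theta tau <-> exists2 sigma, gp tau sigma = hgt tau & hgt tau < hgt sigma.
Proof.
split=> [|[sigma h lt] /(_ sigma)]; last first.
  by apply; [move=> e; move: lt; rewrite e ltxx|apply/arc_rootP].
move=> /existsNP[sigma] /not_implyP[ne] /contrapT/arc_rootP h.
exists sigma => //; rewrite lt_neqAle -{2}h gp_ler andbT.
by apply/eqP => e; apply: ne; apply/esym/gp_eq.
Qed.

End TreeGeometry.

(** * Measurability and the length measure *)

Section LebesgueIntervals.
Context {R : realType}.
Local Notation leb := (@lebesgue_measure R).

Lemma leb_closed_itv (a b : R) : a <= b -> leb `[a, b]%classic = (b - a)%:E.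
Proof.
rewrite lebesgue_measure_itv /= lte_fin le_eqVlt => /orP[/eqP ->|->].
  by rewrite ltxx subrr.
by rewrite EFinB.
Qed.

(** The uniqueness of Lebesgue measure concerns measures on the whole line: [m] is therefore
    completed by Lebesgue measure outside [0, h]. *)
Lemma closed_itv_lebesgue (m : {measure set (measurableTypeR R) -> \bar R}) (h : R) :
  0 <= h ->
  (forall u v : R, 0 <= u -> u <= v -> v <= h -> m `[u, v]%classic = (v - u)%:E) ->
  forall B : set (measurableTypeR R), measurable B -> B `<=` `[0, h] -> m B = leb B.
Proof.
move=> h0 mE B mB B0h.
have mh : measurable (`[0%R, h] : set (measurableTypeR R)) by exact: measurable_itv.
have mhC : measurable (~` `[0%R, h] : set (measurableTypeR R)) by exact: measurableC.
pose m1 := measure_add (mrestr m mh) (mrestr leb mhC).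
have key (u v : R) (b : bool) (m' : {measure set (measurableTypeR R) -> \bar R}) :
    (forall u v : R, 0 <= u -> u <= v -> v <= h -> m' `[u, v]%classic = (v - u)%:E) ->
    0 <= u -> u <= v -> v <= h ->
    m' [set` Interval (BSide b u) (BRight v)] = (v - u)%:E.
  move=> m'E u0 uv vh; case: b => //; first exact: m'E.
  have := m'E u v u0 uv vh; rewrite -(@setU1itv _ _ (BRight v) u false) ?bnd_simp//= measureU //.
  - have := m'E u u u0 (lexx u) (le_trans uv vh); rewrite set_itv1 subrr => m0.
    by move=> <-; rewrite -[LHS]add0e; congr (_ + _)%E; exact: esym m0.
  - by apply/seteqP; split => x //= -[->]; rewrite in_itv /= ltxx.
have m1E : forall X, ocitv X -> leb X = m1 X.
  move=> _ [[x y] _ <-] /=.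
  rewrite /m1 measure_addE /= /mrestr.
  have mxy : measurable (`]x, y] : set (measurableTypeR R)) by exact: measurable_itv.
  rewrite [LHS](measureDI _ mxy mh) addeC setDE; congr (_ + _).
  have [yx|xy] := leP y x.
    by rewrite set_itv_ge ?set0I ?measure0 // bnd_simp -leNgt.
  have [y0|y0] := ltP y 0.
    rewrite (_ : _ `&` _ = set0) ?measure0 //.
    by apply/seteqP; split => z //= []; rewrite !in_itv /= => /andP[_ ?] /andP[? _]; lra.
  have [hx|xh] := leP h x.
    rewrite (_ : _ `&` _ = set0) ?measure0 //.
    by apply/seteqP; split => z //= []; rewrite !in_itv /= => /andP[? _] /andP[_ ?]; lra.
  have lebE : forall u v : R, 0 <= u -> u <= v -> v <= h -> leb `[u, v]%classic = (v - u)%:E.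
    by move=> u v _ uv _; exact: leb_closed_itv.
  have [x0|x0] := ltP x 0.
    rewrite (_ : _ `&` _ = [set` Interval (BLeft 0) (BRight (Num.min y h))]).
      have h2 : 0 <= Num.min y h by rewrite le_min y0.
      have h3 : Num.min y h <= h by rewrite ge_min lexx orbT.
      by apply: (etrans (key 0 _ true leb lebE (lexx 0) h2 h3)); symmetry; apply: key.
    apply/seteqP; split => z /=; rewrite !in_itv /= ?le_min; first by move=> [/andP[_ ->]].
    by move=> /andP[z0 /andP[-> ->]]; rewrite z0 (lt_le_trans x0 z0).
  rewrite (_ : _ `&` _ = [set` Interval (BRight x) (BRight (Num.min y h))]).
    have h2 : x <= Num.min y h by rewrite le_min !ltW.
    have h3 : Num.min y h <= h by rewrite ge_min lexx orbT.
    by apply: (etrans (key x _ false leb lebE x0 h2 h3)); symmetry; apply: key.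
  apply/seteqP; split => z /=; rewrite !in_itv /= ?le_min; first by move=> [/andP[-> ->] /andP[_ ->]].
  by move=> /andP[z0 /andP[-> ->]]; rewrite z0 (le_trans x0 (ltW z0)).
have -> : leb B = m1 B by exact: (lebesgue_measure_unique m1E mB).
rewrite /m1 measure_addE /= /mrestr.
rewrite (_ : B `&` ~` _ = set0) ?measure0 ?adde0; last by apply/disjoints_subset; rewrite setCK.
by rewrite setIidl.
Qed.

End LebesgueIntervals.

Section PushMeasure.
Context {R : realType} d1 d2 (T1 : measurableType d1) (T2 : measurableType d2).
Variables (m : {measure set T1 -> \bar R}) (f : T1 -> T2).
Hypothesis mf : measurable_fun [set: T1] f.

Definition push_measure : {measure set T2 -> \bar R}.
Proof.
by refine (HB.pack_for {measure set T2 -> \bar R} (pushforward m f)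
  (Measure.on (pushforward m f))).
Defined.

Lemma push_measureE : push_measure = pushforward m f :> (set T2 -> \bar R).
Proof. by []. Qed.

End PushMeasure.

Section MetricLipschitz.
Context {R : realType} (M : metricType R).

Lemma lip_continuous (f : M -> R) :
  (forall x y, `|f x - f y| <= mdist x y) -> continuous f.
Proof.
move=> lf x; apply/cvg_ballP => e e0.
have : nbhs x (ball x e) by exact: nbhsx_ballx.
apply: filterS => y; rewrite ballEmdist /= => h.
by rewrite /ball /=; exact: le_lt_trans (lf _ _) h.
Qed.

Lemma lip_continuousR (f : R -> M) :
  (forall x y, mdist (f x) (f y) <= `|x - y|) -> continuous f.
Proof.
move=> lf x; apply/cvg_ballP => e e0.
have : nbhs x (ball x e) by exact: nbhsx_ballx.
apply: filterS => y; rewrite {1}/ball /= => h.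
by rewrite ballEmdist /=; exact: le_lt_trans (lf _ _) h.
Qed.

End MetricLipschitz.

Section TreeMeasurable.
Context {R : realType}.
Variable theta : cpath R R.
Local Notation T := (tree theta).
Local Notation BT := (btree theta).
Local Notation arc := (@Defs.arc R theta).
Local Notation hgt := (@hgt R theta).
Local Notation rt := (Defs.root theta).
Implicit Types (sigma tau ups : T) (x y z a : R).

Lemma hgt_lip sigma tau : `|hgt sigma - hgt tau| <= mdist sigma tau.
Proof.
rewrite mdistE ler_norml; have := gp_le sigma tau; have := gp_ler sigma tau.
by move=> *; apply/andP; split; lra.
Qed.

Lemma gp_lip sigma tau ups : `|gp sigma ups - gp tau ups| <= mdist sigma tau.
Proof.
have h1 := metric_triangle sigma tau ups.
have h2 := metric_triangle tau sigma ups.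
rewrite !mdistE [gp tau sigma]gp_sym in h1 h2 *.
have g1 := gp_le sigma tau; have g2 := gp_ler sigma tau.
by rewrite ler_norml; apply/andP; split; lra.
Qed.

Lemma hgt_continuous : continuous hgt.
Proof. by apply: lip_continuous; exact: hgt_lip. Qed.

Lemma gp_continuous sigma : continuous (fun tau => gp tau sigma).
Proof. by apply: lip_continuous => *; exact: gp_lip. Qed.

Lemma anc_continuous sigma : continuous (anc sigma).
Proof.
apply: lip_continuousR => x y; rewrite -mdist_anc.
by apply: clamp_lip; exact: root_le.
Qed.

Lemma btree_open (A : set BT) : open (A : set T) -> measurable A.
Proof. by move=> oA; apply: sub_sigma_algebra. Qed.

Lemma btree_closed (A : set BT) : closed (A : set T) -> measurable A.
Proof.
by move=> cA; rewrite -[A]setCK; apply: measurableC; apply: btree_open; exact: closed_openC.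
Qed.

Lemma cont_measurable (f : T -> R) : continuous f ->
  measurable_fun [set: BT] (f : BT -> R).
Proof.
move=> cf; apply: (measurability _ (RGenOInfty.measurableE R)).
move=> _ [_ [x ->] <-]; rewrite setTI; apply: btree_open.
by have /continuousP := cf; apply; exact: interval_open.
Qed.

Lemma contR_measurable (f : R -> T) : continuous f ->
  measurable_fun [set: measurableTypeR R] (f : R -> BT).
Proof.
move=> cf; apply: (@measurability _ _ _ BT _ _ (@open T)) => //.
move=> _ [A oA <-]; rewrite setTI; apply: open_measurable.
by have /continuousP := cf; apply.
Qed.

Lemma hgt_measurable : measurable_fun [set: BT] (hgt : BT -> R).
Proof. by apply: cont_measurable; exact: hgt_continuous. Qed.

Lemma anc_measurable sigma : measurable_fun [set: measurableTypeR R] (anc sigma : R -> BT).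
Proof. by apply: contR_measurable; exact: anc_continuous. Qed.

(** The branch [O, sigma]; [leg] is the part of it between two heights. *)
Definition below sigma : set BT := [set tau | gp tau sigma = hgt tau].
Definition leg sigma x y : set BT := below sigma `&` (hgt @^-1` `[x, y]).

Lemma below_measurable sigma : measurable (below sigma).
Proof.
apply: btree_closed.
have -> : below sigma = (fun tau : T => (gp tau sigma - hgt tau) / 2) @^-1` [set 0].
  by apply/seteqP; split => tau /=; rewrite /below /= => h; lra.
apply: preimage_closed; last exact: closed_eq.
suff : continuous (fun tau : T => (gp tau sigma - hgt tau) / 2) by move=> h tau _; exact: h.
apply: lip_continuous => ups tau.
have := gp_lip ups tau sigma; have := hgt_lip ups tau.
by rewrite !ler_norml => /andP[? ?] /andP[? ?]; apply/andP; split; lra.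
Qed.

Lemma leg_measurable sigma x y : measurable (leg sigma x y).
Proof.
apply: measurableI; first exact: below_measurable.
by rewrite -[X in measurable X]setTI; apply: hgt_measurable.
Qed.

Lemma leg_arc sigma x y : hgt rt <= x -> x <= y -> y <= hgt sigma ->
  leg sigma x y = arc (anc sigma x) (anc sigma y).
Proof.
move=> h1 h2 h3; apply/seteqP; split => tau.
  by rewrite /leg /= in_itv /= => ?; apply/arc_anc.
by move/arc_anc => /(_ h1 h2 h3); rewrite /leg /= in_itv.
Qed.

Lemma arc_measurable sigma tau : measurable (arc sigma tau : set BT).
Proof.
have -> : arc sigma tau = (below sigma `|` below tau) `&` (hgt @^-1` `[gp sigma tau, +oo[).
  apply/seteqP; split => ups /=; first by move=> /arcP; rewrite in_itv /= andbT.
  by rewrite in_itv /= andbT => h; apply/arcP.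
apply: measurableI; first by apply: measurableU; exact: below_measurable.
by rewrite -[X in measurable X]setTI; apply: hgt_measurable.
Qed.

End TreeMeasurable.

(** * Integration along a branch *)

Section LegIntegral.
Context {R : realType}.
Variable theta : cpath R R.
Local Notation T := (tree theta).
Local Notation BT := (btree theta).
Local Notation hgt := (@hgt R theta).
Local Notation rt := (Defs.root theta).
Local Notation leb := (@lebesgue_measure R).
Variable lam : {measure set BT -> \bar R}.
Hypothesis hlam : is_length_measure lam.
Implicit Types (sigma tau ups : T) (x y z a : R).

Lemma lam_leg sigma x y : hgt rt <= x -> x <= y -> y <= hgt sigma ->
  lam (leg sigma x y) = (y - x)%:E.
Proof.
move=> h1 h2 h3; rewrite leg_arc // hlam.2 -mdist_anc !clamp_id; last 2 first.
- by rewrite (le_trans h1).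
- by rewrite h1 (le_trans h2).
by rewrite distrC ger0_norm // subr_ge0.
Qed.

Section Psi.
Variables (sigma : T) (b h : R).
Hypotheses (hb : hgt rt <= b) (h0 : 0 <= h) (hbh : b + h <= hgt sigma).

(** The height above the base of the leg. The value -1 lies outside [0, h], so that preimages of
    subintervals of [0, h] are legs. *)
Let psi (tau : BT) : measurableTypeR R :=
  if `[< leg sigma b (b + h) tau >] then hgt tau - b else -1.

Let mpsi : measurable_fun [set: BT] psi.
Proof.
apply: measurable_fun_ifT.
- apply: (measurable_fun_bool true) => //.
  rewrite (_ : _ @^-1` _ = leg sigma b (b + h)); last first.
    by apply/seteqP; split => tau /=; move=> /asboolP.
  by rewrite setTI; exact: leg_measurable.
- by apply: measurable_funB; [exact: hgt_measurable|exact: measurable_cst].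
- exact: measurable_cst.
Qed.

Let psi_itv u v : 0 <= u -> u <= v -> v <= h ->
  psi @^-1` `[u, v] = leg sigma (b + u) (b + v).
Proof.
move=> u0 uv vh; apply/seteqP; split => tau; rewrite /psi /=.
  case: asboolP => [[h1 h2]|_]; rewrite !in_itv /=; last by move=> /andP[]; lra.
  by move=> /andP[h3 h4]; split => //=; rewrite in_itv /=; apply/andP; split; lra.
move=> [h1] /=; rewrite in_itv /= => /andP[h2 h3].
rewrite asboolT; last by split => //=; rewrite in_itv /=; apply/andP; split; lra.
by rewrite in_itv /=; apply/andP; split; lra.
Qed.

Let phi r : BT := anc sigma (b + r).

Let phi_psi tau : leg sigma b (b + h) tau -> phi (psi tau) = tau.
Proof.
move=> l; rewrite /psi asboolT // /phi addrC subrK anc_unique //.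
by case: l.
Qed.

Let push_leb (B : set (measurableTypeR R)) : measurable B -> B `<=` `[0, h] ->
  pushforward lam psi B = leb B.
Proof.
apply: (closed_itv_lebesgue (m := push_measure lam mpsi) h0) => u v u0 uv vh.
rewrite push_measureE /pushforward psi_itv // lam_leg ?(le_trans hb) ?lerDl ?lerD2l //.
  by congr EFin; lra.
by rewrite (le_trans _ hbh) // lerD2l.
Qed.

Let mphi : measurable_fun [set: measurableTypeR R] phi.
Proof.
apply: (@measurableT_comp _ _ _ _ _ _ (anc sigma : R -> BT) _ (fun r : measurableTypeR R => b + r)).
  exact: anc_measurable.
by apply: measurable_funD; [exact: measurable_cst|exact: measurable_id].
Qed.

Let psi_leg : psi @^-1` `[0, h] = leg sigma b (b + h).
Proof. by rewrite psi_itv ?addr0. Qed.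

(** On a leg, height and [anc] are inverse to each other, and height carries the length measure to
    Lebesgue measure because it does so on arcs. *)
Lemma ge0_leg_integral (f : BT -> \bar R) : measurable_fun setT f ->
  (forall tau, (0 <= f tau)%E) ->
  (\int[lam]_(tau in leg sigma b (b + h)) f tau =
   \int[leb]_(r in `[0%R, h]) f (anc sigma (b + r)%R))%E.
Proof.
move=> mf f0.
have mfphi : measurable_fun [set: measurableTypeR R] (f \o phi) by exact: measurableT_comp.
transitivity (\int[lam]_(tau in psi @^-1` `[0%R, h]) ((f \o phi) \o psi) tau)%E.
  by rewrite psi_leg; apply: eq_integral => tau; rewrite inE => l /=; rewrite phi_psi.
rewrite -(@ge0_integral_pushforward _ _ _ _ _ psi mpsi lam `[0, h]%classic (f \o phi)) //.
- by apply: eq_measure_integral => B mB Bh; exact: push_leb.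
- by apply: measurable_funTS.
- by move=> r _; exact: f0.
Qed.

Lemma leg_integral (f : BT -> \bar R) : measurable_fun setT f ->
  lam.-integrable (leg sigma b (b + h)) f ->
  (\int[lam]_(tau in leg sigma b (b + h)) f tau =
   \int[leb]_(r in `[0%R, h]) f (anc sigma (b + r)%R))%E.
Proof.
move=> mf fi.
have mfphi : measurable_fun [set: measurableTypeR R] (f \o phi) by exact: measurableT_comp.
have E : {in leg sigma b (b + h), f =1 ((f \o phi) \o psi)}.
  by move=> tau; rewrite inE => l /=; rewrite phi_psi.
transitivity (\int[lam]_(tau in psi @^-1` `[0%R, h]) ((f \o phi) \o psi) tau)%E.
  by rewrite psi_leg; apply: eq_integral.
rewrite -(@integral_pushforward _ _ _ _ _ psi mpsi lam `[0, h]%classic (f \o phi)) //.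
- by apply: eq_measure_integral => B mB Bh; exact: push_leb.
- by rewrite psi_leg; apply: eq_integrable fi => //; exact: leg_measurable.
Qed.

End Psi.

End LegIntegral.

(** * A dense sequence of points of the tree *)

Section DenseSequence.
Context {R : realType}.
Variable theta : cpath R R.
Local Notation T := (tree theta).
Local Notation proj := (@Defs.proj R theta).
Local Notation hgt := (@hgt R theta).

Definition tproj (x : R) : T := proj (pt x).

Lemma tproj_continuous : continuous tproj.
Proof.
move=> x; apply/cvg_ballP => e e0.
have e4 : 0 < e / 4 by lra.
have /cvg_ballP/(_ _ e4) := @ctheta_continuous _ theta (clamp 0 1 x).
rewrite /= => -[eta /= eta0 hz].
have : nbhs x (ball x eta) by exact: nbhsx_ballx.
apply: filterS => y; rewrite {1}/ball /= => xy.
rewrite ballEmdist /=.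
have zE w : seg (clamp 0 1 x) (clamp 0 1 y) w -> `|theta (clamp 0 1 x) - theta w| < e / 4.
  move=> sw; have w01 := seg_itv (clamp01 x) (clamp01 y) sw.
  have := hz w; rewrite /ball /= !cthetaE ?clamp01 //; apply.
  have := clamp_lip x y (@ler01 R) => hc.
  apply: le_lt_trans xy; apply: le_trans hc.
  by move: sw => /segP[]/andP[? ?];
    [rewrite distrC [leRHS]distrC|]; rewrite !ger0_norm ?subr_ge0//; lra.
rewrite mdistE !hgt_proj gp_proj /=.
have h1 : theta (clamp 0 1 x) - e / 4 <= mt theta (pt x) (pt y).
  by apply/mtP => w /zE; rewrite ltr_norml => /andP[? ?]; lra.
have := zE _ (segr _ _); rewrite ltr_norml => /andP[? ?]; lra.
Qed.

Definition dseq (i : nat) : T :=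
  tproj (if (unpickle i : option rat) is Some q then ratr q else 0).

(** A rational time close to a time of [sigma] provides [i]. Consequently every point that is not a
    leaf lies on the branch of some [dseq i], and unions over all branches become countable. *)
Lemma dseq_dense (sigma : T) (a : R) : a < hgt sigma -> exists i, a < gp (dseq i) sigma.
Proof.
move=> ah; pose x := val (repr sigma).
have sE : tproj x = sigma by rewrite /tproj pt_val proj_repr.
have e0 : 0 < hgt sigma - a by lra.
have /cvg_ballP/(_ _ e0) := @tproj_continuous x.
rewrite /= => -[eta /= eta0 hz].
have [q] : exists q, ratr q \in `]x - eta, x + eta[ by apply: rat_in_itvoo; lra.
rewrite in_itv /= => /andP[q1 q2].
exists (pickle q); rewrite /dseq pickleK.
have := hz (ratr q); rewrite sE ballEmdist /= => h.
have : mdist sigma (tproj (ratr q)) < hgt sigma - a.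
  by apply: h; rewrite /= ltr_norml; apply/andP; split; lra.
rewrite mdistE [gp sigma _]gp_sym.
by have := gp_le (tproj (ratr q)) sigma; lra.
Qed.

End DenseSequence.

(** * Existence of the length measure *)

Section LengthExistence.
Context {R : realType}.
Variable theta : cpath R R.
Local Notation T := (tree theta).
Local Notation BT := (btree theta).
Local Notation arc := (@Defs.arc R theta).
Local Notation hgt := (@hgt R theta).
Local Notation rt := (Defs.root theta).
Local Notation leb := (@lebesgue_measure R).
Local Notation E := (dseq theta).
Implicit Types (sigma tau ups : T) (x y z a : R).

(* The levels of the points of [O, E i) that lie on no [O, E j) with j < i. *)
Definition new_levels (i : nat) : set (measurableTypeR R) :=
  `[hgt rt, hgt (E i)[ `&` \bigcap_(j < i) (`]gp (E i) (E j), +oo[ `|` `[hgt (E j), +oo[).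

Lemma new_levels_measurable i : measurable (new_levels i).
Proof.
apply: measurableI; first exact: measurable_itv.
apply: bigcap_measurableType => j _; apply: measurableU; exact: measurable_itv.
Qed.

(** Lebesgue measure on the new levels, carried to [O, E i]: the branches are glued without counting
    their common parts twice. *)
Definition branch_measure (i : nat) : {measure set BT -> \bar R} :=
  push_measure (mrestr leb (new_levels_measurable i)) (anc_measurable (E i)).

Definition tree_length : {measure set BT -> \bar R} := mseries branch_measure 0.

Lemma tree_lengthE (A : set BT) :
  tree_length A = (\sum_(0 <= i <oo) leb (anc (E i) @^-1` A `&` new_levels i))%E.
Proof. by []. Qed.

Lemma new_levelsP i a : new_levels i a ->
  [/\ hgt (anc (E i) a) = a, a < hgt (E i) & forall j, (j < i)%N -> gp (E i) (E j) < a \/ hgt (E j) <= a].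
Proof.
move=> [/=]; rewrite in_itv /= => /andP[h1 h2] h3; split => //.
  by rewrite hgt_anc // h1 ltW.
by move=> j ji; case: (h3 j ji) => /=; rewrite in_itv /= andbT; [left|right].
Qed.

(** A level of [x, y) is counted exactly once, by the first [E i] whose branch passes strictly
    beyond the point of [O, sigma] at that level. The top level [y] may be missed, which is
    negligible. *)
Lemma tree_length_leg sigma x y : hgt rt <= x -> x <= y -> y <= hgt sigma ->
  tree_length (leg sigma x y) = (y - x)%:E.
Proof.
move=> rx xy ys; rewrite tree_lengthE.
pose D i : set (measurableTypeR R) := anc (E i) @^-1` (leg sigma x y) `&` new_levels i.
have mD i : measurable (D i).
  apply: measurableI; last exact: new_levels_measurable.
  by rewrite -[X in measurable X]setTI; apply: anc_measurable => //; exact: leg_measurable.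
have DE i a : D i a <-> [/\ new_levels i a, x <= a <= y & a <= gp (E i) sigma].
  split=> [[[h1 h2] nl]|[nl h1 h2]].
    have [ha alt _] := new_levelsP nl.
    move: h2; rewrite /= in_itv /= ha => h2; split => //.
    have ra : hgt rt <= a <= hgt (E i) by case/andP: h2 => h2 _; rewrite (le_trans rx h2) ltW.
    move: h1; rewrite /below /= ha => h1.
    rewrite -h1; have := gp_ultra (E i) (anc (E i) a) sigma.
    by rewrite gp_sym gp_anc // h1 minxx.
  have [ha alt _] := new_levelsP nl.
  have ra : hgt rt <= a <= hgt (E i) by case/andP: h1 => h1 _; rewrite (le_trans rx h1) ltW.
  split => //; split; last by rewrite /= in_itv /= ha.
  rewrite /below /= ha (gp_below (etrans (gp_anc ra) (esym (hgt_anc ra))) (gpxx sigma)) ha.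
  by rewrite -minA (min_idPl _) // le_min h2 (le_trans h2 (gp_ler _ _)).
have tD : trivIset setT D.
  suff H i j a : (i < j)%N -> D i a -> D j a -> False.
    apply/trivIsetP => i j _ _; rewrite neq_ltn => /orP[ij|ji].
      by apply/seteqP; split => a //= [h1 h2]; exact: H ij h1 h2.
    by apply/seteqP; split => a //= [h1 h2]; exact: H ji h2 h1.
  move=> ij /DE[n1 h1 g1] /DE[n2 h2 g2].
  have [_ a1 _] := new_levelsP n1; have [_ _ /(_ _ ij)] := new_levelsP n2.
  have := gp_ultra (E j) sigma (E i); rewrite [gp sigma _]gp_sym.
  have : a <= Num.min (gp (E j) sigma) (gp (E i) sigma) by rewrite le_min g1 g2.
  by move=> q1 q2 [q3|q3]; [have := le_lt_trans (le_trans q1 q2) q3|have := le_lt_trans q3 a1]; rewrite ltxx.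
transitivity (leb (\bigcup_i D i)).
  by rewrite (@measure_semi_bigcup _ _ _ leb D) //; exact: bigcup_measurable.
have h1 : `[x, y[ `<=` \bigcup_i D i.
  move=> a /=; rewrite in_itv /= => /andP[xa ay].
  pose P i := (a <= gp (E i) sigma) && (a < hgt (E i)).
  have exP : exists i, P i.
    have [i hi] := dseq_dense (lt_le_trans ay ys).
    by exists i; rewrite /P (ltW hi) (lt_le_trans hi (gp_le _ _)).
  case: (ex_minnP exP) => i /andP[ai1 ai2] imin; exists i => //.
  apply/DE; split; rewrite ?xa ?(ltW ay) //.
  split => /=; first by rewrite in_itv /= (le_trans rx xa).
  move=> j /= ji; have [h|h] := ltP a (hgt (E j)); last by right; rewrite /= in_itv /= h.
  left; rewrite /= in_itv /= andbT ltNge; apply/negP => h'.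
  suff : P j by move=> /imin; rewrite leqNgt ji.
  rewrite /P h andbT; have := gp_ultra (E j) (E i) sigma; apply: le_trans.
  by rewrite le_min gp_sym h' ai1.
have h2 : \bigcup_i D i `<=` `[x, y].
  by move=> a [i _ /DE[_ ? _]] /=; rewrite in_itv.
have mU : measurable (\bigcup_i D i) by exact: bigcup_measurable.
apply/eqP; rewrite eq_le; apply/andP; split.
  rewrite -leb_closed_itv //; apply: le_measure => //; rewrite inE //.
have -> : (y - x)%:E = leb `[x, y[%classic.
  rewrite lebesgue_measure_itv /= lte_fin.
  by move: xy; rewrite le_eqVlt => /orP[/eqP ->|->]; rewrite ?ltxx ?subrr // EFinB.
by apply: le_measure => //; rewrite inE //; exact: measurable_itv.
Qed.

(** [leg tau m m] is the branching point, which already belongs to the leg of [sigma]. *)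
Lemma arc_legs sigma tau (m := gp sigma tau) : arc sigma tau =
  leg sigma m (hgt sigma) `|` (leg tau m (hgt tau) `\` leg tau m m).
Proof.
apply/seteqP; split => ups.
  move=> /arcP[[h|h] hm].
    by left; split => //=; rewrite in_itv /= hm -{1}h gp_ler.
  have [e|ne] := eqVneq (hgt ups) m.
    left; split; last by rewrite /= in_itv /= e lexx gp_le.
    rewrite /below /=; apply/eqP; rewrite eq_le gp_le /=.
    have := gp_ultra ups tau sigma; apply: le_trans.
    by rewrite h le_min lexx gp_sym e /=.
  right; split.
    by split => //=; rewrite in_itv /= hm -{1}h gp_ler.
  by move=> [_ /=]; rewrite in_itv /= => /andP[_ h']; move: ne; rewrite eq_le h' hm.
move=> [[h h']|[[h h'] _]]; move: h'; rewrite /= in_itv /= => /andP[h1 h2]; apply/arcP; split => //.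
  by left.
by right.
Qed.

Lemma arc_legs_disjoint sigma tau (m := gp sigma tau) :
  leg sigma m (hgt sigma) `&` (leg tau m (hgt tau) `\` leg tau m m) = set0.
Proof.
apply/seteqP; split => ups //= -[[h1 _] [[h2 h3] h4]]; apply: h4; split => //=.
move: h3; rewrite /= !in_itv /= => /andP[-> _] /=.
have := gp_ultra sigma ups tau; apply: le_trans.
by rewrite gp_sym h1 h2 minxx.
Qed.

Lemma length_exists : is_length_measure tree_length.
Proof.
split.
  (* New levels lie strictly below the height of [E i], so that the corresponding points are not
     leaves. *)
  rewrite tree_lengthE eseries0 // => i _ _.
  rewrite (_ : _ `&` _ = set0) ?measure0 //.
  apply/seteqP; split => a //= [lf nl].
  have [ha alt _] := new_levelsP nl.
  have [/= + _] := nl; rewrite in_itv /= => ra; apply: (nonleafP (anc (E i) a)).2 lf.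
  by exists (E i); rewrite ha // gp_anc // (andP ra).1 ltW.
move=> sigma tau; set m := gp sigma tau.
have rm : hgt rt <= m := root_gp_le sigma tau.
have ms : m <= hgt sigma := gp_le sigma tau.
have mt' : m <= hgt tau := gp_ler sigma tau.
rewrite arc_legs -/m.
have ml s a b : measurable (leg s a b : set BT) by exact: leg_measurable.
have sub : leg tau m m `<=` leg tau m (hgt tau).
  move=> ups [h /=]; rewrite in_itv /= => /andP[h1 h2]; split => //=.
  by rewrite in_itv /= h1 (le_trans h2).
rewrite measureU //; last 2 first.
- exact: measurableD.
- exact: arc_legs_disjoint.
have lm0 : tree_length (leg tau m m) = 0%E by rewrite tree_length_leg // subrr.
have DE : tree_length (leg tau m (hgt tau) `\` leg tau m m) = (hgt tau - m)%:E.
  have D := measureDI tree_length (ml tau m (hgt tau)) (ml tau m m).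
  rewrite (setIidr sub) in D.
  apply: (etrans _ (tree_length_leg rm mt' (lexx _))); apply/esym/(etrans D).
  by rewrite -[RHS]adde0; congr (_ + _)%E; exact: lm0.
transitivity ((hgt sigma - m)%:E + (hgt tau - m)%:E)%E.
  by congr (_ + _)%E; [exact: tree_length_leg|exact: DE].
by rewrite -EFinD mdistE -/m; congr EFin; lra.
Qed.

(** From here on [length_measure] is known not to be given by its default value. *)
Lemma length_measure_is_length : is_length_measure (length_measure theta).
Proof. by apply: length_measureP; exists tree_length; exact: length_exists. Qed.

End LengthExistence.

(** * The times at which a point of the tree is visited *)

Section Fibres.
Context {R : realType}.
Variable theta : cpath R R.
Local Notation T := (tree theta).
Local Notation BT := (btree theta).
Local Notation proj := (@Defs.proj R theta).
Local Notation arc := (@Defs.arc R theta).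
Local Notation hgt := (@hgt R theta).
Local Notation rt := (Defs.root theta).
Implicit Types (sigma tau ups : T) (x y z a : R) (e : time (R := R)).

Lemma fiberE tau : fiber tau = `[0, 1] `&` (tproj theta @^-1` [set tau]).
Proof.
apply/seteqP; split => x; rewrite /fiber /=.
  by move=> [t <- <-]; split; [exact: valP|rewrite /tproj pt_val].
by move=> [x01 <-]; exists (pt x) => //; exact: ptK.
Qed.

Lemma tproj_fiber_closed tau : closed (tproj theta @^-1` [set tau]).
Proof.
apply: preimage_closed.
  by move=> x _; exact: tproj_continuous.
exact/accessible_closed_set1/hausdorff_accessible/metric_hausdorff.
Qed.

Lemma fiber_compact tau : compact (fiber tau).
Proof.
rewrite fiberE; apply: compact_closedI; first exact: segment_compact.
exact: tproj_fiber_closed.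
Qed.

Lemma fiber_ex tau : fiber tau !=set0.
Proof. by exists (val (repr tau)); exists (repr tau) => //; exact: proj_repr. Qed.

Lemma fiber_bounds tau x : fiber tau x -> 0 <= x <= 1.
Proof. by rewrite fiberE => -[/=]; rewrite in_itv. Qed.

Lemma inf_fiber tau : fiber tau (inf (fiber tau)) /\ forall x, fiber tau x -> inf (fiber tau) <= x.
Proof.
have [c] := @compact_EVT_min _ R id _ (fiber_ex tau) (@fiber_compact tau) (continuous_subspaceT (fun x => @cvg_id _ (nbhs x))).
rewrite inE => fc hc.
have -> : inf (fiber tau) = c.
  apply/eqP; rewrite eq_le; apply/andP; split.
    by apply: ge_inf => //; exists c => x fx; apply: hc; rewrite inE.
  by apply: lb_le_inf; [exact: fiber_ex|move=> x fx; apply: hc; rewrite inE].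
by split => // x fx; apply: hc; rewrite inE.
Qed.

Lemma sup_fiber tau : fiber tau (sup (fiber tau)) /\ forall x, fiber tau x -> x <= sup (fiber tau).
Proof.
have [c] := @compact_EVT_max _ R id _ (fiber_ex tau) (@fiber_compact tau) (continuous_subspaceT (fun x => @cvg_id _ (nbhs x))).
rewrite inE => fc hc.
have -> : sup (fiber tau) = c.
  apply/eqP; rewrite eq_le; apply/andP; split.
    by apply: ge_sup; [exact: fiber_ex|move=> x fx; apply: hc; rewrite inE].
  by apply: ub_le_sup => //; exists c => x fx; apply: hc; rewrite inE.
by split => // x fx; apply: hc; rewrite inE.
Qed.

(* The interval of the times whose position descends from tau; the values -1
   and 2 encode the conventions on [O, A] and on [O, B]. *)
Definition first_time (tau : BT) : R :=
  if `[< arc rt (proj (time0 (R := R))) tau >] then -1 else inf (fiber tau).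
Definition last_time (tau : BT) : R :=
  if `[< arc rt (proj (time1 (R := R))) tau >] then 2 else sup (fiber tau).

Lemma jumpE (g : R -> R) tau : g (-1) = 0 -> g 2 = 0 ->
  jump theta g tau = g (first_time tau) - g (last_time tau).
Proof.
move=> g1 g2; rewrite /jump /first_time /last_time.
by case: ifP => _; case: ifP => _; rewrite ?g1 ?g2.
Qed.

Lemma fiber_time tau x : fiber tau x -> exists2 e, val e = x & proj e = tau.
Proof. by move=> [e h <-]; exists e. Qed.

Lemma first_timeP tau : (first_time tau = -1 /\ forall y, 0 <= y <= inf (fiber tau) -> hgt tau <= theta y)
  \/ (first_time tau = inf (fiber tau)).
Proof.
rewrite /first_time; case: asboolP => h; [left|by right]; split => // y y01.
have [fi _] := inf_fiber tau; have [e ve pe] := fiber_time fi.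
move/arc_rootP : h; rewrite -{1}pe gp_proj mt_sym => h.
by rewrite -h; apply: mt_le; apply/segP; left; rewrite ve.
Qed.

Lemma last_timeP tau : (last_time tau = 2 /\ forall y, sup (fiber tau) <= y <= 1 -> hgt tau <= theta y)
  \/ (last_time tau = sup (fiber tau)).
Proof.
rewrite /last_time; case: asboolP => h; [left|by right]; split => // y y01.
have [fi _] := sup_fiber tau; have [e ve pe] := fiber_time fi.
move/arc_rootP : h; rewrite -{1}pe gp_proj => h.
by rewrite -h; apply: mt_le; apply/segP; left; rewrite ve.
Qed.

(** A path above [tau] cannot pass below the height of [tau] without visiting it. So a descendant
    met before the first visit forces the path to stay at or above this height since time 0, which
    means that [tau] is on [O, A]; this is the case encoded by -1. The last visit is similar, with
    [O, B] and 2. *)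
Lemma descendantP tau e : gp tau (proj e) = hgt tau <-> first_time tau <= val e <= last_time tau.
Proof.
have [fi mi] := inf_fiber tau; have [fs ms] := sup_fiber tau.
have [ei vi pi] := fiber_time fi; have [es vs ps] := fiber_time fs.
have mid y : inf (fiber tau) <= y <= sup (fiber tau) -> hgt tau <= theta y.
  move=> hy; have <- : mt theta ei es = hgt tau by rewrite -gp_proj pi ps gpxx.
  by apply: mt_le; apply/segP; left; rewrite vi vs.
have /andP[e0 e1] : 0 <= val e <= 1 by have := valP e; rewrite in_itv.
have /andP[i0 i1] := fiber_bounds fi; have /andP[s0 s1] := fiber_bounds fs.
have isup := mi _ fs.
split=> [h|/andP[h1 h2]].
- have he : hgt tau <= theta (val e) by rewrite -hgt_proj -h gp_ler.
  have mie y : seg (inf (fiber tau)) (val e) y -> hgt tau <= theta y.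
    by move=> sy; rewrite -{1}h -{1}pi gp_proj; apply: mt_le; rewrite vi.
  have mse y : seg (sup (fiber tau)) (val e) y -> hgt tau <= theta y.
    by move=> sy; rewrite -{1}h -{1}ps gp_proj; apply: mt_le; rewrite vs.
  (* A passage below the height of [tau] at time [w] forces a visit of [tau] between [w] and [e]. *)
  have low (w : time) : theta (val w) < hgt tau ->
      exists2 u : time (R := R), fiber tau (val u) & seg (val w) (val e) (val u).
    move=> lw; have [u su [hu mu]] := @closest_level R theta w e (hgt tau) (introT andP (conj (ltW lw) he)).
    exists u => //; exists u => //; apply: gp_eq; last by rewrite hgt_proj.
    apply/eqP; rewrite hgt_proj eq_le -{1}(hgt_proj theta u) gp_le /=.
    have := gp_ultra (proj u) (proj e) tau; apply: le_trans.
    rewrite gp_proj mu [gp _ tau]gp_sym h minxx.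
    by have := lexx (hgt tau); rewrite -{1}hu.
  apply/andP; split.
  + rewrite /first_time; case: asboolP => [_|nA]; first by lra.
    have [//|ei_] := leP (inf (fiber tau)) (val e).
    exfalso; apply: nA; apply/arc_rootP; rewrite -pi gp_proj hgt_proj mt_sym.
    apply/eqP; rewrite eq_le mt_ler /= vi; apply/mtP => y.
    rewrite vi => /segP[]/andP[y0 y1]; last by rewrite (_ : y = inf (fiber tau)) // -?vi -?hgt_proj ?pi //; move: y0 y1 => /=; lra.
    have hie : theta (inf (fiber tau)) = hgt tau by rewrite -vi -hgt_proj pi.
    rewrite hie leNgt; apply/negP => ly.
    have [ye|ey] := ltP y (val e); last first.
      by move: ly; rewrite ltNge mie //; apply/segP; right; rewrite ey y1.
    have y01 : y \in `[0, 1] by rewrite in_itv /=; move: y0 => /=; lra.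
    have [u fu /segP[]/andP[u1 u2]] := low (exist _ y y01) ly.
      by have := le_lt_trans (le_trans (mi _ fu) u2) ei_; rewrite ltxx.
    by have := lt_le_trans ye (le_trans u1 u2); rewrite ltxx.
  + rewrite /last_time; case: asboolP => [_|nB]; first by lra.
    have [//|se_] := leP (val e) (sup (fiber tau)).
    exfalso; apply: nB; apply/arc_rootP; rewrite -ps gp_proj hgt_proj.
    apply/eqP; rewrite eq_le mt_lel /= vs; apply/mtP => y.
    rewrite vs => /segP[]/andP[y0 y1]; last by rewrite (_ : y = sup (fiber tau)) // -?vs -?hgt_proj ?ps //; move: y0 y1 => /=; lra.
    have hie : theta (sup (fiber tau)) = hgt tau by rewrite -vs -hgt_proj ps.
    rewrite hie leNgt; apply/negP => ly.
    have [ye|ey] := ltP (val e) y; last first.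
      by move: ly; rewrite ltNge mse //; apply/segP; left; rewrite ey y0.
    have y01 : y \in `[0, 1] by rewrite in_itv /=; move: y1 => /=; lra.
    have [u fu /segP[]/andP[u1 u2]] := low (exist _ y y01) ly.
      by have := lt_le_trans ye (le_trans u1 u2); rewrite ltxx.
    by have := lt_le_trans se_ (le_trans u1 (ms _ fu)); rewrite ltxx.
(* Conversely, the path stays at or above the height of [tau] from [first_time] to [last_time], in
   particular between [e] and a visit. *)
- have key y : first_time tau <= y -> y <= last_time tau -> 0 <= y <= 1 -> hgt tau <= theta y.
    move=> y1 y2 /andP[y3 y4].
    have [yi|iy] := ltP y (inf (fiber tau)).
      have [[_ h]|E] := first_timeP tau; first by apply: h; rewrite y3 ltW.
      by move: y1; rewrite E leNgt yi.
    have [ys|sy] := leP y (sup (fiber tau)); first by apply: mid; rewrite iy ys.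
    have [[_ h]|E] := last_timeP tau; first by apply: h; rewrite y4 ltW.
    by move: y2; rewrite E leNgt sy.
  have fle : first_time tau <= inf (fiber tau) by have [[-> _]|->] := first_timeP tau; lra.
  have lle : sup (fiber tau) <= last_time tau by have [[-> _]|->] := last_timeP tau; lra.
  have hie : theta (val ei) = hgt tau by rewrite -hgt_proj pi.
  rewrite -{1}pi gp_proj; apply/eqP; rewrite eq_le -{1}hie mt_lel /=.
  apply/mtP => y; rewrite vi => /segP[]/andP[q1 q2]; apply: key.
  + exact: le_trans fle q1.
  + exact: le_trans q2 h2.
  + by rewrite (le_trans i0 q1) (le_trans q2 e1).
  + exact: le_trans h1 q1.
  + exact: le_trans q2 (le_trans isup lle).
  + by rewrite (le_trans e0 q1) (le_trans q2 i1).
Qed.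

End Fibres.

(** * Controls and jumps *)

Section Controls.
Context {R : realType}.
Implicit Types (u v s t r x y : R) (c : R -> R -> R).

Definition control u v c : Prop :=
  (forall s t, u <= s -> s <= t -> t <= v -> 0 <= c s t) /\
  (forall s t r, u <= s -> s <= t -> t <= r -> r <= v -> c s t + c t r <= c s r).

Lemma control_sub u v c u' v' : control u v c -> u <= u' -> v' <= v -> control u' v' c.
Proof.
move=> [h1 h2] uu vv; split=> [s t us st tv|s t r us st tr rv].
  by apply: h1 => //; [exact: le_trans us|exact: le_trans vv].
by apply: h2 => //; [exact: le_trans us|exact: le_trans vv].
Qed.

Lemma control_mono u v c s t s' t' : control u v c ->
  u <= s -> s <= s' -> s' <= t' -> t' <= t -> t <= v -> c s' t' <= c s t.
Proof.
move=> [h1 h2] us ss st tt tv.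
have a1 := h1 s s' us ss (le_trans st (le_trans tt tv)).
have a2 := h1 t' t (le_trans us (le_trans ss st)) tt tv.
have a3 := h2 s s' t' us ss st (le_trans tt tv).
have a4 := h2 s t' t us (le_trans ss st) tt tv.
lra.
Qed.

Definition apart : rel (R * R) := fun p q => (p.2 <= q.1) || (q.2 <= p.1).

(** The intervals come in no particular order: the head of the list separates the others into those
    on its left and those on its right, and superadditivity is applied at its two ends. *)
Lemma control_disjoint_sum u v c (l : seq (R * R)) : control u v c -> u <= v ->
  (forall p, p \in l -> [/\ u <= p.1, p.1 <= p.2 & p.2 <= v]) ->
  pairwise apart l -> \sum_(p <- l) c p.1 p.2 <= c u v.
Proof.
have [n] := ubnP (size l); elim: n => // n IH in l u v *.
case: l => [|p l] /= sl hc uv hl.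
  by rewrite big_nil => _; apply: hc.1.
move=> /andP[/allP pl pw]; rewrite big_cons.
have [u1 u2 u3] := hl p (mem_head _ _).
rewrite (bigID (fun q : R * R => q.2 <= p.1)) /=.
rewrite -big_filter -[X in _ + (_ + X)]big_filter.
set l1 := [seq q <- l | _]; set l2 := [seq q <- l | _].
have s1 : \sum_(q <- l1) c q.1 q.2 <= c u p.1.
  apply: IH => //.
  - by rewrite size_filter (leq_ltn_trans (count_size _ _)).
  - by apply: (control_sub hc) => //; exact: le_trans u3.
  - move=> q; rewrite mem_filter => /andP[qp ql].
    by have [? ? ?] := hl q (mem_behead (s := p :: l) ql); split.
  - exact: pairwise_filter.
have s2 : \sum_(q <- l2) c q.1 q.2 <= c p.2 v.
  apply: IH => //.
  - by rewrite size_filter (leq_ltn_trans (count_size _ _)).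
  - by apply: (control_sub hc) => //; exact: le_trans u2.
  - move=> q; rewrite mem_filter => /andP[qp ql].
    have [? ? ?] := hl q (mem_behead (s := p :: l) ql); split => //.
    by have := pl q ql; rewrite /apart (negbTE qp) orbF.
  - exact: pairwise_filter.
have a1 := hc.2 u p.1 p.2 (lexx u) u1 u2 u3.
have a2 := hc.2 u p.2 v (lexx u) (le_trans u1 u2) u3 (lexx v).
lra.
Qed.

(* a surrogate for Hoelder's inequality, optimal up to the factor 2 *)
Lemma sum_le_threshold (I : eqType) (l : seq I) (f : I -> R) (Q A : R) :
  1 <= Q -> 0 < A -> (forall i, i \in l -> 0 <= f i) ->
  \sum_(i <- l) f i <= (size l)%:R * A + A `^ (1 - Q) * \sum_(i <- l) f i `^ Q.
Proof.
move=> Q1 A0 f0.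
have -> : (size l)%:R * A = \sum_(i <- l) A.
  by rewrite big_const_seq count_predT iter_addr addr0 mulr_natl.
rewrite mulr_sumr -big_split /= !big_seq; apply: ler_sum => i il.
have fi0 := f0 i il.
have p0 : 0 <= A `^ (1 - Q) * f i `^ Q by rewrite mulr_ge0 ?powR_ge0.
have [fA|Af] := leP (f i) A; first by lra.
(* Above the threshold, (f i / A)^(Q - 1) is at least 1. *)
suff : f i <= A `^ (1 - Q) * f i `^ Q by lra.
have fp : 0 < f i := lt_trans A0 Af.
have -> : f i `^ Q = f i * f i `^ (Q - 1).
  have E : f i `^ (1 + (Q - 1)) = f i `^ 1 * f i `^ (Q - 1).
    by apply: powRD; apply/implyP => _; rewrite gt_eqF.
  by rewrite powRr1 // in E; rewrite -E; congr (_ `^ _); lra.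
rewrite mulrCA ler_peMr //.
have -> : A `^ (1 - Q) = (A `^ (Q - 1))^-1 by rewrite -powRN opprB.
rewrite mulrC ler_pdivlMr ?powR_gt0 // mul1r.
by apply: ge0_ler_powR; rewrite ?nnegrE ?(ltW A0) ?(ltW Af) //; lra.
Qed.

End Controls.

(** * Measurability of the jumps and separation of the intervals of visits *)

Section Jump.
Context {R : realType}.
Variable theta : cpath R R.
Local Notation T := (tree theta).
Local Notation BT := (btree theta).
Local Notation proj := (@Defs.proj R theta).
Local Notation arc := (@Defs.arc R theta).
Local Notation hgt := (@hgt R theta).
Local Notation rt := (Defs.root theta).
Implicit Types (sigma tau ups : T) (x y z a : R) (e : time (R := R)).

(** The points visited for the first time at or before [x] form the image of the compact set of
    times up to [x], which is closed. *)
Lemma inf_fiber_measurable : measurable_fun [set: BT] (fun tau : BT => inf (fiber tau)).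
Proof.
apply: (measurability _ (RGenOInfty.measurableE R)) => //.
move=> _ [_ [x ->] <-]; rewrite setTI.
rewrite -[X in measurable X]setCK; apply: measurableC.
rewrite (_ : ~` _ = tproj theta @` (`[0, 1] `&` `]-oo, x])); last first.
  apply/seteqP; split => tau /=.
    rewrite in_itv /= andbT => /negP; rewrite -leNgt => h.
    have [fi _] := inf_fiber tau; exists (inf (fiber tau)).
      by split; rewrite /= in_itv /= ?h //; exact: (fiber_bounds fi).
    by move: fi; rewrite {1}fiberE => -[].
  move=> [y [/= y01 yx] ytau]; rewrite in_itv /= andbT; apply/negP; rewrite -leNgt.
  move: yx; rewrite in_itv /=; apply: le_trans.
  by apply: (inf_fiber tau).2; rewrite fiberE.
apply: btree_closed; apply: compact_closed; first exact: metric_hausdorff.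
apply: continuous_compact; first by apply: continuous_subspaceT; exact: tproj_continuous.
by apply: compact_closedI; [exact: segment_compact|exact: interval_closed].
Qed.

Lemma sup_fiber_measurable : measurable_fun [set: BT] (fun tau : BT => sup (fiber tau)).
Proof.
apply: (measurability _ (RGenCInfty.measurableE R)) => //.
move=> _ [_ [x ->] <-]; rewrite setTI.
rewrite (_ : _ @^-1` _ = tproj theta @` (`[0, 1] `&` `[x, +oo[)); last first.
  apply/seteqP; split => tau /=.
    rewrite in_itv /= andbT => h.
    have [fi _] := sup_fiber tau; exists (sup (fiber tau)).
      by split; rewrite /= in_itv /= ?h //; exact: (fiber_bounds fi).
    by move: fi; rewrite {1}fiberE => -[].
  move=> [y [/= y01 yx] ytau]; rewrite in_itv /= andbT.
  move: yx; rewrite in_itv /= andbT => yx; apply: (le_trans yx).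
  by apply: (sup_fiber tau).2; rewrite fiberE.
apply: btree_closed; apply: compact_closed; first exact: metric_hausdorff.
apply: continuous_compact; first by apply: continuous_subspaceT; exact: tproj_continuous.
by apply: compact_closedI; [exact: segment_compact|exact: interval_closed].
Qed.

Lemma arc_root_measurable_fun sigma :
  measurable_fun [set: BT] (fun tau : BT => `[< arc rt sigma tau >]).
Proof.
apply: (measurable_fun_bool true) => //; rewrite setTI.
rewrite (_ : _ @^-1` _ = below sigma); first exact: below_measurable.
by apply/seteqP; split => tau /=; [move=> /asboolP/arc_rootP|move=> h; apply/asboolP/arc_rootP].
Qed.

Lemma first_time_measurable : measurable_fun [set: BT] (@first_time R theta).
Proof.
apply: measurable_fun_ifT; [exact: arc_root_measurable_fun|exact: measurable_cst|].
exact: inf_fiber_measurable.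
Qed.

Lemma last_time_measurable : measurable_fun [set: BT] (@last_time R theta).
Proof.
apply: measurable_fun_ifT; [exact: arc_root_measurable_fun|exact: measurable_cst|].
exact: sup_fiber_measurable.
Qed.

Lemma jump_measurable (g : R -> R) : measurable_fun [set: measurableTypeR R] g ->
  g (-1) = 0 -> g 2 = 0 -> measurable_fun [set: BT] (jump theta g).
Proof.
move=> mg g1 g2.
have -> : jump theta g = (g \o @first_time R theta) \- (g \o @last_time R theta).
  by apply/funext => tau; rewrite jumpE.
apply: measurable_funB; apply: measurableT_comp => //.
  exact: first_time_measurable.
exact: last_time_measurable.
Qed.

Lemma first_time_proj tau : 0 <= first_time tau ->
  exists2 e, val e = first_time tau & proj e = tau.
Proof.
have [fi _] := inf_fiber tau; have [e ve pe] := fiber_time fi.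
by have [[->]|->] := first_timeP tau; [lra|exists e].
Qed.

Lemma last_time_proj tau : last_time tau <= 1 ->
  exists2 e, val e = last_time tau & proj e = tau.
Proof.
have [fi _] := sup_fiber tau; have [e ve pe] := fiber_time fi.
by have [[->]|->] := last_timeP tau; [lra|exists e].
Qed.

Lemma first_le_last tau : first_time tau <= last_time tau.
Proof.
have [fi _] := inf_fiber tau; have [_ ms] := sup_fiber tau; have := ms _ fi.
have /andP[? ?] := fiber_bounds fi; have /andP[? ?] := fiber_bounds (sup_fiber tau).1.
by have [[-> _]|->] := first_timeP tau; have [[-> _]|->] := last_timeP tau; lra.
Qed.

(** If the two intervals overlapped, the first time of one of them would belong to the other, and
    one point would descend from the other. *)
Lemma incomparable_apart sigma tau : 0 <= first_time sigma -> 0 <= first_time tau ->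
  gp sigma tau <> hgt sigma -> gp sigma tau <> hgt tau ->
  (last_time sigma <= first_time tau) || (last_time tau <= first_time sigma).
Proof.
move=> /first_time_proj[e ve pe] /first_time_proj[e' ve' pe'] n1 n2.
have a1 : ~ (first_time sigma <= val e' <= last_time sigma).
  by move=> /descendantP; rewrite pe'.
have a2 : ~ (first_time tau <= val e <= last_time tau).
  by move=> /descendantP; rewrite pe gp_sym.
rewrite ve ve' in a1 a2.
have [h|h] := leP (last_time sigma) (first_time tau) => //=.
rewrite leNgt; apply/negP => h'.
have [q|q] := leP (first_time sigma) (first_time tau).
  by apply: a1; rewrite q ltW.
by apply: a2; rewrite !ltW.
Qed.

End Jump.

(** * The estimate of the integral *)

Definition cutoff {R : realType} (rho : R -> R) (s t r : R) : R := rho r * \1_(`]s, t]) r.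

Lemma cutoffE {R : realType} (rho : R -> R) (s t r : R) :
  cutoff rho s t r = if (s < r) && (r <= t) then rho r else 0.
Proof.
rewrite /cutoff /indic; case: (boolP (r \in _)) => h.
  by move: h; rewrite inE /= in_itv /= => ->; rewrite mulr1.
rewrite mulr0; case: ifP => // h'; move: h; rewrite notin_setE /= in_itv /= h'.
by move=> /(_ isT).
Qed.

Section CoreEstimate.
Context {R : realType}.
Variable theta : cpath R R.
Local Notation T := (tree theta).
Local Notation BT := (btree theta).
Local Notation proj := (@Defs.proj R theta).
Local Notation arc := (@Defs.arc R theta).
Local Notation hgt := (@hgt R theta).
Local Notation rt := (Defs.root theta).
Local Notation leb := (@lebesgue_measure R).
Local Notation E := (dseq theta).
Variable lam : {measure set BT -> \bar R}.
Hypothesis hlam : is_length_measure lam.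
Variables (P Q : R) (s t : R) (rho : R -> R) (c w : R -> R -> R) (c0 w0 : R).
Hypotheses (P1 : 1 <= P) (Q1 : 1 <= Q) (hPQ : 1 < P^-1 + Q^-1).
Hypotheses (s0 : 0 <= s) (st : s <= t) (t1 : t <= 1).
Hypotheses (hc : control s t c) (hw : control s t w).
Hypothesis hcP : forall a b, s <= a -> a <= b -> b <= t -> `|theta b - theta a| `^ P <= c a b.
Hypothesis hwQ : forall a b, s <= a -> a <= b -> b <= t -> theta a = theta b ->
  `|rho b - rho a| `^ Q <= w a b.
(** [c0] and [w0] stand for c(s,t)^(1/P) and w(s,t)^(1/Q); they are positive so as to serve as a
    scale and in a threshold. *)
Hypotheses (c0_gt0 : 0 < c0) (w0_gt0 : 0 < w0) (hcc : c s t <= c0 `^ P) (hww : w s t <= w0 `^ Q).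
Local Notation g := (cutoff rho s t).
Hypothesis mg : measurable_fun [set: measurableTypeR R] g.
Implicit Types (sigma tau ups : T) (x y z a b : R) (e : time (R := R)).
Local Notation J := (jump theta g).

Let gE r : g r = if (s < r) && (r <= t) then rho r else 0.
Proof. exact: cutoffE. Qed.

Let g_m1 : g (-1) = 0.
Proof. by rewrite gE; case: ifP => // /andP[]; have := s0; have := t1; lra. Qed.

Let g_2 : g 2 = 0.
Proof. by rewrite gE; case: ifP => // /andP[]; have := s0; have := t1; lra. Qed.

Let JE tau : J tau = g (first_time tau) - g (last_time tau).
Proof. exact: jumpE. Qed.

Let mJ : measurable_fun [set: BT] J.
Proof. exact: jump_measurable. Qed.

Let P_gt0 : 0 < P. Proof. exact: lt_le_trans P1. Qed.

Let osc a b : s <= a -> a <= b -> b <= t -> `|theta b - theta a| <= c0.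
Proof.
move=> sa ab bt; rewrite leNgt; apply/negP => h.
have h1 : c0 `^ P < `|theta b - theta a| `^ P.
  by apply: gt0_ltr_powR => //; rewrite nnegrE ?(ltW c0_gt0).
have := hcP sa ab bt; have := control_mono hc (lexx s) sa ab bt (lexx t); have := hcc; lra.
Qed.

Local Notation S := (proj (pt s)).
Local Notation Te := (proj (pt t)).

Let vs : val (pt s) = s. Proof. by rewrite ptK // in_itv /= s0 (le_trans st). Qed.
Let vt : val (pt t) = t. Proof. by rewrite ptK // in_itv /= t1 (le_trans s0). Qed.

(* the points that are not on [pi s, pi t] have their interval of times inside
   or outside (s, t) *)
Let off_arc tau : ~ arc S Te tau -> J tau <> 0 ->
  [/\ s < first_time tau, first_time tau <= last_time tau, last_time tau < t &
      J tau = rho (first_time tau) - rho (last_time tau)].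
Proof.
move=> na nJ; have fl := first_le_last tau.
(* Off [pi s, pi t] a point is an ancestor of both ends or of neither: its interval of visits
   contains both [s] and [t], or neither. *)
have nS : gp tau S = hgt tau -> gp tau Te = hgt tau.
  move=> h; apply: contrapT => nT; apply: na; apply/arcP; split; first by left.
  have := gp_ultra S Te tau; have := gp_ultra tau S Te.
  rewrite h [gp Te tau]gp_sym => + _.
  rewrite ge_min => /orP[h1|h1].
    by exfalso; apply: nT; apply/eqP; rewrite eq_le gp_le.
  have [//|h2] := leP (gp S Te) (hgt tau).
  exfalso; apply: nT; apply/eqP; rewrite eq_le gp_le /=.
  have := gp_ultra tau S Te; apply: le_trans; by rewrite h le_min lexx ltW.
have nT : gp tau Te = hgt tau -> gp tau S = hgt tau.
  move=> h; apply: contrapT => nS'; apply: na; apply/arcP; split; first by right.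
  rewrite leNgt; apply/negP => h2; apply: nS'; apply/eqP; rewrite eq_le gp_le /=.
  have := gp_ultra tau Te S; apply: le_trans; by rewrite h le_min lexx gp_sym ltW.
have iS : (s < first_time tau) || (last_time tau < s) = ~~ (first_time tau <= s <= last_time tau).
  by rewrite negb_and -!ltNge.
have iT : (t < first_time tau) || (last_time tau < t) = ~~ (first_time tau <= t <= last_time tau).
  by rewrite negb_and -!ltNge.
have dS : gp tau S = hgt tau <-> first_time tau <= s <= last_time tau.
  by have := descendantP tau (pt s); rewrite vs.
have dT : gp tau Te = hgt tau <-> first_time tau <= t <= last_time tau.
  by have := descendantP tau (pt t); rewrite vt.
move: nJ; rewrite JE !gE.
case: (boolP (first_time tau <= s <= last_time tau)) => [/[dup] /dS/nS/dT /andP[f1 f2] /andP[f3 f4]|].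
  (* The value at the first visit is cut off. The value at the last one survives only if
     [last_time tau = t], and then [tau] is pi t, which is on the arc. *)
  rewrite [s < first_time tau]ltNge f3 /=; case: ifP => [/andP[f5 f6]|_]; last by rewrite subrr.
  exfalso.
  have et : last_time tau = t by apply/eqP; rewrite eq_le f6.
  have [ee ve pe] : exists2 e, val e = last_time tau & proj e = tau.
    by apply: last_time_proj; rewrite et.
  apply: na; have <- : tau = Te by rewrite -pe; congr proj; apply: val_inj; rewrite ve vt et.
  by apply/arcP; split; [right; exact: gpxx|exact: gp_ler].
rewrite -iS => nsS.
have : ~~ (first_time tau <= t <= last_time tau).
  by apply/negP => /dT/nT/dS; apply/negP; rewrite -iS.
rewrite -iT; case/orP: nsS => q1 /orP[] q2.
- have -> : (first_time tau <= t) = false by apply/negbTE; rewrite -ltNge.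
  have -> : (last_time tau <= t) = false by apply/negbTE; rewrite -ltNge (lt_le_trans q2).
  by rewrite !andbF subrr.
- by rewrite q1 (ltW (le_lt_trans fl q2)) (lt_le_trans q1 fl) (ltW q2) /=; split.
- by have := lt_le_trans q2 (le_trans fl (le_trans (ltW q1) st)); rewrite ltxx.
- have -> : (s < first_time tau) = false by apply/negbTE; rewrite -leNgt ltW // (le_lt_trans fl).
  have -> : (s < last_time tau) = false by apply/negbTE; rewrite -leNgt ltW.
  by rewrite subrr.
Qed.

Let off_arc_hgt tau : ~ arc S Te tau -> J tau <> 0 ->
  theta (first_time tau) = hgt tau /\ theta (last_time tau) = hgt tau.
Proof.
move=> na nJ; have [f1 f2 f3 _] := off_arc na nJ.
have [|e ve pe] := @first_time_proj _ _ tau; first by rewrite (le_trans s0) // ltW.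
have [|e' ve' pe'] := @last_time_proj _ _ tau; first by rewrite (le_trans (ltW f3)).
by rewrite -ve -ve'; split; rewrite -hgt_proj ?pe ?pe'.
Qed.

(** The points above which the tree continues for a height greater than [x]; taking descendants in
    the dense sequence makes this set measurable. *)
Definition deeper (x : R) : set BT :=
  \bigcup_i (below (E i) `&` (hgt @^-1` [set y | y < hgt (E i) - x])).

Lemma deeper_measurable x : measurable (deeper x).
Proof.
apply: bigcup_measurable => i _; apply: measurableI; first exact: below_measurable.
rewrite -[X in measurable X]setTI; apply: hgt_measurable => //.
rewrite (_ : [set y | _] = `]-oo, hgt (E i) - x[%classic); first exact: measurable_itv.
by apply/seteqP; split => y /=; rewrite in_itv.
Qed.

Section Scale.
Variable eps : R.
Hypothesis eps_gt0 : 0 < eps.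

(** The height of the tree above these points is greater than 2 eps and at most 4 eps. The upper
    bound prevents one of two points at well separated levels from being above the other; the lower
    bound forces theta to vary during the visits. *)
Definition slice : set BT :=
  (~` arc S Te `&` (J @^-1` [set~ 0])) `&` (deeper (2 * eps) `\` deeper (4 * eps)).

Lemma slice_measurable : measurable slice.
Proof.
apply: measurableI; last by apply: measurableD; exact: deeper_measurable.
apply: measurableI; last first.
  rewrite -[X in measurable X]setTI; apply: mJ => //.
  by apply: measurableC; exact: measurable_set1.
by apply: measurableC; exact: arc_measurable.
Qed.

Let slice_apart sigma tau : slice sigma -> slice tau -> sigma <> tau ->
  [\/ hgt sigma = hgt tau, hgt sigma + 4 * eps <= hgt tau | hgt tau + 4 * eps <= hgt sigma] ->
  apart (first_time sigma, last_time sigma) (first_time tau, last_time tau).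
Proof.
(* If [ups'] descended from [ups], then [ups] would be deeper than 4 eps, unless both have the same
   height and coincide. *)
have key ups ups' : slice ups -> slice ups' -> ups <> ups' ->
    hgt ups = hgt ups' \/ hgt ups + 4 * eps <= hgt ups' -> gp ups ups' <> hgt ups.
  move=> [_ [_ n4]] [_ [[i _ [b1 b2]] _]] ne [h|h] g1; first by apply: ne; exact: gp_eq.
  apply: n4; exists i => //; split; last by move: b2; rewrite /=; have := eps_gt0; lra.
  apply/eqP; rewrite eq_le gp_le /=; have := gp_ultra ups ups' (E i); apply: le_trans.
  by rewrite g1 b1 le_min lexx /=; have := eps_gt0; lra.
move=> ss tt ne cmp.
have pos ups : slice ups -> 0 <= first_time ups.
  by move=> [[na nJ] _]; have [/ltW f1 _ _ _] := off_arc na nJ; exact: le_trans f1.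
rewrite /apart /=; apply: incomparable_apart; rewrite ?pos //.
  have [|h] := leP (hgt sigma) (hgt tau).
    move=> h; apply: key => //; case: cmp => [->|h'|h']; [by left|by right|].
    by exfalso; have := eps_gt0; lra.
  by move=> g1; have := gp_ler sigma tau; rewrite g1; lra.
have [|h] := leP (hgt tau) (hgt sigma).
  move=> h; rewrite gp_sym; apply: key => //; first by move=> e; apply: ne.
  by case: cmp => [->|h'|h']; [by left| |by right]; exfalso; have := eps_gt0; lra.
by move=> g1; have := gp_le sigma tau; rewrite g1; lra.
Qed.

(** Within the interval of visits the path reaches a point [E i] that is more than 2 eps above
    [tau]. *)
Let slice_control tau : slice tau -> (2 * eps) `^ P <= c (first_time tau) (last_time tau).
Proof.
move=> [[na nJ] [[i _ [b1 b2]] _]].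
have [f1 f2 f3 _] := off_arc na nJ; have [h1 h2] := off_arc_hgt na nJ.
have bE : gp tau (proj (repr (E i))) = hgt tau by rewrite proj_repr.
move/descendantP : bE; set e := val (repr (E i)) => /andP[e1 e2].
have he : hgt (E i) = theta e by [].
have k1 := control_mono hc (ltW f1) (lexx _) e1 e2 (ltW f3).
have k2 := hcP (ltW f1) e1 (le_trans e2 (ltW f3)).
apply: (le_trans _ k1); apply: (le_trans _ k2).
apply: ge0_ler_powR; rewrite ?nnegrE ?(ltW P_gt0) //; first by rewrite mulr_ge0 // ltW.
rewrite h1 -he ger0_norm; move: b2 => /=; have := eps_gt0; lra.
Qed.

(* eps plays the role of c0 * 2 ^- k below, so that [N] is 2 ^ (k P) *)
Let slice_sum (l : seq T) (N A : R) : uniq l -> (forall tau, tau \in l -> slice tau) ->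
  {in l &, forall sigma tau, [\/ hgt sigma = hgt tau, hgt sigma + 4 * eps <= hgt tau |
     hgt tau + 4 * eps <= hgt sigma]} ->
  0 < A -> c0 `^ P <= N * (2 * eps) `^ P ->
  \sum_(tau <- l) `|J tau| <= N * A + A `^ (1 - Q) * w0 `^ Q.
Proof.
move=> ul sl cmp A0 hN.
pose I tau := (first_time tau, last_time tau).
have pw : pairwise apart (map I l).
  rewrite pairwise_map; have := ul; rewrite uniq_pairwise.
  apply: (@sub_in_pairwise _ (mem l)); last exact/allP.
  move=> sigma tau sl1 tl1 /= ne.
  by apply: slice_apart; [exact: sl|exact: sl|exact/eqP|exact: cmp].
have bd p : p \in map I l -> [/\ s <= p.1, p.1 <= p.2 & p.2 <= t].
  move=> /mapP[tau tl ->]; have [[na nJ] _] := sl tau tl.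
  by have [f1 f2 f3 _] := off_arc na nJ; split => //=; exact: ltW.
have hcl := control_disjoint_sum hc st bd pw.
have hwl := control_disjoint_sum hw st bd pw.
rewrite !big_map /= in hcl hwl.
(* Each interval takes at least (2 eps)^P of the control [c], whose total is at most c0^P. *)
have nb : (size l)%:R <= N.
  have e0 : 0 < (2 * eps) `^ P by rewrite powR_gt0 // mulr_gt0.
  rewrite -(ler_pM2r e0); apply: (le_trans _ hN); apply: (le_trans _ hcc); apply: (le_trans _ hcl).
  have -> : (size l)%:R * (2 * eps) `^ P = \sum_(tau <- l) (2 * eps) `^ P.
    by rewrite big_const_seq count_predT iter_addr addr0 mulr_natl.
  by rewrite !big_seq; apply: ler_sum => tau tl; exact/slice_control/sl.
have J0 tau : tau \in l -> 0 <= `|J tau| by [].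
apply: (le_trans (sum_le_threshold Q1 A0 J0)); apply: lerD.
  by rewrite ler_pM2r.
apply: ler_wpM2l; first exact: powR_ge0.
apply: (le_trans _ hww); apply: (le_trans _ hwl).
rewrite !big_seq; apply: ler_sum => tau tl.
have [[na nJ] _] := sl tau tl.
have [f1 f2 f3 ->] := off_arc na nJ; have [h1 h2] := off_arc_hgt na nJ.
rewrite distrC; apply: hwQ; [exact: ltW|exact: f2|exact: ltW|by rewrite h1 h2].
Qed.

Let level (j : nat) : R := hgt rt + j%:R * eps.

(** [n] codes a branch [i] and a level index [j]. The margin 2 eps below the top of the branch
    ensures that the whole leg of length eps around the point lies on [O, E i], so that [0, eps]
    parametrizes it. *)
Let pieces (n : nat) : set BT :=
  if unpickle n is Some (i, j) then
    slice `&` leg (E i) (level j) (level j + eps) `&` (hgt @^-1` `]-oo, hgt (E i) - 2 * eps[)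
  else set0.

Let mpieces n : measurable (pieces n).
Proof.
rewrite /pieces; case: unpickle => [[i j]|]; last exact: measurable0.
apply: measurableI; last by rewrite -[X in measurable X]setTI; apply: hgt_measurable.
by apply: measurableI; [exact: slice_measurable|exact: leg_measurable].
Qed.

Let slice_pieces : slice = \bigcup_n pieces n.
Proof.
apply/seteqP; split => tau; last first.
  by move=> [n _]; rewrite /pieces; case: unpickle => [[i j]|//] -[[]].
move=> st'; have [_ [[i _ [b1 b2]] _]] := st'.
have h0 : 0 <= (hgt tau - hgt rt) / eps by rewrite divr_ge0 ?subr_ge0 ?root_le // ltW.
have /andP[j1 j2] := truncn_itv h0; set j := Num.truncn _ in j1 j2.
exists (pickle (i, j)) => //; rewrite /pieces pickleK; split; last by rewrite /= in_itv.
split => //; split => //=.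
rewrite ler_pdivlMr // in j1; rewrite ltr_pdivrMr // -natr1 mulrDl mul1r in j2.
by rewrite in_itv /= /level; apply/andP; split; lra.
Qed.

Let pt_of (n : nat) (r : R) : BT :=
  if unpickle n is Some (i, j) then anc (E i) (level j + r) else rt.

Let good (n : nat) : bool :=
  if unpickle n is Some (i, j) then level j + eps <= hgt (E i) else false.

(** The integrand of the piece [n] as a function of the residue of the level modulo eps; [seqDU]
    prevents a point shared by several branches from being counted twice. *)
Let phi (n : nat) (r : measurableTypeR R) : \bar R :=
  if good n then (`|J (pt_of n r)|%:E * (\1_(seqDU pieces n) (pt_of n r))%:E)%E else 0%E.

Let mseqDU n : measurable (seqDU pieces n).
Proof. by apply: measurableD => //; exact: bigsetU_measurable. Qed.

Let mpt_of n : measurable_fun [set: measurableTypeR R] (pt_of n).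
Proof.
rewrite /pt_of; case: unpickle => [[i j]|]; last exact: measurable_cst.
apply: (@measurableT_comp _ _ _ _ _ _ (anc (E i) : R -> BT) _ (fun r : measurableTypeR R => level j + r)).
  exact: anc_measurable.
by apply: measurable_funD; [exact: measurable_cst|exact: measurable_id].
Qed.

Let mF n : measurable_fun [set: BT] (fun tau : BT => `|J tau|%:E * (\1_(seqDU pieces n) tau)%:E)%E.
Proof.
apply: emeasurable_funM; apply/measurable_EFinP; last exact: measurable_indic.
by apply: measurableT_comp.
Qed.

Let phi_ge0 n r : (0 <= phi n r)%E.
Proof. by rewrite /phi; case: ifP => // _; rewrite mule_ge0 // lee_fin. Qed.

Let mphi n : measurable_fun [set: measurableTypeR R] (phi n).
Proof.
rewrite /phi; case: (good n); last exact: measurable_cst.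
exact: (measurableT_comp (mF n) (mpt_of n)).
Qed.

Let int_piece n : (\int[lam]_(tau in seqDU pieces n) `|J tau|%:E = \int[leb]_(r in `[0%R, eps]) phi n r)%E.
Proof.
case: (boolP (good n)) => gn; last first.
  rewrite (_ : seqDU pieces n = set0) ?integral_set0.
    by rewrite integral0_eq // => r _; rewrite /phi (negbTE gn).
  apply/seteqP; split => // tau h; have := subset_seqDU h.
  rewrite /pieces; move: gn; rewrite /good.
  case: unpickle => [[i j]|//] gn [[_ [_ /= +]] /=]; rewrite !in_itv /=.
  by move=> /andP[l1 l2] l3; move/negP: gn; apply; have := eps_gt0; lra.
transitivity (\int[lam]_(tau in seqDU pieces n) (`|J tau|%:E * (\1_(seqDU pieces n) tau)%:E))%E.
  by apply: eq_integral => tau h; rewrite indicE h mule1.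
rewrite /phi gn; move: (gn); rewrite /good.
case En : (unpickle n) => [[i j]|//] lj.
have := @ge0_leg_integral _ _ lam hlam (E i) (level j) eps _ (ltW eps_gt0) lj _ (mF n) _.
move=> H; rewrite /pt_of En -H; last 2 first.
- by rewrite lerDl mulr_ge0 // ltW.
- by move=> tau; rewrite mule_ge0 // lee_fin.
rewrite [RHS]integral_mkcond [LHS]integral_mkcond.
apply: eq_integral => tau _; rewrite /patch.
case: (boolP (tau \in seqDU pieces n)) => h1.
  rewrite ifT // inE; move: (h1); rewrite inE => h2; have := subset_seqDU h2.
  by rewrite /pieces En => -[[]].
by case: ifP => // _; rewrite indicE (negbTE h1) mule0.
Qed.

(* Points at levels that are congruent modulo eps, split according to the
   residue of the level index modulo 4, are far enough apart in height. *)
Let sum_phi (N A : R) (r : R) (n : nat) : 0 < A -> c0 `^ P <= N * (2 * eps) `^ P ->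
  0 <= r <= eps ->
  (\sum_(i < n) phi i r <= (4 * (N * A + A `^ (1 - Q) * w0 `^ Q))%:E)%E.
Proof.
move=> A0 hN /andP[r0 re].
pose ok i := good i && (pt_of i r \in seqDU pieces i).
have phiE i : phi i r = (if ok i then `|J (pt_of i r)| else 0)%:E.
  rewrite /phi /ok; case: (good i) => //=; rewrite indicE.
  by case: (_ \in _); rewrite ?mule1 ?mule0.
rewrite (eq_bigr (fun i : 'I_n => (if ok i then `|J (pt_of i r)| else 0)%:E)); last by move=> i _; exact: phiE.
rewrite sumEFin lee_fin -big_mkcond /=.
pose jj i := if (unpickle i : option (nat * nat)) is Some (_, j) then j else 0%N.
pose cl (i : 'I_n) : 'I_4 := inord (jj i %% 4).
rewrite (partition_big cl predT) //=.
have -> : 4 * (N * A + A `^ (1 - Q) * w0 `^ Q) = \sum_(q < 4) (N * A + A `^ (1 - Q) * w0 `^ Q).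
  by rewrite sumr_const card_ord mulr_natl.
apply: ler_sum => q _.
rewrite -big_filter; set l := [seq i <- _ | _].
have lP i : i \in l -> ok i /\ (jj i %% 4)%N = q.
  rewrite mem_filter => /andP[/andP[h1 /eqP h2] _]; split => //.
  by rewrite -h2 /cl inordK // ltn_pmod.
have okP i : ok i -> seqDU pieces i (pt_of i r) /\ hgt (pt_of i r) = level (jj i) + r.
  rewrite /ok => /andP[gi]; rewrite inE => h; split => //.
  move: gi; rewrite /good /pt_of /jj; case: unpickle => [[k j]|//] gi.
  rewrite hgt_anc //; apply/andP; split; last by apply: le_trans gi; rewrite lerD2l.
  by rewrite /level -addrA lerDl addr_ge0 // mulr_ge0 // ltW.
pose l' : seq T := [seq (pt_of i r : T) | i : 'I_n <- l].
rewrite -(big_map (fun i : 'I_n => pt_of i r : T) predT (fun tau : T => `|J tau|)) -/l'.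
apply: slice_sum => //.
- rewrite map_inj_in_uniq ?filter_uniq ?index_enum_uniq // => i k il kl e.
  have [oki _] := lP i il; have [okk _] := lP k kl.
  have [d1 _] := okP i oki; have [d2 _] := okP k okk.
  apply: val_inj; apply: contrapT => ne.
  have /trivIsetP/(_ i k Logic.I Logic.I (introN eqP ne)) := trivIset_seqDU pieces.
  by apply/eqP/set0P; exists (pt_of i r); split => //; rewrite e.
- move=> tau /mapP[i il ->]; have [oki _] := lP i il; have [d1 _] := okP i oki.
  by rewrite slice_pieces; exists (val i) => //; exact: subset_seqDU d1.
- move=> _ _ /mapP[i il ->] /mapP[k kl ->].
  have [oki qi] := lP i il; have [okk qk] := lP k kl.
  have [_ ->] := okP i oki; have [_ ->] := okP k okk.
  have far (a b : nat) : (a < b)%N -> (a %% 4 = b %% 4)%N -> level a + r + 4 * eps <= level b + r.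
    move=> ab e; have ab4 : (a + 4 <= b)%N.
      have : (4 %| b - a)%N by rewrite -eqn_mod_dvd ?(ltnW ab) // e.
      by move=> /dvdn_leq; rewrite subn_gt0 ab => /(_ isT); rewrite leq_subRL ?(ltnW ab).
    have : (a + 4)%:R * eps <= b%:R * eps by rewrite ler_pM2r // ler_nat.
    by rewrite natrD mulrDl /level; lra.
  have [lt|gt|->] := ltngtP (jj i) (jj k); last by apply: Or31.
    by apply: Or32; apply: far => //; rewrite qi qk.
  by apply: Or33; apply: far => //; rewrite qi qk.
Qed.

(** By Tonelli, the integral over the slice is the integral over the residue r in [0, eps] of the
    sum of the jumps at the levels congruent to r, and [sum_phi] bounds this sum for each r. *)
Lemma slice_integral (N A : R) : 0 < A -> c0 `^ P <= N * (2 * eps) `^ P ->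
  (\int[lam]_(tau in slice) `|J tau|%:E <= (eps * (4 * (N * A + A `^ (1 - Q) * w0 `^ Q)))%:E)%E.
Proof.
move=> A0 hN; set B := 4 * _.
have B0 : 0 <= B.
  have := sum_phi 0 A0 hN (introT andP (conj (lexx 0) (ltW eps_gt0))).
  by rewrite big_ord0 lee_fin.
have mJE : measurable_fun [set: BT] (fun tau : BT => `|J tau|%:E).
  by apply/measurable_EFinP; exact: measurableT_comp.
rewrite slice_pieces seqDU_bigcup_eq ge0_integral_bigcup //; last exact: measurable_funTS.
apply: lime_le; first by apply: is_cvg_nneseries => i _ _; apply: integral_ge0.
apply: nearW => n; rewrite big_mkord.
rewrite (eq_bigr (fun i : 'I_n => \int[leb]_(r in `[0%R, eps]) phi i r)%E); last by move=> i _; exact: int_piece.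
rewrite -ge0_integral_sum //; last by move=> i; apply: measurable_funTS; exact: mphi.
rewrite mulrC EFinM -[eps in leRHS](subr0 eps) -(leb_closed_itv (ltW eps_gt0)).
rewrite -integral_cst; last exact: measurable_itv.
apply: ge0_le_integral => //.
- by move=> r _; apply: sume_ge0 => i _.
- by apply: emeasurable_sum => i; apply: measurable_funTS; exact: mphi.
- by move=> r /=; rewrite in_itv /= => hr; exact: sum_phi.
Qed.

End Scale.

Lemma leaves_deeper : ~` deeper 0 = leaves theta.
Proof.
apply/seteqP; split => tau h; last first.
  move=> [i _ [h1 /= h2]]; apply: (nonleafP tau).2 h; exists (E i) => //.
  by rewrite subr0 in h2.
apply: contrapT => /nonleafP[sigma g1 g2]; apply: h.
have [i hi] := dseq_dense g2; exists i => //; split => /=; last first.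
  by rewrite subr0 (lt_le_trans hi) ?gp_le.
apply/eqP; rewrite eq_le gp_le /=; have := gp_ultra tau sigma (E i); apply: le_trans.
by rewrite g1 le_min lexx gp_sym ltW.
Qed.

Let marc : measurable (arc S Te : set BT).
Proof. exact: arc_measurable. Qed.

Let eps (k : nat) : R := c0 / 2 ^+ k.

Let eps_gt0 k : 0 < eps k.
Proof. by rewrite /eps divr_gt0 // exprn_gt0. Qed.

(** The ratio of the series over the scales c0 2^-k: the sum of the jumps grows by a factor 2^(P -
    P/Q), the range of the residues shrinks by 1/2. The exponent is P (1 - 1/P - 1/Q), which is
    negative. *)
Definition scale_ratio : R := 2 `^ (P - P / Q - 1).

Lemma scale_ratio_itv : 0 < scale_ratio < 1.
Proof.
rewrite /scale_ratio powR_gt0 //=.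
have h : P - P / Q - 1 < 0.
  have P0 := P_gt0; have : P * 1 < P * (P^-1 + Q^-1) by rewrite ltr_pM2l.
  by rewrite mulrDr divff ?gt_eqF // mulr1; lra.
have -> : P - P / Q - 1 = - (1 + P / Q - P) by lra.
rewrite powRN invf_lt1 ?powR_gt0 //.
have : 1 `^ (1 + P / Q - P) < 2 `^ (1 + P / Q - P).
  by apply: gt0_ltr_powR; rewrite ?nnegrE ?ltr1n //; lra.
by rewrite powR1.
Qed.

Let slice_eps k : (\int[lam]_(tau in slice (eps k)) `|J tau|%:E <= (8 * c0 * w0 * scale_ratio ^+ k)%:E)%E.
Proof.
set b : R := 2 ^+ k; have b0 : 0 < b by rewrite exprn_gt0.
have bn0 : b != 0 by rewrite gt_eqF.
have Q0 : 0 < Q by apply: lt_le_trans Q1.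
have w00 := w0_gt0; have c00 := c0_gt0.
(* With b^P as the bound on the number of points, this threshold balances the two terms of
   [slice_integral]: both become w0 b^(P - P/Q). *)
pose A := w0 * b `^ (- (P / Q)).
have A0 : 0 < A by rewrite mulr_gt0 ?powR_gt0.
have hN : c0 `^ P <= b `^ P * (2 * eps k) `^ P.
  rewrite -powRM ?(ltW b0) //; last by rewrite mulr_ge0 // ltW // eps_gt0.
  apply: ge0_ler_powR; rewrite ?nnegrE ?(ltW c00) ?(ltW P_gt0) //.
    by rewrite !mulr_ge0 ?(ltW b0) // ltW // eps_gt0.
  have -> : b * (2 * eps k) = 2 * c0 by rewrite /eps -/b; field.
  by lra.
apply: (le_trans (slice_integral (eps_gt0 k) A0 hN)); rewrite lee_fin.
have E1 : b `^ P * A = w0 * b `^ (P - P / Q).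
  by rewrite /A mulrCA -powRD // bn0 implybT.
have E2 : A `^ (1 - Q) * w0 `^ Q = w0 * b `^ (P - P / Q).
  rewrite /A powRM ?(ltW w00) ?powR_ge0 // -powRrM mulrAC -powRD; last first.
    by apply/implyP => _; rewrite gt_eqF.
  have -> : 1 - Q + Q = 1 by lra.
  rewrite powRr1 ?(ltW w00) //; congr (_ * _ `^ _).
  by rewrite mulrBr mulr1 mulNr divfK ?gt_eqF //; lra.
have E3 : scale_ratio ^+ k = b^-1 * b `^ (P - P / Q).
  rewrite /scale_ratio -powR_mulrn ?powR_ge0 // -powRrM mulrC powRrM powR_mulrn // -/b.
  by rewrite powRD ?bn0 ?implybT // powRN powRr1 ?(ltW b0) // mulrC.
by rewrite E1 E2 E3 /eps -/b; lra.
Qed.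

(** Take the least [k] for which [tau] is deeper than 2 eps_k; minimality excludes a depth greater
    than 2 eps_(k-1) = 4 eps_k. For [k = 0] this depth is excluded because theta oscillates by at
    most c0 on [s, t]. *)
Let main_cover tau : ~ arc S Te tau -> deeper 0 tau -> J tau <> 0 -> exists k, slice (eps k) tau.
Proof.
move=> na [i _ [b1 /= b2]] nJ; rewrite subr0 in b2.
have [f1 f2 f3 _] := off_arc na nJ; have [h1 _] := off_arc_hgt na nJ.
have bounded j : below (E j) tau -> hgt (E j) <= hgt tau + c0.
  rewrite /below /= -{1}(proj_repr (E j)) => /descendantP/andP[e1 e2].
  have := osc (ltW f1) e1 (le_trans e2 (ltW f3)).
  by rewrite h1 ler_norml => /andP[_]; rewrite /hgt; lra.
have exk : exists k, `[< deeper (2 * eps k) tau >].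
  have d0 : 0 < hgt (E i) - hgt tau by lra.
  have x0 : 0 <= 2 * c0 / (hgt (E i) - hgt tau) by rewrite divr_ge0 ?mulr_ge0 ?ltW.
  have /andP[_] := truncn_itv x0; set k := Num.truncn _ => hk.
  exists k.+1; apply/asboolP; exists i => //; split => //=.
  suff : 2 * eps k.+1 < hgt (E i) - hgt tau by lra.
  have k2 : (k.+1%:R : R) <= 2 ^+ k.+1 by rewrite -natrX ler_nat ltnW // ltn_expl.
  have := lt_le_trans hk k2; rewrite ltr_pdivrMr // => h.
  by rewrite /eps mulrA ltr_pdivrMr ?exprn_gt0 // [ltRHS]mulrC.
case: (ex_minnP exk) => k /asboolP dk kmin; exists k; split; first by split.
split => //; case: k dk kmin => [|k] dk kmin.
  move=> [j _ [c1 /= c2]]; have := bounded j c1.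
  by move: c2; rewrite /eps expr0 divr1; have := c0_gt0; lra.
have -> : 4 * eps k.+1 = 2 * eps k.
  by rewrite /eps exprS invfM; lra.
by move=> /asboolP/kmin; rewrite ltnn.
Qed.

Lemma off_arc_integral :
  (\int[lam]_(tau in ~` arc S Te) `|J tau|%:E <= (8 * c0 * w0 / (1 - scale_ratio))%:E)%E.
Proof.
have mJE : measurable_fun [set: BT] (fun tau : BT => `|J tau|%:E).
  by apply/measurable_EFinP; exact: measurableT_comp.
have mN : measurable (~` deeper 0) by apply: measurableC; exact: deeper_measurable.
rewrite (ge0_negligible_integral mN) //; last 3 first.
- exact: measurableC.
- exact: measurable_funTS.
- by rewrite leaves_deeper; exact: hlam.1.
have msl k : measurable (slice (eps k)) by exact: slice_measurable.
have -> : (\int[lam]_(tau in (~` arc S Te) `\` ~` deeper 0) `|J tau|%:E =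
   \int[lam]_(tau in \bigcup_k slice (eps k)) `|J tau|%:E)%E.
  rewrite [LHS]integral_mkcond [RHS]integral_mkcond; apply: eq_integral => tau _.
  rewrite /patch; case: (boolP (tau \in \bigcup_k _)) => [|h].
    rewrite inE => -[k _ [[na nJ] [[i _ [b1 b2]] _]]]; rewrite ifT // inE; split => //.
    move=> nd; apply: nd; exists i => //; split => //; move: b2 => /=.
    by have := eps_gt0 k; lra.
  case: ifP => //; rewrite inE => -[na /contrapT d].
  have [->|/eqP nJ] := eqVneq (J tau) 0; first by rewrite normr0.
  have [k hk] := main_cover na d nJ.
  by exfalso; move/negP: h; apply; rewrite inE; exists k.
rewrite seqDU_bigcup_eq ge0_integral_bigcup //; last first.
- exact: measurable_funTS.
- by move=> k; apply: measurableD => //; exact: bigsetU_measurable.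
apply: lime_le; first by apply: is_cvg_nneseries => i _ _; apply: integral_ge0.
apply: nearW => n; rewrite big_mkord.
have /andP[z0 z1] := scale_ratio_itv.
apply: (@le_trans _ _ (\sum_(k < n) (8 * c0 * w0 * scale_ratio ^+ k)%:E)%E).
  apply: lee_sum => k _; apply: le_trans (slice_eps k).
  apply: ge0_subset_integral => //.
  - by apply: measurableD => //; exact: bigsetU_measurable.
  - exact: measurable_funTS.
  - exact: subset_seqDU.
rewrite sumEFin lee_fin -mulr_sumr ler_wpM2l //.
  by rewrite !mulr_ge0 // ltW.
rewrite -[leRHS]mul1r ler_pdivlMr ?subr_gt0 //.
have := subrX1 scale_ratio n; have := exprn_ge0 n (ltW z0).
by set S := \sum_(i < n) _; lra.
Qed.

Variable K : R.
Hypothesis hK : forall r, s <= r -> r <= t -> `|rho r| <= K.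

Let K_ge0 : 0 <= K.
Proof. exact: le_trans (hK (lexx s) st). Qed.

Let gK r : `|g r| <= K.
Proof.
by rewrite gE; case: ifP => [/andP[/ltW ? ?]|_]; [exact: hK|rewrite normr0].
Qed.

Let JK tau : `|J tau| <= 2 * K.
Proof. by rewrite JE mulr_natl mulr2n (le_trans (ler_normB _ _)) // lerD. Qed.

Let gp_st : hgt S - gp S Te <= c0 /\ hgt Te - gp S Te <= c0.
Proof.
rewrite !hgt_proj gp_proj; have [x] := mt_ex theta (pt s) (pt t).
rewrite vs vt => /segP[]/andP[x1 x2] [<- _].
  have := osc (lexx s) x1 x2; have := osc x1 x2 (lexx t).
  by rewrite !ler_norml => /andP[? ?] /andP[? ?]; split; lra.
have xs : x = s by apply/eqP; rewrite eq_le x2 (le_trans st).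
have xt : x = t by apply/eqP; rewrite eq_le x1 (le_trans _ st) // -xs.
by rewrite -xt -xs !subrr !ltW.
Qed.

Let mJE : measurable_fun [set: BT] (fun tau : BT => `|J tau|%:E).
Proof. by apply/measurable_EFinP; exact: measurableT_comp. Qed.

(** On [pi s, pi t], which consists of two legs of length at most c0, the jump is only bounded by 2
    K: this is where sup |rho| enters. *)
Lemma jump_integral_le :
  (\int[lam]_(tau in setT) `|J tau|%:E <= (4 * K * c0 + 8 * c0 * w0 / (1 - scale_ratio))%:E)%E.
Proof.
rewrite -(setUv (arc S Te)) ge0_integral_setU //; last 3 first.
- exact: measurableC.
- exact: measurable_funTS.
- by apply/disj_setPS; rewrite setICr.
rewrite EFinD; apply: leeD; last exact: off_arc_integral.
have [g1 g2] := gp_st.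
apply: (@le_trans _ _ (\int[lam]_(tau in arc S Te) cst (2 * K)%:E tau)%E).
  apply: ge0_le_integral => //; first exact: measurable_funTS.
  by move=> tau _; rewrite lee_fin.
rewrite integral_cst // hlam.2 -EFinM lee_fin mdistE.
have := ler_wpM2l K_ge0 (lerD g1 g2); lra.
Qed.

Lemma jump_integrable : lam.-integrable setT (EFin \o J).
Proof.
apply/integrableP; split; first by apply/measurable_EFinP.
by apply: le_lt_trans jump_integral_le _; rewrite ltry.
Qed.

Lemma norm_jump_integral_le :
  `|\int[lam]_(tau in setT) J tau| <= 4 * K * c0 + 8 * c0 * w0 / (1 - scale_ratio).
Proof.
have Ji := jump_integrable.
rewrite -lee_fin /Rintegral -abse_EFin fineK ?integrable_fin_num //.
apply: le_trans jump_integral_le; apply: le_abse_integral => //.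
by apply/measurable_EFinP.
Qed.

(** * The estimate between two times of equal level *)

Section Loop.
Hypothesis thst : theta s = theta t.

Let m := gp S Te.
Let h := hgt S - m.

Let hTS : hgt Te = hgt S.
Proof. by rewrite !hgt_proj vs vt thst. Qed.

Let h_ge0 : 0 <= h.
Proof. by rewrite subr_ge0 gp_le. Qed.

(** The interval of visits of [a] contains [s] and that of [b] contains [t]. The cutoff leaves only
    the last visit of [a] and the first visit of [b], two times of (s, t) where theta equals m + r.
    The strict bounds on [r] exclude the common branching point and the ends pi s and pi t. *)
Let anc_sum r : 0 < r -> r < h -> `|J (anc S (m + r)) + J (anc Te (m + r))| <= w0.
Proof.
move=> r0 rh.
have rm : hgt rt <= m := root_gp_le S Te.
have rhS : hgt rt <= m + r <= hgt S by apply/andP; split; rewrite /h in rh; lra.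
have rhT : hgt rt <= m + r <= hgt Te by rewrite hTS.
set a := anc S _; set b := anc Te _.
have [aS hS] : gp a S = hgt a /\ hgt a = m + r by rewrite gp_anc ?hgt_anc.
have [bT hT] : gp b Te = hgt b /\ hgt b = m + r by rewrite gp_anc ?hgt_anc.
have aT : gp a Te <> hgt a.
  rewrite (gp_below aS (gpxx Te)) -/m hS => e.
  have h2 : m + r <= m by rewrite -e ge_min lexx orbT.
  lra.
have bS : gp b S <> hgt b.
  rewrite (gp_below bT (gpxx S)) hT gp_sym -/m => e.
  have : m + r <= m by rewrite -{1}e ge_min lexx orbT.
  lra.
have dv tau x (x01 : x \in `[0, 1]) : gp tau (proj (pt x)) = hgt tau <-> first_time tau <= x <= last_time tau.
  by have := descendantP tau (pt x); rewrite ptK.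
have s01 : s \in `[0, 1] by rewrite in_itv /= s0 (le_trans st).
have t01 : t \in `[0, 1] by rewrite in_itv /= t1 (le_trans s0).
move: aS bT aT bS => /(dv _ _ s01)/andP[a1 a2] /(dv _ _ t01)/andP[b1 b2].
move=> /(contra_not (dv _ _ t01).2)/negP; rewrite negb_and -!ltNge => aT.
move=> /(contra_not (dv _ _ s01).2)/negP; rewrite negb_and -!ltNge => bS.
have {}aT : last_time a < t by case/orP: aT => // /lt_le_trans/(_ a1); have := st; lra.
have {}bS : s < first_time b by case/orP: bS => // /(le_lt_trans b2); have := st; lra.
have [ea va pa] := last_time_proj (ltW (lt_le_trans aT t1)).
have [eb vb pb] := first_time_proj (ltW (le_lt_trans s0 bS)).
have tha : theta (last_time a) = m + r by rewrite -va -hgt_proj pa.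
have thb : theta (first_time b) = m + r by rewrite -vb -hgt_proj pb.
have lt_hS : m + r < theta s by have := rh; rewrite /h hgt_proj vs; lra.
have sa : s < last_time a.
  rewrite lt_neqAle a2 andbT; apply/eqP => e; move: lt_hS; rewrite {1}e tha; lra.
have bt : first_time b < t.
  rewrite lt_neqAle b1 andbT; apply/eqP => e; move: lt_hS; rewrite thst -e thb; lra.
have tb : t < last_time b.
  rewrite lt_neqAle b2 andbT; apply/eqP => e.
  have [|eb' vb' pb'] := @last_time_proj _ _ b; first by rewrite -e.
  have : theta t = m + r by rewrite e -vb' -hgt_proj pb'.
  by move: lt_hS; rewrite thst; lra.
rewrite !JE !gE (ltNge s) a1 /= sa (ltW aT) bS (ltW bt) (leNgt _ t) tb andbF /= subr0 sub0r addrC.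
rewrite leNgt; apply/negP => lt_w.
have : w0 `^ Q < `|rho (first_time b) - rho (last_time a)| `^ Q.
  apply: gt0_ltr_powR => //; rewrite ?nnegrE ?(ltW w0_gt0) //.
  exact: lt_le_trans Q1.
have [ab|ba] := leP (last_time a) (first_time b).
  have := hwQ (ltW sa) ab (ltW bt); rewrite tha thb => /(_ erefl).
  have := control_mono hw (lexx s) (ltW sa) ab (ltW bt) (lexx t); have := hww; lra.
have := hwQ (ltW bS) (ltW ba) (ltW aT); rewrite tha thb => /(_ erefl).
have := control_mono hw (lexx s) (ltW bS) (ltW ba) (ltW aT) (lexx t); have := hww.
rewrite distrC; lra.
Qed.

Let leg_int sigma : m <= hgt sigma -> hgt rt <= m -> hgt sigma = m + h ->
  (\int[lam]_(tau in leg sigma m (hgt sigma)) (J tau)%:E =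
   \int[leb]_(r in `[0%R, h]) (J (anc sigma (m + r)%R))%:E)%E /\
  leb.-integrable `[0, h] (fun r => (J (anc sigma (m + r)))%:E).
Proof.
move=> ms rm hs; have mEJ : measurable_fun [set: BT] (EFin \o J) by apply/measurable_EFinP.
split.
  rewrite hs; apply: (@leg_integral _ _ lam hlam sigma m h rm h_ge0 _ (EFin \o J)) => //.
    by rewrite hs.
  by apply: (integrableS measurableT) => //; [exact: leg_measurable|exact: jump_integrable].
have mI : measurable (`[0, h]%classic : set (measurableTypeR R)) by exact: measurable_itv.
apply: (@measurable_bounded_integrable _ _ _ leb (fun r => J (anc sigma (m + r))) _ mI).
- change (lebesgue_measure (`[0%R, h]%classic : set R) < +oo)%E.
  by rewrite leb_closed_itv // ltry.
- apply: measurable_funTS; apply: (@measurableT_comp _ _ _ _ _ _ J) => //.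
  apply: (@measurableT_comp _ _ _ _ _ _ (anc sigma : R -> BT) _ (fun r : measurableTypeR R => m + r)).
    exact: anc_measurable.
  by apply: measurable_funD; [exact: measurable_cst|exact: measurable_id].
- exists (2 * K); split; first exact: num_real.
  by move=> M KM r _ /=; apply: le_trans (JK _) (ltW KM).
Qed.

Lemma norm_loop_integral_le :
  `|\int[lam]_(tau in setT) J tau| <= c0 * w0 + 8 * c0 * w0 / (1 - scale_ratio).
Proof.
have Ji := jump_integrable.
have mEJ : measurable_fun [set: BT] (EFin \o J) by apply/measurable_EFinP.
rewrite -lee_fin /Rintegral -abse_EFin fineK ?integrable_fin_num //.
rewrite -(setUv (arc S Te)) integral_setU //; last 3 first.
- exact: measurableC.
- by rewrite setUv.
- by apply/disj_setPS; rewrite setICr.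
apply: (le_trans (lee_abs_add _ _)).
rewrite EFinD; apply: leeD; last first.
  apply: le_trans off_arc_integral; apply: le_abse_integral; last exact: measurable_funTS.
  exact: measurableC.
have rm : hgt rt <= m := root_gp_le S Te.
have lm0 : lam (leg Te m m) = 0%E.
  by rewrite lam_leg ?subrr // gp_ler.
have mTm : measurable (leg Te m m : set BT) by exact: leg_measurable.
have mT : measurable (leg Te m (hgt Te) : set BT) by exact: leg_measurable.
rewrite arc_legs integral_setU //; last 4 first.
- exact: leg_measurable.
- exact: measurableD.
- exact: measurable_funTS.
- by apply/disj_setPS; rewrite arc_legs_disjoint.
rewrite -(negligible_integral mTm mT) //; last first.
  exact: (integrableS measurableT).
have [i1 j1] := leg_int (gp_le S Te) rm (esym (subrKC _ _)).
have hsT : hgt Te = m + h by rewrite hTS /h; lra.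
have [i2 j2] := leg_int (gp_ler S Te) rm hsT.
(* Both legs have the same height [h], so that one variable [r] parametrizes them and the jumps add
   up inside the integral. *)
rewrite i1 i2 -integralD //.
have mI : measurable (`]0, h[%classic : set (measurableTypeR R)) by exact: measurable_itv.
set F := fun r : measurableTypeR R => ((J (anc S (m + r)))%:E + (J (anc Te (m + r)))%:E)%E.
have mFc : measurable_fun `[0, h]%classic F.
  by apply: emeasurable_funD; [exact: measurable_int j1|exact: measurable_int j2].
have -> : (\int[leb]_(x in `[0%R, h]) F x = \int[leb]_(x in `]0%R, h[) F x)%E.
  rewrite -integral_itv_obnd_cbnd; last by apply: measurable_funS mFc => //; exact: subset_itv_oc_cc.
  rewrite -integral_itv_bndo_bndc //; apply: measurable_funS mFc => //; exact: subset_itv_oo_cc.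
apply: (le_trans (le_abse_integral _ mI _)).
  by apply: measurable_funS mFc => //; exact: subset_itv_oo_cc.
apply: (@le_trans _ _ (\int[leb]_(r in `]0%R, h[) cst w0%:E r)%E).
  apply: ge0_le_integral => //.
    by apply: measurableT_comp => //; apply: measurable_funS mFc => //; exact: subset_itv_oo_cc.
  by move=> r /=; rewrite in_itv /= => /andP[r0 rh]; rewrite lee_fin anc_sum.
rewrite integral_cst //.
change (w0%:E * lebesgue_measure (`]0%R, h[%classic : set R) <= (c0 * w0)%:E)%E.
rewrite lebesgue_measure_itv /= lte_fin; have [_] := gp_st; rewrite hTS -/m -/h => hc0.
case: ifP => _; last by rewrite mule0 lee_fin mulr_ge0 // ltW.
by rewrite -EFinB -EFinM lee_fin subr0 mulrC ler_wpM2r // ltW.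
Qed.

End Loop.

End CoreEstimate.

(** * Variations *)

Section Variations.
Context {R : realType}.
Implicit Types (rel : R -> R -> Prop) (d : R -> R -> R) (u v w s t K P : R) (l : seq (R * R)).

(** Successive intervals, possibly with gaps between them. The relation [anyrel] gives the ordinary
    variation, and equality of the values of omega gives V_q(.|omega), so that both are treated at
    once. *)
Fixpoint chain rel u v l : Prop :=
  if l is p :: l' then [/\ u <= p.1, p.1 <= p.2, rel p.1 p.2 & chain rel p.2 v l'] else u <= v.

Lemma chain_le rel u v l : chain rel u v l -> u <= v.
Proof.
elim: l u => //= p l IH u [h1 h2 _ /IH h3].
exact: le_trans h1 (le_trans h2 h3).
Qed.

Lemma chain_cat rel u w v l1 l2 : chain rel u w l1 -> chain rel w v l2 -> chain rel u v (l1 ++ l2).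
Proof.
elim: l1 u => [|p l1 IH] u /=.
  case: l2 => [|p l2] /=; first exact: le_trans.
  by move=> uw [h1 h2 h3 h4]; split => //; exact: le_trans h1.
by move=> [h1 h2 h3 h4] h5; split => //; exact: IH.
Qed.

Lemma chain_widen rel u v u' v' l : u' <= u -> v <= v' -> chain rel u v l -> chain rel u' v' l.
Proof.
move=> uu vv; elim: l u u' uu => [|p l IH] u u' uu /=.
  by move=> uv; rewrite (le_trans uu) // (le_trans uv).
by move=> [h1 h2 h3 h4]; split => //; [exact: le_trans h1|exact: IH h4].
Qed.

Lemma chain_mem rel u v l p : chain rel u v l -> p \in l ->
  [/\ u <= p.1, p.1 <= p.2, p.2 <= v & rel p.1 p.2].
Proof.
elim: l u => // q l IH u /= [h1 h2 h3 h4]; rewrite inE => /orP[/eqP ->|pl].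
  by split => //; exact: chain_le h4.
have [a1 a2 a3 a4] := IH _ h4 pl; split => //.
exact: le_trans h1 (le_trans h2 a1).
Qed.

Lemma chain_sub rel rel' u v l : (forall s t, rel s t -> rel' s t) ->
  chain rel u v l -> chain rel' u v l.
Proof.
move=> rr; elim: l u => //= p l IH u [h1 h2 h3 h4].
by split => //; [exact: rr|exact: IH].
Qed.

Definition vsum P d l := \sum_(p <- l) `|d p.1 p.2| `^ P.

Lemma vsum_ge0 P d l : 0 <= vsum P d l.
Proof. by apply: sumr_ge0 => p _; exact: powR_ge0. Qed.

(* K bounds the P-variation of the increments d over [u, v], restricted to
   intervals whose end points are related by rel *)
Definition vle P rel d u v K : Prop :=
  0 <= K /\ forall l, chain rel u v l -> vsum P d l <= K `^ P.

Lemma vle_sub P rel rel' d u v u' v' K : (forall s t, rel' s t -> rel s t) ->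
  u <= u' -> v' <= v -> vle P rel d u v K -> vle P rel' d u' v' K.
Proof.
move=> rr uu vv [K0 h]; split => // l hl; apply: h.
exact: chain_widen uu vv (chain_sub rr hl).
Qed.

Lemma vle_le P rel d u v K K' : 0 <= P -> K <= K' -> vle P rel d u v K -> vle P rel d u v K'.
Proof.
move=> P0 KK [K0 h]; split; first exact: le_trans KK.
move=> l /h/le_trans; apply; apply: ge0_ler_powR; rewrite ?nnegrE //.
exact: le_trans KK.
Qed.

Lemma vle_incr P rel d u v K s t : 0 < P -> vle P rel d u v K ->
  u <= s -> s <= t -> t <= v -> rel s t -> `|d s t| <= K.
Proof.
move=> P0 [K0 h] us st tv r; rewrite leNgt; apply/negP => lt.
have : K `^ P < `|d s t| `^ P by apply: gt0_ltr_powR; rewrite ?nnegrE.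
have := h [:: (s, t)]; rewrite /vsum big_seq1 /= => /(_ _)/le_lt_trans q.
by move=> /q; rewrite ltxx => /(_ (And4 us st r tv)).
Qed.

Lemma vle_scale P rel d d1 u v K A : 1 <= P -> 0 <= A ->
  (forall s t, u <= s -> s <= t -> t <= v -> rel s t -> `|d s t| <= A * `|d1 s t|) ->
  vle P rel d1 u v K -> vle P rel d u v (A * K).
Proof.
move=> P1 A0 hd [K0 h]; split; first exact: mulr_ge0.
move=> l hl; rewrite powRM //.
apply: (@le_trans _ _ (A `^ P * vsum P d1 l)); last first.
  by apply: ler_wpM2l; [exact: powR_ge0|exact: h].
rewrite /vsum mulr_sumr !big_seq; apply: ler_sum => p pl.
have [a1 a2 a3 a4] := chain_mem hl pl.
rewrite -powRM //; apply: ge0_ler_powR; rewrite ?nnegrE ?mulr_ge0 //.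
  exact: le_trans P1.
exact: hd.
Qed.

(** Convexity of the power, applied to x + y = a (x / a) + b (y / b). *)
Lemma powR_convex (x y a b P : R) : 1 <= P -> 0 <= x -> 0 <= y -> 0 < a -> 0 < b -> a + b = 1 ->
  (x + y) `^ P <= a `^ (1 - P) * x `^ P + b `^ (1 - P) * y `^ P.
Proof.
move=> P1 x0 y0 a0 b0 ab.
have a01 : 0 <= a <= 1 by lra.
have [a00 a11] := andP a01.
have xa : x / a \in (`[0, +oo[%classic : set R) by rewrite inE /= in_itv /= andbT divr_ge0 // ltW.
have yb : y / b \in (`[0, +oo[%classic : set R) by rewrite inE /= in_itv /= andbT divr_ge0 // ltW.
have := convex_powR P1 (Itv01 a00 a11) xa yb.
move=> H; have {H} : (a * (x / a) + unstable.onem a * (y / b)) `^ P <=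
  a * (x / a) `^ P + unstable.onem a * (y / b) `^ P := H.
have -> : unstable.onem a = b by rewrite /unstable.onem; lra.
rewrite [a * (x / a)]mulrC [b * (y / b)]mulrC !divfK ?gt_eqF //; move=> /le_trans; apply.
have E c z : 0 < c -> 0 <= z -> c * (z / c) `^ P = c `^ (1 - P) * z `^ P.
  move=> c0 z0; rewrite powRM ?invr_ge0 ?(ltW c0) // mulrCA mulrC; congr (_ * _).
  rewrite powRD; last by apply/implyP => _; rewrite gt_eqF.
  by rewrite powRr1 ?(ltW c0) // -(powR_inv1 (ltW c0)) -powRrM mulN1r.
by rewrite !E.
Qed.

Lemma vle_add P rel d d1 d2 u v K1 K2 : 1 <= P ->
  (forall s t, u <= s -> s <= t -> t <= v -> rel s t -> `|d s t| <= `|d1 s t| + `|d2 s t|) ->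
  vle P rel d1 u v K1 -> vle P rel d2 u v K2 -> vle P rel d u v (K1 + K2).
Proof.
move=> P1 hd [K10 h1] [K20 h2]; split; first exact: addr_ge0.
have P0 : 0 < P by exact: lt_le_trans P1.
(* Minkowski: perturb K1 and K2 to make them positive *)
move=> l hl; suff pert e : 0 < e -> vsum P d l <= (K1 + K2 + e) `^ P.
  have [l0|l0] := leP (vsum P d l) 0.
    by apply: le_trans l0 _; exact: powR_ge0.
  rewrite leNgt; apply/negP => lt.
  pose r := vsum P d l `^ P^-1.
  have rP : r `^ P = vsum P d l by rewrite -powRrM mulVf ?gt_eqF // powRr1 // ltW.
  have lr : K1 + K2 < r.
    rewrite ltNge; apply/negP => rK; move: lt; rewrite -rP ltNge => /negP; apply.
    by apply: ge0_ler_powR; rewrite ?nnegrE ?powR_ge0 ?addr_ge0 // ltW.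
  have e0 : 0 < (r - (K1 + K2)) / 2 by lra.
  have := pert _ e0; rewrite -rP => q.
  have : (K1 + K2 + (r - (K1 + K2)) / 2) `^ P < r `^ P.
    by apply: gt0_ltr_powR; rewrite ?nnegrE ?powR_ge0 //; lra.
  by rewrite ltNge q.
move=> e0; pose L1 := K1 + e / 2; pose L2 := K2 + e / 2.
have L10 : 0 < L1 by rewrite /L1; lra.
have L20 : 0 < L2 by rewrite /L2; lra.
have -> : K1 + K2 + e = L1 + L2 by rewrite /L1 /L2; lra.
have L0 : 0 < L1 + L2 by lra.
(* With weights proportional to [L1] and [L2] the two terms of the convexity bound add up to exactly
   (L1 + L2)^P. *)
pose a := L1 / (L1 + L2); pose b := L2 / (L1 + L2).
have a0 : 0 < a by rewrite divr_gt0.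
have b0 : 0 < b by rewrite divr_gt0.
have ab : a + b = 1 by rewrite /a /b -mulrDl divff ?gt_eqF.
have n1 : vsum P d1 l <= L1 `^ P.
  by apply: (le_trans (h1 l hl)); apply: ge0_ler_powR; rewrite ?nnegrE // /L1; lra.
have n2 : vsum P d2 l <= L2 `^ P.
  by apply: (le_trans (h2 l hl)); apply: ge0_ler_powR; rewrite ?nnegrE // /L2; lra.
apply: (@le_trans _ _ (a `^ (1 - P) * vsum P d1 l + b `^ (1 - P) * vsum P d2 l)).
  rewrite /vsum !mulr_sumr -big_split /= !big_seq; apply: ler_sum => p pl.
  have [q1 q2 q3 q4] := chain_mem hl pl.
  apply: le_trans (powR_convex P1 (normr_ge0 _) (normr_ge0 _) a0 b0 ab).
  apply: ge0_ler_powR; rewrite ?nnegrE ?addr_ge0 //; first exact: ltW.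
  exact: hd.
apply: (@le_trans _ _ (a `^ (1 - P) * L1 `^ P + b `^ (1 - P) * L2 `^ P)).
  by apply: lerD; apply: ler_wpM2l => //; exact: powR_ge0.
have E L : 0 < L -> (L / (L1 + L2)) `^ (1 - P) * L `^ P = L * (L1 + L2) `^ (P - 1).
  move=> l0; rewrite powRM ?invr_ge0 ?(ltW L0) ?(ltW l0) // mulrAC -powRD; last first.
    by apply/implyP => _; rewrite gt_eqF.
  have -> : 1 - P + P = 1 by lra.
  rewrite powRr1 ?(ltW l0) //; congr (_ * _).
  by rewrite -powR_inv1 ?(ltW L0) // -powRrM mulN1r opprB.
rewrite !E // -mulrDl -{1}(powRr1 (ltW L0)) -powRD; last first.
  by apply/implyP => _; rewrite gt_eqF.
by have -> : 1 + (P - 1) = P by lra.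
Qed.

Lemma vle0 P rel u v : 0 < P -> vle P rel (fun _ _ => 0) u v 0.
Proof.
move=> P0; split => // l _; rewrite /vsum big1 ?powR_ge0 // => p _.
by rewrite normr0 powR0 // gt_eqF.
Qed.

Lemma vle_sum P rel d u v n (D : 'I_n -> R -> R -> R) (K : 'I_n -> R) : 1 <= P ->
  (forall s t, u <= s -> s <= t -> t <= v -> rel s t -> `|d s t| <= \sum_k `|D k s t|) ->
  (forall k, vle P rel (D k) u v (K k)) -> vle P rel d u v (\sum_k K k).
Proof.
move=> P1 hd hD; have P0 : 0 < P by exact: lt_le_trans P1.
have H : vle P rel (fun s t => \sum_k `|D k s t|) u v (\sum_k K k).
  elim: n D K {hd} hD => [|n IH] D K hD.
    rewrite big_ord0; have [_ h] := vle0 rel u v P0; split => // l /h; apply: le_trans.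
    by apply: ler_sum => p _; rewrite big_ord0.
  rewrite big_ord_recl.
  apply: (vle_add (d1 := D ord0) (d2 := fun s t => \sum_k `|D (lift ord0 k) s t|)) => //.
    by move=> s t *; rewrite big_ord_recl (le_trans (ler_normD _ _)) // normr_id.
  exact: IH.
rewrite -[\sum_k K k]mul1r; apply: vle_scale H => // s t us st tv r.
by rewrite mul1r (le_trans (hd s t us st tv r)) // ler_norm.
Qed.

(** Each increment is at most [K], so that its power P' is at most K^(P' - P) times its power P. *)
Lemma vle_exponent P P' rel d u v K : 0 < P -> P <= P' -> vle P rel d u v K -> vle P' rel d u v K.
Proof.
move=> P0 PP h; have [K0 h0] := h; split => // l hl.
apply: (@le_trans _ _ (K `^ (P' - P) * vsum P d l)).
  rewrite /vsum mulr_sumr !big_seq; apply: ler_sum => p pl.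
  have [q1 q2 q3 q4] := chain_mem hl pl.
  have dK := vle_incr P0 h q1 q2 q3 q4.
  have -> : P' = (P' - P) + P by lra.
  rewrite powRD; last by apply/implyP => /eqP; have := lt_le_trans P0 PP; lra.
  have -> : P' - P + P - P = P' - P by lra.
  apply: ler_wpM2r; first exact: powR_ge0.
  by apply: ge0_ler_powR; rewrite ?nnegrE //; lra.
apply: (@le_trans _ _ (K `^ (P' - P) * K `^ P)).
  by apply: ler_wpM2l; [exact: powR_ge0|exact: h0].
have -> : K `^ P' = K `^ ((P' - P) + P) by congr (_ `^ _); lra.
rewrite -powRD //; apply/implyP => /eqP.
by have := lt_le_trans P0 PP; lra.
Qed.

Lemma control_vle P rel d u v c K : 0 < P -> control u v c -> u <= v -> 0 <= K -> c u v <= K `^ P ->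
  (forall s t, u <= s -> s <= t -> t <= v -> rel s t -> `|d s t| `^ P <= c s t) ->
  vle P rel d u v K.
Proof.
move=> P0 hc uv K0 hK hd; split => // l hl; apply: le_trans hK.
suff H w : u <= w -> w <= v -> chain rel w v l -> vsum P d l <= c w v by exact: H.
elim: l w {hl} => [|p l IH] w uw wv /=.
  by move=> _; rewrite /vsum big_nil; apply: hc.1.
move=> [h1 h2 h3 h4]; have p2v := chain_le h4.
have up1 := le_trans uw h1; have up2 := le_trans up1 h2.
rewrite /vsum big_cons; have := IH _ up2 p2v h4; rewrite /vsum.
have := hd _ _ up1 h2 p2v h3.
have := hc.2 w p.1 p.2 uw h1 h2 p2v; have := hc.2 w p.2 v uw (le_trans h1 h2) p2v (lexx v).
have := hc.1 w p.1 uw h1 (le_trans h2 p2v).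
lra.
Qed.

(** The variation over [s, t] as a real number, meaningful where [vle] provides a bound. It is
    superadditive because chains over adjacent intervals concatenate, and it is the control to which
    the estimates of the integral are applied. *)
Definition vsup P rel d s t : R := sup [set vsum P d l | l in [set l | chain rel s t l]].

Section Vsup.
Variables (P : R) (rel : R -> R -> Prop) (d : R -> R -> R) (u v K : R).
Hypothesis h : vle P rel d u v K.

Let ne s t : s <= t -> [set vsum P d l | l in [set l | chain rel s t l]] !=set0.
Proof. by move=> st; exists (vsum P d [::]), [::]. Qed.

Let ubK s t : u <= s -> t <= v -> ubound [set vsum P d l | l in [set l | chain rel s t l]] (K `^ P).
Proof. by move=> us tv _ [l /= hl <-]; apply: h.2; exact: chain_widen us tv hl. Qed.

Lemma vsup_ub s t l : u <= s -> t <= v -> chain rel s t l -> vsum P d l <= vsup P rel d s t.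
Proof. by move=> us tv hl; apply: ub_le_sup; [exists (K `^ P); exact: ubK|exists l]. Qed.

Lemma vsup_le s t : u <= s -> s <= t -> t <= v -> vsup P rel d s t <= K `^ P.
Proof. by move=> us st tv; apply: ge_sup; [exact: ne|exact: ubK]. Qed.

Lemma vsup_adherent s t e : u <= s -> s <= t -> t <= v -> 0 < e ->
  exists2 l, chain rel s t l & vsup P rel d s t - e < vsum P d l.
Proof.
move=> us st tv e0.
have hs : has_sup [set vsum P d l | l in [set l | chain rel s t l]].
  by split; [exact: ne|exists (K `^ P); exact: ubK].
by have [_ [l hl <-] lt] := sup_adherent e0 hs; exists l.
Qed.

Lemma vsup_control : control u v (vsup P rel d).
Proof.
split=> [s t us st tv|s t r us st tr rv].
  by apply: le_trans (vsup_ub (l := [::]) us tv st); exact: vsum_ge0.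
have ur := le_trans us st; have tv := le_trans tr rv.
apply/ler_addgt0Pr => e e0; have e2 : 0 < e / 2 by lra.
have [l1 c1 q1] := vsup_adherent us st tv e2.
have [l2 c2 q2] := vsup_adherent ur tr rv e2.
have := vsup_ub us rv (chain_cat c1 c2).
by rewrite /vsum big_cat /= -/(vsum P d l1) -/(vsum P d l2); lra.
Qed.

Lemma vsup_incr s t : u <= s -> s <= t -> t <= v -> rel s t -> `|d s t| `^ P <= vsup P rel d s t.
Proof.
move=> us st tv r; have := @vsup_ub s t [:: (s, t)] us tv.
by rewrite /vsum big_seq1 /=; apply; split.
Qed.

End Vsup.

Lemma powR_norm_continuous P : 1 <= P -> continuous (fun x : R => `|x| `^ P).
Proof.
move=> P1 x; have P0 : 0 < P by exact: lt_le_trans P1.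
have [->|x0] := eqVneq x 0; last first.
  apply: (@continuous_comp _ _ _ (fun x : R => `|x|) (fun y : R => y `^ P)).
    exact: norm_continuous.
  apply: differentiable_continuous; apply/derivable1_diffP.
  by apply: derivable_powR; rewrite in_itv /= andbT normr_gt0.
rewrite /continuous_at normr0 powR0 ?gt_eqF //.
apply: (@squeeze_cvgr _ _ _ _ (fun=> 0) (fun y : R => `|y|)).
- have : nbhs (0 : R) (ball (0 : R) 1) by exact: nbhsx_ballx.
  apply: filterS => y; rewrite /ball /= sub0r normrN => y1.
  rewrite powR_ge0 /=; have [->|y0] := eqVneq y 0; first by rewrite normr0 powR0 ?gt_eqF.
  have yp : 0 < `|y| by rewrite normr_gt0.
  have -> : P = 1 + (P - 1) by lra.
  rewrite powRD; last by apply/implyP => _; rewrite gt_eqF.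
  rewrite powRr1 // ler_piMr // -[leRHS](_ : 1 `^ (P - 1) = 1); last by rewrite powR1.
  by apply: ge0_ler_powR; rewrite ?nnegrE ?ler01 //; [lra|exact: ltW].
- exact: cvg_cst.
- by have := @norm_continuous _ R 0; rewrite /continuous_at normr0.
Qed.

(** The sum over one fixed chain depends continuously on finitely many increments, so that a uniform
    bound survives pointwise limits. *)
Lemma vle_lim P rel (dn : nat -> R -> R -> R) d u v K : 1 <= P ->
  (forall s t, u <= s -> s <= t -> t <= v -> dn n s t @[n --> \oo] --> d s t) ->
  (exists N, forall n, (N <= n)%N -> vle P rel (dn n) u v K) -> vle P rel d u v K.
Proof.
move=> P1 hd [N hn]; split; first by have [] := hn N (leqnn N).
have P0 : 0 < P by exact: lt_le_trans P1.
move=> l hl; have cv : vsum P (dn n) l @[n --> \oo] --> vsum P d l.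
  rewrite /vsum; elim: l u hl hd {hn} => [|p l IH] w hl hd.
    by rewrite big_nil; under eq_fun do rewrite big_nil; exact: cvg_cst.
  rewrite big_cons; under eq_fun do rewrite big_cons.
  have [h1 h2 h3 h4] := hl; apply: cvgD.
    apply: (@cvg_comp _ _ _ (fun n => dn n p.1 p.2) (fun x => `|x| `^ P) _ (nbhs (d p.1 p.2))).
      by apply: hd => //; exact: chain_le h4.
    exact: powR_norm_continuous.
  apply: (IH p.2) => // s t ps st tv; apply: hd => //.
  exact: le_trans h1 (le_trans h2 ps).
rewrite -(cvg_lim (@Rhausdorff R) cv); apply: limr_le; first exact: cvgP cv.
by exists N => // n /= Nn; have [_] := hn n Nn; exact.
Qed.

Lemma chain_split rel u w v l : chain rel u v l -> u <= w -> w <= v ->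
  exists l1 l2, [/\ chain rel u w l1, chain rel w v l2 &
    l = l1 ++ l2 \/ exists p, l = l1 ++ p :: l2 /\ [/\ u <= p.1, p.1 <= p.2 & p.2 <= v]].
Proof.
elim: l u => [|p l IH] u; first by exists [::], [::]; split => //; left.
move=> /= [h1 h2 h3 h4] uw wv; have p2v := chain_le h4.
have [wp1|p1w] := leP w p.1.
  by exists [::], (p :: l); split => //; left.
have [p2w|wp2] := leP p.2 w.
  have [l1 [l2 [c1 c2 e]]] := IH _ h4 p2w wv.
  exists (p :: l1), l2; split => //; case: e => [->|[q [-> [q1 q2 q3]]]]; first by left.
  by right; exists q; split => //; split => //; exact: le_trans (le_trans h1 h2) q1.
exists [::], l; split => //; first by apply: chain_widen h4 => //; exact: ltW.
by right; exists p.
Qed.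

(** At most one interval of a chain straddles [w], and it contributes at most M^P. It is not cut at
    [w], because its two halves need not satisfy [rel]. *)
Lemma vle_glue P rel d u w v K1 K2 M : 1 <= P -> u <= w -> w <= v ->
  (forall s t, u <= s -> s <= t -> t <= v -> `|d s t| <= M) ->
  vle P rel d u w K1 -> vle P rel d w v K2 ->
  vle P rel d u v ((K1 `^ P + M `^ P + K2 `^ P) `^ P^-1).
Proof.
move=> P1 uw wv hM h1 h2; have P0 : 0 < P by exact: lt_le_trans P1.
split; first exact: powR_ge0.
have s0 : 0 <= K1 `^ P + M `^ P + K2 `^ P by rewrite !addr_ge0 ?powR_ge0.
move=> l; rewrite -powRrM mulVf ?gt_eqF // powRr1 //.
move=> /chain_split/(_ uw wv)[l1 [l2 [c1 c2 e]]].
have := h1.2 _ c1; have := h2.2 _ c2; have := powR_ge0 M P.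
case: e => [->|[p [-> [p1 p2 p3]]]]; rewrite /vsum big_cat ?big_cons /=; first by lra.
have : `|d p.1 p.2| `^ P <= M `^ P.
  apply: ge0_ler_powR; rewrite ?nnegrE ?(ltW P0) //; last exact: hM.
  exact: le_trans (hM p.1 p.2 p1 p2 p3).
lra.
Qed.

(** Time reversal, through which smallness of the variation to the left of a time follows from
    smallness to the right. *)
Lemma chain_rev rel u v l : chain rel u v l ->
  chain (fun s t => rel (1 - t) (1 - s)) (1 - v) (1 - u) (rev [seq (1 - p.2, 1 - p.1) | p <- l]).
Proof.
elim: l u => [|p l IH] u /=; first by rewrite /rev /= => uv; lra.
move=> [h1 h2 h3 /IH c]; rewrite rev_cons -cats1; apply: chain_cat c _ => /=.
split; [by lra|by lra| |by lra].
by rewrite !subKr.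
Qed.

Lemma vsum_rev P d l : vsum P (fun s t => d (1 - t) (1 - s)) (rev [seq (1 - p.2, 1 - p.1) | p <- l]) = vsum P d l.
Proof.
rewrite /vsum (perm_big [seq (1 - p.2, 1 - p.1) | p <- l]) /=; last by rewrite perm_rev.
by rewrite big_map; apply: eq_bigr => p _ /=; rewrite !subKr.
Qed.

Lemma vle_rev P rel d u v K : vle P rel d u v K ->
  vle P (fun s t => rel (1 - t) (1 - s)) (fun s t => d (1 - t) (1 - s)) (1 - v) (1 - u) K.
Proof.
move=> [K0 h]; split => // l hl; rewrite -vsum_rev.
have -> : vsum P (fun s t => d (1 - (1 - s)) (1 - (1 - t))) (rev [seq (1 - p.2, 1 - p.1) | p <- l]) =
  vsum P d (rev [seq (1 - p.2, 1 - p.1) | p <- l]).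
  by rewrite /vsum; apply: eq_bigr => p _; rewrite !subKr.
apply: h; have := chain_rev hl; rewrite !subKr.
by apply: chain_sub => s t; rewrite !subKr.
Qed.

Definition incr (f : R -> R) s t := f t - f s.
Definition anyrel s t := True.

(** Degenerate intervals at [t] are dropped, and by continuity of [f] the next interval may start at
    [w], slightly after [t], at the cost [e]. *)
Lemma chain_shift P (f : R -> R) t v l e : 1 <= P -> continuous f -> 0 < e -> t < v ->
  chain anyrel t v l -> exists2 h, 0 < h & forall w, t <= w -> w <= t + h -> w <= v ->
    exists2 l', chain anyrel w v l' & vsum P (incr f) l - e <= vsum P (incr f) l'.
Proof.
move=> P1 cf e0; elim: l t => [|p l IH] t tv.
  move=> _; exists 1 => // w _ _ wv; exists [::] => //.
  by rewrite /vsum !big_nil; lra.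
move=> /= [h1 h2 _ h4].
have [tp|pt_] := ltP t p.1.
  exists (p.1 - t); first by lra.
  by move=> w w1 w2 w3; exists (p :: l); [split => //; lra|lra].
have pe : p.1 = t by apply/eqP; rewrite eq_le pt_ h1.
have [tp2|p2t] := ltP t p.2; last first.
  have pe2 : p.2 = t by apply/eqP; rewrite eq_le p2t -pe h2.
  rewrite pe2 in h4; have [h h0 H] := IH t tv h4; exists h => // w w1 w2 w3.
  have [l' c q] := H w w1 w2 w3; exists l' => //.
  rewrite /vsum big_cons /incr pe pe2 subrr normr0 powR0 ?add0r //.
  by rewrite gt_eqF // (lt_le_trans _ P1).
have cg : continuous (fun w => `|f p.2 - f w| `^ P).
  move=> w; apply: (@continuous_comp _ _ _ (fun w => f p.2 - f w) (fun x : R => `|x| `^ P)).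
    by apply: cvgB; [exact: cvg_cst|exact: cf].
  exact: powR_norm_continuous.
have /cvg_ballP/(_ _ e0) := cg t; rewrite /= => -[h /= h0 H].
exists (Num.min (h / 2) (p.2 - t)); first by rewrite lt_min; apply/andP; split; lra.
move=> w w1 w2 w3; have w4 : w <= t + h / 2.
  by apply: (le_trans w2); rewrite lerD2l ge_min lexx.
have w5 : w <= p.2 by apply: (le_trans w2); rewrite -lerBrDl ge_min lexx orbT.
exists ((w, p.2) :: l) => //=.
rewrite /vsum !big_cons /incr /= pe; have := H w; rewrite /ball /= => /(_ _)/ltW.
rewrite distrC ger0_norm ?subr_ge0 // => /(_ _)/ler_distlDr.
move=> /(_ _)/=; lra.
Qed.

(** A nearly optimal chain over [t, v] can be moved into [w, v] with little loss; by superadditivity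
    little variation is left for [t, w]. *)
Lemma right_small P (f : R -> R) t v K e : 1 <= P -> continuous f -> 0 < e -> t < v ->
  vle P anyrel (incr f) t v K ->
  exists2 h, 0 < h & forall w, t <= w -> w <= t + h -> w <= v -> vle P anyrel (incr f) t w e.
Proof.
move=> P1 cf e0 tv hv; have P0 : 0 < P by exact: lt_le_trans P1.
have e2 : 0 < e `^ P / 2 by rewrite divr_gt0 // powR_gt0.
have [l c q] := vsup_adherent hv (lexx t) (ltW tv) (lexx v) e2.
have [h h0 H] := chain_shift P1 cf e2 tv c.
exists h => // w w1 w2 w3; split; first exact: ltW.
move=> l1 c1; have [l2 c2 q2] := H w w1 w2 w3.
have := vsup_ub hv (lexx t) (lexx v) (chain_cat c1 c2).
by rewrite /vsum big_cat /= -/(vsum _ _ l1) -/(vsum _ _ l2); lra.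
Qed.

Lemma left_small P (f : R -> R) u t K e : 1 <= P -> continuous f -> 0 < e -> u < t ->
  vle P anyrel (incr f) u t K ->
  exists2 h, 0 < h & forall w, w <= t -> t - h <= w -> u <= w -> vle P anyrel (incr f) w t e.
Proof.
move=> P1 cf e0 ut hv; have P0 : 0 < P by exact: lt_le_trans P1.
pose g x := f (1 - x).
have cg : continuous g.
  move=> x; apply: (@continuous_comp _ _ _ (fun x : R => 1 - x) f); last exact: cf.
  by apply: cvgB; [exact: cvg_cst|exact: cvg_id].
have E s r : incr g s r = - incr f (1 - r) (1 - s) by rewrite /incr /g; lra.
have hg : vle P anyrel (incr g) (1 - t) (1 - u) K.
  rewrite -[K]mul1r; apply: (vle_scale P1 ler01 _ (vle_rev hv)) => s r *.
  by rewrite E normrN mul1r.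
have tu : 1 - t < 1 - u by lra.
have [h h0 H] := right_small P1 cg e0 tu hg; exists h => // w w1 w2 w3.
have := H (1 - w); rewrite !lerD2l !lerN2 => /(_ w1 _ w3) hh.
have {hh} : vle P anyrel (incr g) (1 - t) (1 - w) e by apply: hh; lra.
move=> /vle_rev; rewrite !subKr => hr; rewrite -[e]mul1r; apply: (vle_scale P1 ler01 _ hr) => s r *.
by rewrite E normrN mul1r !subKr.
Qed.

(* By continuity, the variation of each f i over small intervals is small, so
   that [0, 1] is covered by finitely many steps. *)
Lemma small_variation_ind (I : finType) (P : I -> R) (f : I -> R -> R) (K : I -> R) e
    (Pr : R -> Prop) :
  (forall i, 1 <= P i) -> (forall i, continuous (f i)) ->
  (forall i, vle (P i) anyrel (incr (f i)) 0 1 (K i)) -> 0 < e -> Pr 0 ->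
  (forall u v, 0 <= u -> u <= v -> v <= 1 ->
     (forall i, vle (P i) anyrel (incr (f i)) u v e) -> Pr u -> Pr v) -> Pr 1.
Proof.
move=> P1 cf hv e0 Pr0 step.
have fin (Q : I -> R -> Prop) : (forall i, exists2 h : R, 0 < h & forall h', 0 <= h' -> h' <= h -> Q i h') ->
    exists2 h : R, 0 < h & forall i h', 0 <= h' -> h' <= h -> Q i h'.
  move=> hQ; have /choice[h hh] : forall i, exists h : R, 0 < h /\ forall h', 0 <= h' -> h' <= h -> Q i h'.
    by move=> i; have [h h0 H] := hQ i; exists h.
  exists (\big[Num.min/1]_i h i).
    by elim/big_ind: _ => // [x y x0 y0|i _]; [rewrite lt_min x0|exact: (hh i).1].
  move=> i h' h0 hle; apply: (hh i).2 => //; apply: (le_trans hle).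
  exact: bigmin_le_cond.
have right t : 0 <= t -> t < 1 -> exists2 h, 0 < h & forall i h', 0 <= h' -> h' <= h ->
    t + h' <= 1 -> vle (P i) anyrel (incr (f i)) t (t + h') e.
  move=> t0 t1; apply: fin => i.
  have hi : vle (P i) anyrel (incr (f i)) t 1 (K i) by apply: vle_sub (hv i).
  have [h h0 H] := right_small (P1 i) (cf i) e0 t1 hi; exists h => // h' a b c.
  by apply: H => //; rewrite ?lerDl ?lerD2l.
have left t : 0 < t -> t <= 1 -> exists2 h, 0 < h & forall i h', 0 <= h' -> h' <= h ->
    0 <= t - h' -> vle (P i) anyrel (incr (f i)) (t - h') t e.
  move=> t0 t1; apply: fin => i.
  have hi : vle (P i) anyrel (incr (f i)) 0 t (K i) by apply: vle_sub (hv i).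
  have [h h0 H] := left_small (P1 i) (cf i) e0 t0 hi; exists h => // h' a b c.
  by apply: H => //; rewrite ?gerBl ?lerD2l ?lerN2.
(* Induction over the reals: [left] shows that sup S belongs to S, and [right] would extend S beyond
   its supremum if this were less than 1. *)
pose S := [set t | [/\ 0 <= t, t <= 1 & Pr t]].
have S0 : S 0 by [].
have hS : has_sup S by split; [exists 0|exists 1 => t []].
pose t := sup S.
have t0 : 0 <= t by apply: ub_le_sup => //; exists 1 => x [].
have t1 : t <= 1 by apply: ge_sup; [exists 0|move=> x []].
have Prt : Pr t.
  move: t0; rewrite le_eqVlt => /orP[/eqP <-//|tpos].
  have [h h0 H] := left t tpos t1.
  have [x [x0 x1 Prx] xt] := sup_adherent h0 hS.
  have xt' : x <= t by apply: ub_le_sup => //; exists 1 => y [].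
  apply: (step x t) => // i.
  have := H i (t - x); rewrite subKr; apply => //; first by rewrite subr_ge0.
  by move: xt; rewrite -/t; lra.
move: t1; rewrite le_eqVlt => /orP[/eqP <-//|tlt].
have [h h0 H] := right t t0 tlt.
pose h' := Num.min h (1 - t).
have h'0 : 0 < h' by rewrite lt_min h0 subr_gt0.
have h'h : h' <= h by rewrite ge_min lexx.
have h'1 : t + h' <= 1 by rewrite -lerBrDl ge_min lexx orbT.
have : t + h' <= t.
  apply: ub_le_sup; first by exists 1 => y [].
  split => //; first by rewrite addr_ge0 // ltW.
  apply: (step t) => //; first by rewrite lerDl ltW.
  by move=> i; apply: H => //; exact: ltW.
by rewrite gerDl leNgt h'0.
Qed.

End Variations.

(** * Chains of intervals versus subdivisions *)

Section VariationBridge.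
Context {R : realType}.
Implicit Types (F : R -> R -> R) (x u v K : R) (s : seq R) (l : seq (R * R)).

(** [flat] leads from chains to sequences of times. In the other direction, [pairs] keeps every
    second interval, as V_q(.|omega) does, and [steps] keeps all of them, as V_p does. *)
Fixpoint flat l : seq R := if l is p :: l' then p.1 :: p.2 :: flat l' else [::].

Fixpoint pairs s : seq (R * R) :=
  if s is a :: s1 then if s1 is b :: s2 then (a, b) :: pairs s2 else [::] else [::].

Fixpoint steps x s : seq (R * R) := if s is y :: s' then (x, y) :: steps y s' else [::].

Lemma seq_ind2 (Q : seq R -> Prop) : Q [::] -> (forall a, Q [:: a]) ->
  (forall a b s, Q s -> Q [:: a, b & s]) -> forall s, Q s.
Proof.
move=> q0 q1 q2 s; have [n] := ubnP (size s); elim: n s => // n IH [|a [|b s]] //= sn.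
by apply: q2; apply: IH; rewrite -ltnS ltnW.
Qed.

Lemma pairs_flat l : pairs (flat l) = l.
Proof. by elim: l => //= -[a b] l ->. Qed.

Lemma sum_pairs F s :
  \sum_(k < (size s)./2) F s`_(k.*2) s`_(k.*2.+1) = \sum_(p <- pairs s) F p.1 p.2.
Proof.
elim/seq_ind2: s => [|a|a b s IH] /=; rewrite ?big_ord0 ?big_nil //.
by rewrite big_ord_recl big_cons /= -IH.
Qed.

Lemma sum_steps F x s :
  \sum_(k < size s) F (x :: s)`_k (x :: s)`_k.+1 = \sum_(p <- steps x s) F p.1 p.2.
Proof.
elim: s x => [|y s IH] x /=; rewrite ?big_ord0 ?big_nil //.
by rewrite big_ord_recl big_cons /= -IH.
Qed.

Lemma sum_flat_le F x l : (forall a b, 0 <= F a b) ->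
  \sum_(p <- l) F p.1 p.2 <= \sum_(p <- steps x (flat l)) F p.1 p.2.
Proof.
move=> F0; elim: l x => [|p l IH] x /=; first by rewrite !big_nil.
rewrite !big_cons /=; have := IH p.2; have := F0 x p.1; lra.
Qed.

Lemma chain_flat rel u v l : chain rel u v l ->
  path <=%R u (flat l) /\ {subset flat l <= `[u, v]}.
Proof.
elim: l u => //= p l IH u [h1 h2 _ h4]; have [i1 i2] := IH _ h4; have h5 := chain_le h4.
rewrite h1 h2 i1; split => // z; rewrite !in_cons => /or3P[/eqP ->|/eqP ->|/i2].
- by rewrite in_itv /= h1 (le_trans h2).
- by rewrite in_itv /= h5 (le_trans h1).
- by rewrite !in_itv /= => /andP[a ->]; rewrite (le_trans h1) // (le_trans h2).
Qed.

Lemma size_flat l : size (flat l) = (size l).*2.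
Proof. by elim: l => //= p l ->. Qed.

Lemma chain_nth rel u v l k : chain rel u v l -> (k < size l)%N ->
  rel (flat l)`_(k.*2) (flat l)`_(k.*2.+1).
Proof. by elim: l u k => [|p l IH] u [|k] //= [_ _ h /IH]; [|exact]. Qed.

Lemma flat_subdivision rel l : chain rel 0 1 l -> subdivision (0 :: flat l).
Proof.
move=> /chain_flat[h1 h2]; split => // z; rewrite in_cons => /orP[/eqP ->|/h2 //].
by rewrite in_itv /= lexx ler01.
Qed.

Lemma path_steps u v x s : u <= x -> x <= v -> path <=%R x s -> {subset s <= `[u, v]} ->
  chain anyrel x v (steps x s).
Proof.
move=> ux xv; elim: s x ux xv => //= y s IH x ux xv /andP[xy p] sub.
have /andP[uy yv] : u <= y <= v by have := sub y (mem_head _ _); rewrite in_itv.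
by split => //; apply: IH => // z zs; apply: sub; rewrite in_cons zs orbT.
Qed.

Lemma path_pairs rel u v x s : u <= x -> x <= v -> path <=%R x s -> {subset s <= `[u, v]} ->
  (forall k, (k < (size s)./2)%N -> rel s`_(k.*2) s`_(k.*2.+1)) ->
  chain rel x v (pairs s).
Proof.
elim/seq_ind2: s x => [|a|a b s IH] x //= ux xv /and3P[xa ab p] sub hr.
have /andP[ub bv] : u <= b <= v.
  by have := sub b; rewrite !in_cons eqxx orbT in_itv; apply.
split => //; first exact: (hr 0%N).
apply: IH => //; first by move=> z zs; apply: sub; rewrite !in_cons zs !orbT.
by move=> k ks; exact: (hr k.+1).
Qed.

Lemma ereal_sup_bound (I : Type) (A : set I) (F : I -> R) : A !=set0 ->
  (ereal_sup [set (F i)%:E | i in A] < +oo)%E -> exists M, forall i, A i -> F i <= M.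
Proof.
move=> [a Aa] hs; have fs : (ereal_sup [set (F i)%:E | i in A]) \is a fin_num.
  rewrite fin_numE; apply/andP; split; last by rewrite lt_eqF.
  by rewrite gt_eqF // (lt_le_trans (ltNyr (F a))) //; apply: ereal_sup_ubound; exists a.
exists (fine (ereal_sup [set (F i)%:E | i in A])) => i Ai; rewrite -lee_fin fineK //.
by apply: ereal_sup_ubound; exists i.
Qed.

Lemma ereal_sup_finite (I : Type) (A : set I) (F : I -> R) M : (forall i, A i -> F i <= M) ->
  (ereal_sup [set (F i)%:E | i in A] < +oo)%E.
Proof.
move=> h; apply: (@le_lt_trans _ _ M%:E); last exact: ltry.
by apply: ge_ereal_sup => _ [x Ax <-]; rewrite lee_fin h.
Qed.

Lemma bound_vle P rel d M : 1 <= P -> (forall l, chain rel 0 1 l -> vsum P d l <= M) ->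
  exists K, vle P rel d 0 1 K.
Proof.
move=> P1 h; have P0 : 0 < P by exact: lt_le_trans P1.
exists (Num.max M 0 `^ P^-1); split; first exact: powR_ge0.
move=> l /h/le_trans; apply; rewrite -powRrM mulVf ?gt_eqF // powRr1 ?le_max ?lexx //.
by rewrite orbT.
Qed.

Lemma pvariation_vle (V : normedModType R) p (f : R -> V) : 1 <= p ->
  (pvariation p f < +oo)%E -> exists K, vle p anyrel (fun s t : R => `|f t - f s|) 0 1 K.
Proof.
move=> p1 /ereal_sup_bound[|M hM]; first by exists [::].
apply: (@bound_vle _ _ _ M) => // l hl.
have := hM _ (flat_subdivision hl); rewrite /pvar_sum /= (sum_steps (fun a b => `|f b - f a| `^ p)); apply: le_trans.
rewrite /vsum (eq_bigr (fun q => `|f q.2 - f q.1| `^ p)); last by move=> q _; rewrite normr_id.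
by apply: (sum_flat_le (F := fun a b => `|f b - f a| `^ p)) => a b; exact: powR_ge0.
Qed.

Lemma vle_pvariation p (f : R -> R) K : vle p anyrel (incr f) 0 1 K -> (pvariation p f < +oo)%E.
Proof.
move=> [K0 h]; apply: (@ereal_sup_finite _ _ _ (K `^ p)) => s [ss sub].
case: s ss sub => [|x s] ss sub; first by rewrite /pvar_sum big_ord0 powR_ge0.
rewrite /pvar_sum /= (sum_steps (fun a b => `|f b - f a| `^ p)).
have /andP[x0 x1] : 0 <= x <= 1 by have := sub x (mem_head _ _); rewrite in_itv.
apply: h; apply: (chain_widen x0 (lexx 1)); apply: (path_steps x0 x1 ss).
by move=> z zs; apply: sub; rewrite in_cons zs orbT.
Qed.

Definition lev (omega : R -> R) : R -> R -> Prop := fun s t : R => omega s = omega t.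

Lemma cond_variation_vle q (rho omega : R -> R) : 1 <= q ->
  (cond_variation q rho omega < +oo)%E -> exists K, vle q (lev omega) (incr rho) 0 1 K.
Proof.
move=> q1 /ereal_sup_bound[|M hM]; first by exists [::].
(* The time 0 in front takes the index 0, so that the pairs (t_(2k+1), t_(2k+2)) are the intervals
   of [l]. *)
have E l : cond_pvar_sum q rho (0 :: flat l) = vsum q (incr rho) l.
  by rewrite /cond_pvar_sum /= (sum_pairs (fun a b => `|rho b - rho a| `^ q)) pairs_flat.
apply: (@bound_vle _ _ _ M) => // l hl; rewrite -E; apply: hM.
split; first exact: flat_subdivision hl.
by move=> k /=; rewrite size_flat doubleK; exact: chain_nth hl.
Qed.

Lemma vle_cond_variation q (rho omega : R -> R) K : vle q (lev omega) (incr rho) 0 1 K ->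
  (cond_variation q rho omega < +oo)%E.
Proof.
move=> [K0 h]; apply: (@ereal_sup_finite _ _ _ (K `^ q)) => s [[ss sub] hl].
case: s ss sub hl => [|x s] ss sub hl; first by rewrite /cond_pvar_sum big_ord0 powR_ge0.
rewrite /cond_pvar_sum /= (sum_pairs (fun a b => `|rho b - rho a| `^ q)).
have /andP[x0 x1] : 0 <= x <= 1 by have := sub x (mem_head _ _); rewrite in_itv.
apply: h; apply: (chain_widen x0 (lexx 1)); apply: (path_pairs x0 x1 ss) => //.
by move=> z zs; apply: sub; rewrite in_cons zs orbT.
Qed.

(* K bounds each of the three terms of the norm of the space B, on [u, v] *)
Definition norm_le p q (omega rho : R -> R) u v K : Prop :=
  [/\ vle p anyrel (incr rho) u v K, vle q (lev omega) (incr rho) u v K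
    & forall t, u <= t -> t <= v -> `|rho t| <= K].

Lemma spaceBP p q (omega rho : R -> R) : 1 <= p -> 1 <= q ->
  spaceB p q omega rho <-> exists K, norm_le p q omega rho 0 1 K.
Proof.
move=> p1 q1; have p0 : 0 < p by exact: lt_le_trans p1.
have q0 : 0 < q by exact: lt_le_trans q1.
rewrite /spaceB /= /normB.
have fin (x : \bar R) r : 0 < r -> (x `^ r < +oo)%E -> (x < +oo)%E.
  move=> r0 h; rewrite ltey; apply/eqP => e; move: h; rewrite (eqy_poweR r0 e).
  by rewrite ltxx.
split.
  move=> h.
  have s0 : (0 <= ereal_sup [set `|rho t|%:E | t in `[0%R, 1%R]%classic])%E.
    apply: (@le_trans _ _ (`|rho 0|)%:E); first by rewrite lee_fin.
    by apply: ereal_sup_ubound; exists 0 => //=; rewrite in_itv /= lexx ler01.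
  have hp : (pvariation p rho `^ p^-1 < +oo)%E.
    by apply: le_lt_trans h; rewrite -addeA leeDl // adde_ge0 ?poweR_ge0.
  have hq : (cond_variation q rho omega `^ q^-1 < +oo)%E.
    apply: le_lt_trans h; rewrite addeAC addeC; rewrite leeDl // adde_ge0 ?poweR_ge0 //.
  have hs : (ereal_sup [set `|rho t|%:E | t in `[0%R, 1%R]%classic] < +oo)%E.
    by apply: le_lt_trans h; rewrite addeC leeDl // adde_ge0 ?poweR_ge0.
  have [K1 h1] := pvariation_vle p1 (fin _ _ (etrans (invr_gt0 _) p0) hp).
  have [K2 h2] := cond_variation_vle q1 (fin _ _ (etrans (invr_gt0 _) q0) hq).
  have [K3 h3] : exists M, forall t, t \in `[0, 1] -> `|rho t| <= M.
    have [|M hM] := ereal_sup_bound _ hs; last by exists M.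
    by exists 0 => /=; rewrite in_itv /= lexx ler01.
  exists (Num.max K1 (Num.max K2 K3)); split.
  - apply: (@vle_le _ _ _ _ _ _ K1 _ (ltW p0)); first by rewrite le_max lexx.
    rewrite -[K1]mul1r; apply: (vle_scale p1 ler01 _ h1) => s t *.
    by rewrite mul1r normr_id.
  - by apply: vle_le h2; [exact: ltW|rewrite !le_max lexx orbT].
  - move=> t t0 t1; rewrite !le_max h3 ?orbT // in_itv /= t0 t1.
    by [].
move=> [K [h1 h2 h3]].
rewrite lte_add_pinfty // ?lte_add_pinfty ?poweR_lty //.
- exact: vle_pvariation h1.
- exact: vle_cond_variation h2.
- by apply: (@ereal_sup_finite _ _ _ K) => t /=; rewrite in_itv /= => /andP[]; exact: h3.
Qed.

End VariationBridge.

(** * Integration as an operator of finite variation *)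

Arguments scale_ratio {R} P Q.

Section TreeIntegral.
Context {R : realType}.
Variable theta : cpath R R.
Implicit Types (g rho : R -> R) (s t u v K P Q : R).

Definition tint rho s t : R := tree_integral theta (cutoff rho s t).

Lemma jumpD g1 g2 tau : jump theta (g1 \+ g2) tau = jump theta g1 tau + jump theta g2 tau.
Proof. by rewrite /jump; case: ifP => _; case: ifP => _ /=; lra. Qed.

Lemma jumpB g1 g2 tau : jump theta (g1 \- g2) tau = jump theta g1 tau - jump theta g2 tau.
Proof. by rewrite /jump; case: ifP => _; case: ifP => _ /=; lra. Qed.

Lemma tree_integralD g1 g2 : tree_integrable theta g1 -> tree_integrable theta g2 ->
  tree_integrable theta (g1 \+ g2) /\
  tree_integral theta (g1 \+ g2) = tree_integral theta g1 + tree_integral theta g2.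
Proof.
move=> [h i1] [_ i2]; have E : jump theta (g1 \+ g2) = jump theta g1 \+ jump theta g2.
  by apply/funext => tau; rewrite jumpD.
rewrite /tree_integrable /tree_integral E; split; last by rewrite RintegralD.
by split => //; rewrite (_ : EFin \o _ = (EFin \o jump theta g1) \+ (EFin \o jump theta g2))%E //; exact: integrableD.
Qed.

Lemma tree_integralB g1 g2 : tree_integrable theta g1 -> tree_integrable theta g2 ->
  tree_integral theta (g1 \- g2) = tree_integral theta g1 - tree_integral theta g2.
Proof.
move=> [h i1] [_ i2]; have E : jump theta (g1 \- g2) = jump theta g1 \- jump theta g2.
  by apply/funext => tau; rewrite jumpB.
by rewrite /tree_integral E RintegralB.
Qed.

Lemma eq_cutoff rho rho' s t : (forall r, s < r -> r <= t -> rho r = rho' r) -> cutoff rho s t = cutoff rho' s t.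
Proof.
by move=> h; apply/funext => r; rewrite !cutoffE; case: ifP => // /andP[r1 r2]; exact: h.
Qed.

Lemma cutoff_split rho s u t : s <= u -> u <= t -> cutoff rho s t = cutoff rho s u \+ cutoff rho u t.
Proof.
move=> su ut; apply/funext => r; rewrite /= !cutoffE.
have [ru|ur] := leP r u.
  by rewrite (le_trans ru ut) !andbT /= addr0.
by rewrite (le_lt_trans su ur) andbF add0r.
Qed.

Lemma cutoffB rho rho' s t : cutoff (rho \- rho') s t = cutoff rho s t \- cutoff rho' s t.
Proof. by apply/funext => r; rewrite /cutoff /= mulrBl. Qed.

(** The 4 comes from the arc [pi s, pi t], the fraction from the geometric series over the
    scales. *)
Definition tcst P Q : R := 4 + 8 / (1 - scale_ratio P Q).

Lemma tcst_ge0 P Q : 1 <= P -> 1 <= Q -> 1 < P^-1 + Q^-1 -> 0 <= tcst P Q.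
Proof.
move=> P1 Q1 hPQ; have /andP[_ h] := scale_ratio_itv P1 hPQ.
by rewrite /tcst addr_ge0 // divr_ge0 // subr_ge0 ltW.
Qed.

(** The estimates of the jumps require positive [c0] and [w0]. They are applied to the roots of the
    controls increased by [e], and here [e] tends to 0. *)
Lemma le_prod_perturb (X C x y : R) : 0 <= C -> 0 <= x -> 0 <= y ->
  (forall e, 0 < e -> X <= C * (x + e) * (y + e)) -> X <= C * x * y.
Proof.
move=> C0 x0 y0 h; apply/ler_addgt0Pr => e e0.
pose D := C * (x + y + 1) + 1; have D0 : 0 < D by rewrite /D ltr_wpDl // !mulr_ge0 // !addr_ge0.
pose f := Num.min 1 (e / D); have f0 : 0 < f by rewrite lt_min ltr01 divr_gt0.
apply: (le_trans (h f f0)).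
have f1 : f <= 1 by rewrite ge_min lexx.
have f2 : f * D <= e by rewrite -ler_pdivlMr // ge_min lexx orbT.
have ff : C * f * f <= C * f by rewrite ler_piMr // mulr_ge0 // ltW.
have -> : C * (x + f) * (y + f) = C * x * y + (f * (C * (x + y)) + C * f * f) by ring.
rewrite lerD2l; apply: le_trans f2; rewrite /D.
have -> : f * (C * (x + y + 1) + 1) = f * (C * (x + y)) + C * f + f by ring.
lra.
Qed.

Lemma powR_invK (x P : R) : 0 < P -> 0 <= x -> (x `^ P^-1) `^ P = x.
Proof. by move=> P0 x0; rewrite -powRrM mulVf ?gt_eqF // powRr1. Qed.

Lemma powR_Kinv (x P : R) : 0 < P -> 0 <= x -> (x `^ P) `^ P^-1 = x.
Proof. by move=> P0 x0; rewrite -powRrM divff ?gt_eqF // powRr1. Qed.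

Section Bounds.
Variables (P Q s t : R) (rho : R -> R) (c w : R -> R -> R) (K : R).
Hypotheses (P1 : 1 <= P) (Q1 : 1 <= Q) (hPQ : 1 < P^-1 + Q^-1).
Hypotheses (s0 : 0 <= s) (st : s <= t) (t1 : t <= 1).
Hypotheses (hc : control s t c) (hw : control s t w).
Hypothesis hcP : forall a b : R, s <= a -> a <= b -> b <= t -> `|theta b - theta a| `^ P <= c a b.
Hypothesis hwQ : forall a b : R, s <= a -> a <= b -> b <= t -> theta a = theta b ->
  `|rho b - rho a| `^ Q <= w a b.
Hypothesis mg : measurable_fun [set: measurableTypeR R] (cutoff rho s t).
Hypothesis hK : forall r, s <= r -> r <= t -> `|rho r| <= K.

Let P0 : 0 < P. Proof. exact: lt_le_trans P1. Qed.
Let Q0 : 0 < Q. Proof. exact: lt_le_trans Q1. Qed.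
Let hlam := length_measure_is_length theta.
Let K0 : 0 <= K. Proof. exact: le_trans (hK (lexx s) st). Qed.
Let c0 : 0 <= c s t. Proof. exact: hc.1. Qed.
Let w0 : 0 <= w s t. Proof. exact: hw.1. Qed.

Let perturb (x p e : R) : 0 < p -> 0 <= x -> 0 < e -> 0 < x `^ p^-1 + e /\ x <= (x `^ p^-1 + e) `^ p.
Proof.
move=> p0 x0 e0; have h := powR_ge0 x p^-1; split; first lra.
rewrite -{1}(powR_invK p0 x0); apply: ge0_ler_powR; rewrite ?nnegrE ?powR_ge0 ?(ltW p0) //; lra.
Qed.

Lemma tint_integrable : tree_integrable theta (cutoff rho s t).
Proof.
have [a1 a2] := perturb P0 c0 ltr01; have [b1 b2] := perturb Q0 w0 ltr01.
split => //.
exact: (jump_integrable hlam P1 Q1 hPQ s0 st t1 hc hw hcP hwQ a1 b1 a2 b2 mg hK).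
Qed.

Lemma norm_tint_le : `|tint rho s t| <= tcst P Q * c s t `^ P^-1 * (K + w s t `^ Q^-1).
Proof.
have C0 := tcst_ge0 P1 Q1 hPQ.
apply: le_prod_perturb => //; rewrite ?addr_ge0 ?powR_ge0 // => e e0.
have [a1 a2] := perturb P0 c0 e0; have [b1 b2] := perturb Q0 w0 e0.
have := norm_jump_integral_le hlam P1 Q1 hPQ s0 st t1 hc hw hcP hwQ a1 b1 a2 b2 mg hK.
move=> /le_trans; apply; rewrite /tcst -[K + _ + _]addrA.
set x := _ + e; set y := _ + e; have /andP[_ r1] := scale_ratio_itv P1 hPQ.
have z0 : 0 <= 8 / (1 - scale_ratio P Q) by rewrite divr_ge0 // subr_ge0 ltW.
have -> : 8 * x * y / (1 - scale_ratio P Q) = 8 / (1 - scale_ratio P Q) * (x * y) by ring.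
set z := 8 / _ in z0 *.
have x0 : 0 <= x := ltW a1; have y0 : 0 <= y := ltW b1.
have p1 : 0 <= x * y by rewrite mulr_ge0.
have p2 : 0 <= z * (x * K) by apply: mulr_ge0 => //; exact: mulr_ge0.
have -> : (4 + z) * x * (K + y) = 4 * K * x + z * (x * y) + (4 * (x * y) + z * (x * K)) by ring.
by rewrite lerDl addr_ge0 // mulr_ge0.
Qed.

Lemma norm_tint_loop_le : theta s = theta t ->
  `|tint rho s t| <= tcst P Q * c s t `^ P^-1 * w s t `^ Q^-1.
Proof.
move=> thst; have C0 := tcst_ge0 P1 Q1 hPQ.
apply: le_prod_perturb => //; rewrite ?powR_ge0 // => e e0.
have [a1 a2] := perturb P0 c0 e0; have [b1 b2] := perturb Q0 w0 e0.
have := norm_loop_integral_le hlam P1 Q1 hPQ s0 st t1 hc hw hcP hwQ a1 b1 a2 b2 mg hK thst.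
move=> /le_trans; apply; rewrite /tcst.
set x := _ + e; set y := _ + e.
have -> : 8 * x * y / (1 - scale_ratio P Q) = 8 / (1 - scale_ratio P Q) * (x * y) by ring.
have p1 : 0 <= x * y by rewrite mulr_ge0 // ltW.
set z := 8 / _; have -> : (4 + z) * x * y = 4 * (x * y) + z * (x * y) by ring.
by rewrite lerD2r ler_peMl // ler1n.
Qed.

End Bounds.

End TreeIntegral.

(** The variation [phi] of [rho] from [u] is monotone, hence measurable, and the power p of an
    increment of [rho] is at most that of [phi]. So [rho] is a continuous function of [phi], and the
    set where it exceeds [a] is the preimage under [phi] of the open set [G]. *)
Lemma vle_measurable_cutoff {R : realType} (p : R) (rho : R -> R) (u v K s t : R) : 1 <= p ->
  vle p anyrel (incr rho) u v K -> u <= s -> s <= t -> t <= v ->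
  measurable_fun [set: measurableTypeR R] (cutoff rho s t).
Proof.
move=> p1 hv us st tv; have p0 : 0 < p by exact: lt_le_trans p1.
have uv := le_trans us (le_trans st tv).
pose c := vsup p anyrel (incr rho).
have hc : control u v c := vsup_control hv.
pose phi (x : measurableTypeR R) : measurableTypeR R := c u (clamp u v x).
have phi_nd : {homo phi : x y / x <= y}.
  move=> x y xy; rewrite /phi.
  have /andP[x1 x2] := clamp_itv x uv; have /andP[y1 y2] := clamp_itv y uv.
  apply: (control_mono hc) => //.
  by rewrite /clamp le_max2 // le_min2.
have mphi : measurable_fun [set: measurableTypeR R] phi.
  apply: (measurability _ (RGenOInfty.measurableE R)) => //.
  move=> _ [_ [a ->] <-]; rewrite setTI; apply: is_interval_measurable => x y /=.
  rewrite !in_itv /= !andbT => ax ay z /andP[xz _]; rewrite in_itv /= andbT.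
  exact: lt_le_trans (phi_nd _ _ xz).
apply: (measurability _ (RGenOInfty.measurableE R)) => //.
move=> _ [_ [a ->] <-]; rewrite setTI.
pose G := \bigcup_(z in [set z | u <= z <= v /\ a < rho z]) ball (c u z) ((rho z - a) `^ p).
have mG : measurable (G : set (measurableTypeR R)).
  apply: open_measurable; apply: bigcup_open => z [_ az]; apply: ball_open.
have -> : cutoff rho s t @^-1` `]a, +oo[%classic =
    (`]s, t] `&` phi @^-1` G) `|` (if a < 0 then ~` `]s, t]%classic else set0).
  apply/seteqP; split => x /=; rewrite in_itv /= ?andbT cutoffE.
    case: ifP => [/andP[x1 x2] ax|nx ax]; last first.
      by right; rewrite ax /= in_itv /= nx.
    left; split; first by rewrite in_itv /= x1.
    have xuv : u <= x <= v by rewrite (le_trans us (ltW x1)) (le_trans x2 tv).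
    exists x => //; rewrite /phi clamp_id //; apply: ballxx.
    by rewrite powR_gt0 // subr_gt0.
  move=> [[/= + [z [/andP[z1 z2] az]]]|]; last first.
    by case: ifP => // a0 /= /negP; rewrite !in_itv /= andbT => /negbTE ->.
  move=> /andP[x1 x2]; rewrite in_itv /= andbT x1 x2 /=.
  have xu : u <= x := le_trans us (ltW x1); have xv : x <= v := le_trans x2 tv.
  rewrite /phi clamp_id ?xu // /ball /= => hb.
  have key : `|rho x - rho z| `^ p <= `|c u z - c u x|.
    have [xz|/ltW zx] := leP x z.
      have h1 := hc.2 u x z (lexx u) xu xz z2.
      have h2 := vsup_incr hv xu xz z2 I.
      by rewrite distrC; apply: (le_trans h2); apply: le_trans (ler_norm _); rewrite -/c; lra.
    have h1 := hc.2 u z x (lexx u) z1 zx xv.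
    have h2 := vsup_incr hv z1 zx xv I.
    by apply: (le_trans h2); rewrite distrC; apply: le_trans (ler_norm _); rewrite -/c; lra.
  have lt : `|rho x - rho z| < rho z - a.
    rewrite ltNge; apply/negP => le; have := le_lt_trans key hb; rewrite ltNge => /negP; apply.
    by apply: ge0_ler_powR; rewrite ?nnegrE ?subr_ge0 ?(ltW p0) ?(ltW az).
  by move: lt; rewrite ltr_norml => /andP[]; lra.
apply: measurableU.
  apply: measurableI; first exact: measurable_itv.
  by rewrite -[X in measurable X]setTI; exact: mphi.
by case: ifP => _ //; apply: measurableC; exact: measurable_itv.
Qed.

(** * Variations of the indefinite integral *)

Section TintVariation.
Context {R : realType}.
Variables (theta : cpath R R) (P Q u v : R) (rho : R -> R) (kappa K p' K' : R).
Hypotheses (P1 : 1 <= P) (Q1 : 1 <= Q) (hPQ : 1 < P^-1 + Q^-1).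
Hypotheses (u0 : 0 <= u) (uv : u <= v) (v1 : v <= 1).
Hypothesis hth : vle P anyrel (incr theta) u v kappa.
Hypothesis hrho : vle Q (lev theta) (incr rho) u v K.
Hypothesis hsup : forall t, u <= t -> t <= v -> `|rho t| <= K.
(** The variation of [rho] between arbitrary times provides the measurability of its cutoffs. *)
Hypotheses (p'1 : 1 <= p') (hreg : vle p' anyrel (incr rho) u v K').

Let c := vsup P anyrel (incr theta).
Let w := vsup Q (lev theta) (incr rho).
Let P0 : 0 < P. Proof. exact: lt_le_trans P1. Qed.
Let Q0 : 0 < Q. Proof. exact: lt_le_trans Q1. Qed.
Let hc : control u v c := vsup_control hth.
Let hw : control u v w := vsup_control hrho.

Lemma tint_ok s t : u <= s -> s <= t -> t <= v -> tree_integrable theta (cutoff rho s t).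
Proof.
move=> us st tv; apply: (@tint_integrable _ theta P Q s t rho c w K) => //.
- exact: le_trans us.
- exact: le_trans v1.
- exact: control_sub hc us tv.
- exact: control_sub hw us tv.
- by move=> a b sa ab bt; apply: (vsup_incr hth) => //; [exact: le_trans sa|exact: le_trans tv].
- by move=> a b sa ab bt e; apply: (vsup_incr hrho) => //; [exact: le_trans sa|exact: le_trans tv].
- exact: vle_measurable_cutoff p'1 hreg us st tv.
- by move=> r sr rt; apply: hsup; [exact: le_trans sr|exact: le_trans tv].
Qed.

Lemma tint_incr s t : u <= s -> s <= t -> t <= v ->
  incr (tint theta rho u) s t = tint theta rho s t.
Proof.
move=> us st tv; rewrite /incr /tint (cutoff_split rho us st).
by rewrite (tree_integralD (tint_ok (lexx u) us (le_trans st tv)) (tint_ok us st tv)).2; lra.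
Qed.

Let C := tcst P Q.
Let C0 : 0 <= C. Proof. exact: tcst_ge0. Qed.
Let K0 : 0 <= K. Proof. by have [] := hrho. Qed.
Let kappa0 : 0 <= kappa. Proof. by have [] := hth. Qed.

Let root_le (x y p : R) : 0 < p -> 0 <= x -> 0 <= y -> x <= y `^ p -> x `^ p^-1 <= y.
Proof.
move=> p0 x0 y0 h; rewrite -[leRHS](powR_Kinv p0 y0).
by apply: ge0_ler_powR; rewrite ?nnegrE ?powR_ge0 // invr_ge0 ltW.
Qed.

(** [w] is bounded by K^Q, and [c] remains as the control of the P-variation of the integral. *)
Let bound1 s t : u <= s -> s <= t -> t <= v -> `|tint theta rho s t| <= 2 * C * K * c s t `^ P^-1.
Proof.
move=> us st tv.
have := @norm_tint_le _ theta P Q s t rho c w K P1 Q1 hPQ (le_trans u0 us) st (le_trans tv v1)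
  (control_sub hc us tv) (control_sub hw us tv).
move=> /(_ (fun a b sa ab bt => vsup_incr hth (le_trans us sa) ab (le_trans bt tv) I)).
move=> /(_ (fun a b sa ab bt e => vsup_incr hrho (le_trans us sa) ab (le_trans bt tv) e)).
move=> /(_ (vle_measurable_cutoff p'1 hreg us st tv)).
move=> /(_ (fun r sr rt => hsup (le_trans us sr) (le_trans rt tv)))/le_trans; apply.
have wK : w s t `^ Q^-1 <= K.
  apply: root_le => //; first exact: hw.1.
  exact: (vsup_le hrho).
rewrite -/C; have h := ler_wpM2l (mulr_ge0 C0 (powR_ge0 (c s t) P^-1)) (lerD (lexx K) wK).
by apply: (le_trans h); rewrite le_eqVlt; apply/orP; left; apply/eqP; ring.
Qed.

(** The roles are exchanged: [c] is bounded by kappa^P, and [w] remains as the control of the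
    Q-variation at equal levels. An additional term in sup |rho| would destroy the power w^(1/Q). *)
Let bound2 s t : u <= s -> s <= t -> t <= v -> theta s = theta t ->
  `|tint theta rho s t| <= C * kappa * w s t `^ Q^-1.
Proof.
move=> us st tv e.
have := @norm_tint_loop_le _ theta P Q s t rho c w K P1 Q1 hPQ (le_trans u0 us) st (le_trans tv v1)
  (control_sub hc us tv) (control_sub hw us tv).
move=> /(_ (fun a b sa ab bt => vsup_incr hth (le_trans us sa) ab (le_trans bt tv) I)).
move=> /(_ (fun a b sa ab bt e => vsup_incr hrho (le_trans us sa) ab (le_trans bt tv) e)).
move=> /(_ (vle_measurable_cutoff p'1 hreg us st tv)).
move=> /(_ (fun r sr rt => hsup (le_trans us sr) (le_trans rt tv)) e)/le_trans; apply.
apply: ler_wpM2r; first exact: powR_ge0.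
apply: ler_wpM2l => //; apply: root_le => //; first exact: hc.1.
exact: (vsup_le hth).
Qed.

Let vle_of_root_bound r rel (c' : R -> R -> R) (I : R -> R) (B k : R) : 0 < r -> 0 <= B -> 0 <= k ->
  control u v c' -> c' u v <= k `^ r ->
  (forall s t, u <= s -> s <= t -> t <= v -> rel s t -> `|incr I s t| <= B * c' s t `^ r^-1) ->
  vle r rel (incr I) u v (B * k).
Proof.
move=> r0 B0 k0 hc' ck hI.
apply: (@control_vle _ _ _ _ _ _ (fun s t => B `^ r * c' s t)) => //; last 3 first.
- exact: mulr_ge0.
- by rewrite [leRHS]powRM // ler_wpM2l // powR_ge0.
- move=> s t us st tv rst; rewrite -(powR_invK r0 (hc'.1 s t us st tv)) -powRM ?powR_ge0 //.
  by apply: ge0_ler_powR; rewrite ?nnegrE ?mulr_ge0 ?powR_ge0 ?(ltW r0) // hI.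
- have [h1 h2] := hc'; split=> [s t us st tv|s t x us st tx xv].
    by rewrite mulr_ge0 ?powR_ge0 // h1.
  by rewrite -mulrDr ler_wpM2l ?powR_ge0 // h2.
Qed.

Lemma tint_vle : vle P anyrel (incr (tint theta rho u)) u v (2 * C * K * kappa).
Proof.
apply: (@vle_of_root_bound _ _ c) => //; first by rewrite !mulr_ge0.
  exact: (vsup_le hth).
by move=> s t us st tv _; rewrite tint_incr //; exact: bound1.
Qed.

Lemma tint_cond_vle : vle Q (lev theta) (incr (tint theta rho u)) u v (C * kappa * K).
Proof.
apply: (@vle_of_root_bound _ _ w) => //; first exact: mulr_ge0.
  exact: (vsup_le hrho).
by move=> s t us st tv e; rewrite tint_incr //; exact: bound2.
Qed.

End TintVariation.

(** * Composition with a map of class C^2 *)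

Section TaylorBounds.
Context {R : realType}.
Implicit Types (V : normedModType R).

Lemma line_is_derive V (g : V -> R) (b v : V) (r : R) : differentiable g (b + r *: v) ->
  is_derive r (1 : R) (fun r : R => g (b + r *: v)) ('d g (b + r *: v) v).
Proof.
move=> dg; have hl : is_diff r (fun r : R => b + r *: v) (fun h : R => 0 + h *: v).
  exact: (is_diffD (is_diff_cst b r) (is_diff_scalel r v)).
have hg : is_diff (b + r *: v) g ('d g (b + r *: v)) by exact: differentiableP.
have hc : is_diff r (g \o (fun r : R => b + r *: v)) ('d g (b + r *: v) \o (fun h : R => 0 + h *: v)).
  exact: is_diff_comp.
apply: DeriveDef; first by apply: diff_derivable; case: hc.
by rewrite deriveE ?diff_val /= ?scale1r ?add0r //; by case: hc.
Qed.

Lemma line_continuous V (g : V -> R) (b v : V) : (forall x, differentiable g x) ->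
  continuous (fun r : R => g (b + r *: v)).
Proof.
move=> dg r; apply: differentiable_continuous; apply/derivable1_diffP.
by have [] := line_is_derive (dg (b + r *: v)).
Qed.

Lemma lipschitz_of_diff V (g : V -> R) (C : R) : (forall x, differentiable g x) ->
  (forall x v, `|'d g x v| <= C * `|v|) -> forall a b, `|g a - g b| <= C * `|a - b|.
Proof.
move=> dg hC a b; pose phi r := g (b + r *: (a - b)).
have cphi : {within `[0, 1], continuous phi}.
  by apply: continuous_subspaceT; exact: line_continuous.
have [c _] := @MVT_segment R phi _ 0 1 ler01 (fun r _ => line_is_derive (dg (b + r *: (a - b)))) cphi.
by rewrite /phi scale1r scale0r addr0 subrKC subr0 mulr1 => ->.
Qed.

(** The mean value theorem is applied to the difference of the values of [g] along the segments
    [b, a] and [b', a'] run simultaneously. Such differences of increments are what the variation of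
    f(x) - f(y) consists of. *)
Lemma second_difference_le V (g : V -> R) (C1 C2 S : R) : (forall x, differentiable g x) ->
  (forall x v, `|'d g x v| <= C1 * `|v|) ->
  (forall x y v, `|'d g x v - 'd g y v| <= C2 * `|x - y| * `|v|) -> 0 <= C2 ->
  forall a b a' b', `|a - a'| <= S -> `|b - b'| <= S ->
  `|g a - g b - (g a' - g b')| <= C1 * `|a - b - (a' - b')| + C2 * S * `|a' - b'|.
Proof.
move=> dg h1 h2 C20 a b a' b' aS bS.
pose y r := b + r *: (a - b); pose y' r := b' + r *: (a' - b').
pose phi r := g (y r) - g (y' r).
have cphi : {within `[0, 1], continuous phi}.
  apply: continuous_subspaceT => r; apply: (@cvgB _ R^o).
    exact: line_continuous.
  exact: line_continuous.
have dphi (r : R) : is_derive r (1 : R) phi ('d g (y r) (a - b) - 'd g (y' r) (a' - b')).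
  by apply: is_deriveB; exact: line_is_derive.
have [c c01] := @MVT_segment R phi _ 0 1 ler01 (fun r _ => dphi r) cphi.
rewrite /phi /y /y' !scale1r !scale0r !addr0 !subrKC subr0 mulr1 -/(y c) -/(y' c).
have -> : g a - g b - (g a' - g b') = g a - g a' - (g b - g b') by lra.
move=> ->.
have -> : 'd g (y c) (a - b) - 'd g (y' c) (a' - b') =
    'd g (y c) (a - b - (a' - b')) + ('d g (y c) (a' - b') - 'd g (y' c) (a' - b')).
  by rewrite (linearB ('d g (y c)) (a - b)) addrA subrK.
apply: (le_trans (ler_normD _ _)); apply: lerD; first exact: h1.
apply: (le_trans (h2 _ _ _)); apply: ler_wpM2r => //; apply: ler_wpM2l => //.
move: c01; rewrite in_itv /= => /andP[c0 c1].
have cvx (z1 z2 : V) : z1 + c *: (z2 - z1) = (1 - c) *: z1 + c *: z2.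
  by rewrite scalerBr scalerBl scale1r -[RHS]addrA [- _ + _]addrC.
have -> : y c - y' c = (1 - c) *: (b - b') + c *: (a - a').
  by rewrite /y /y' !cvx opprD addrACA -!scalerBr.
apply: (le_trans (ler_normD _ _)); rewrite !normrZ (ger0_norm c0) ger0_norm ?subr_ge0 //.
have := ler_wpM2l c0 aS; have := ler_wpM2l (etrans (subr_ge0 _ _) c1 : 0 <= 1 - c) bS.
lra.
Qed.

Lemma entry_le_norm m n (M : 'M[R]_(m, n)) i j : `|M i j| <= `|M|.
Proof.
rewrite [leRHS]/Num.Def.normr /= mx_normrE.
by apply: (@le_trans _ _ `|M (i, j).1 (i, j).2|) => //; exact: le_bigmax.
Qed.

Lemma mx_norm_le_sum n (v : 'cV[R]_n) : `|v| <= \sum_k `|v k ord0|.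
Proof.
rewrite [leLHS]/Num.Def.normr /= mx_normrE; apply/bigmax_leP; split.
  exact: sumr_ge0.
move=> [i j] _ /=; rewrite (ord1 j) (bigD1 i) //= lerDl; exact: sumr_ge0.
Qed.

Lemma mx_norm_le_entries n (v : 'cV[R]_n) S : 0 <= S -> (forall k, `|v k ord0| <= S) -> `|v| <= S.
Proof.
move=> S0 h; rewrite [leLHS]/Num.Def.normr /= mx_normrE; apply/bigmax_leP; split => //.
by move=> [i j] _ /=; rewrite (ord1 j).
Qed.

Lemma entry_diff V m n (F : V -> 'M[R]_(m, n)) x i j : differentiable F x ->
  differentiable (fun y => F y i j) x /\ forall v, 'd (fun y => F y i j) x v = ('d F x v) i j.
Proof.
move=> dF; have dFij : differentiable (fun y => F y i j) x.
  apply: (@differentiable_comp _ _ _ _ F (fun M : 'M[R]_(m, n) => M i j)) => //.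
  exact: differentiable_coord.
split => // v; rewrite -!deriveE // derive_mx ?mxE //.
exact: diff_derivable.
Qed.

(** What is kept of the C^2 hypothesis: the Lipschitz bound controls f(x) in B, and the four-point
    bound controls f(x) - f(y). Sums over coordinates match the subadditivity of the variations. *)
Definition entry_bounds n d (f : 'cV[R]_n -> 'M[R]_(n, d)) (L : R) : Prop := forall i j,
  (forall a b : 'cV[R]_n, `|f a i j - f b i j| <= L * \sum_k `|a k ord0 - b k ord0|) /\
  (forall (S : R) (a b a' b' : 'cV[R]_n), 0 <= S ->
    (forall k, `|a k ord0 - a' k ord0| <= S) -> (forall k, `|b k ord0 - b' k ord0| <= S) ->
    `|f a i j - f b i j - (f a' i j - f b' i j)| <=
      L * \sum_k `|a k ord0 - b k ord0 - (a' k ord0 - b' k ord0)|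
      + L * S * \sum_k `|a' k ord0 - b' k ord0|).

Lemma C2_entry_bounds n d (f : 'cV[R]_n -> 'M[R]_(n, d)) : C2_bounded_derivatives f ->
  exists2 L, 0 <= L & entry_bounds f L.
Proof.
move=> [d1 d2 _ [M1 h1] [M2 h2]].
pose L := Num.max 0 (Num.max M1 M2).
have L0 : 0 <= L by rewrite le_max lexx.
have L1 : M1 <= L by rewrite !le_max lexx orbT.
have L2 : M2 <= L by rewrite !le_max lexx !orbT.
exists L => // i j.
have dg x : differentiable (fun y => f y i j) x by have [] := entry_diff i j (d1 x).
have dgE x v : 'd (fun y => f y i j) x v = ('d f x v) i j by have [_ ->] := entry_diff i j (d1 x).
have b1 x v : `|'d (fun y => f y i j) x v| <= L * `|v|.
  by rewrite dgE (le_trans (entry_le_norm _ _ _)) // (le_trans (h1 x v)) // ler_wpM2r.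
have b2 x y v : `|'d (fun y => f y i j) x v - 'd (fun y => f y i j) y v| <= L * `|x - y| * `|v|.
  (* The derivative in the fixed direction [v] is Lipschitz by the bound on the second
     derivative. *)
  pose h := fun y => ('d f y v) i j.
  have dh z : differentiable h z by have [] := entry_diff i j (d2 v z).
  have bh z u : `|'d h z u| <= L * `|v| * `|u|.
    have [_ ->] := entry_diff i j (d2 v z).
    rewrite (le_trans (entry_le_norm _ _ _)) // (le_trans (h2 _ _ _)) // mulrAC.
    by rewrite -!mulrA ler_wpM2r // mulr_ge0.
  have -> : 'd (fun y => f y i j) x v - 'd (fun y => f y i j) y v = h x - h y.
    by congr (_ - _); exact: dgE.
  by rewrite mulrAC; exact: lipschitz_of_diff.
have sumE (a b : 'cV[R]_n) : \sum_k `|(a - b) k ord0| = \sum_k `|a k ord0 - b k ord0|.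
  by apply: eq_bigr => k _; rewrite !mxE.
split=> [a b|S a b a' b' S0 aS bS].
  apply: (le_trans (lipschitz_of_diff dg b1 a b)); rewrite ler_wpM2l // -sumE.
  exact: mx_norm_le_sum.
apply: (le_trans (@second_difference_le _ _ L L S dg b1 b2 L0 a b a' b' _ _)).
- by apply: mx_norm_le_entries => // k; rewrite !mxE.
- by apply: mx_norm_le_entries => // k; rewrite !mxE.
- apply: lerD; first (rewrite ler_wpM2l // (le_trans (mx_norm_le_sum _)) //).
    by rewrite le_eqVlt; apply/orP; left; apply/eqP; apply: eq_bigr => k _; rewrite !mxE.
  by rewrite ler_wpM2l ?mulr_ge0 // -sumE; exact: mx_norm_le_sum.
Qed.

End TaylorBounds.

(** * The space B on an interval *)

Lemma geometric_small {R : realType} (K e : R) : 0 < e ->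
  exists N, forall n, (N <= n)%N -> K / 2 ^+ n <= e.
Proof.
move=> e0; exists (Num.bound (`|K| / e)) => n Nn.
rewrite ler_pdivrMr ?exprn_gt0 // (le_trans (ler_norm K)) // mulrC -ler_pdivrMr //.
have h : 0 <= `|K| / e by rewrite divr_ge0 // ltW.
apply: (le_trans (ltW (archi_boundP h))); rewrite -natrX ler_nat.
by rewrite (leq_trans Nn) // ltnW // ltn_expl.
Qed.

Section NormLe.
Context {R : realType}.
Variables (p q : R) (omega : R -> R).
Hypotheses (p1 : 1 <= p) (q1 : 1 <= q).
Implicit Types (g h : R -> R) (u v w s t K A S : R).
Local Notation nle := (norm_le p q omega).

Let p0 : 0 <= p. Proof. exact: le_trans p1. Qed.
Let q0 : 0 <= q. Proof. exact: le_trans q1. Qed.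

Lemma norm_le_ge0 g u v K : nle g u v K -> 0 <= K.
Proof. by move=> [[]]. Qed.

Lemma norm_le_le g u v K K' : K <= K' -> nle g u v K -> nle g u v K'.
Proof.
move=> KK [h1 h2 h3]; split; [exact: vle_le h1|exact: vle_le h2|].
by move=> t ut tv; apply: le_trans KK; exact: h3.
Qed.

Lemma norm_le_sub g u v u' v' K : u <= u' -> v' <= v -> nle g u v K -> nle g u' v' K.
Proof.
move=> uu vv [h1 h2 h3]; split; [exact: vle_sub h1|exact: vle_sub h2|].
by move=> t ut tv; apply: h3; [exact: le_trans ut|exact: le_trans vv].
Qed.

(** Domination of increments transfers both variations at once. There are two families because, for
    f(x) - f(y), the increments of x - y and those of y come with different constants. *)
Lemma norm_le_dom n (h h' : 'I_n -> R -> R) g u v A A' K K' S : 0 <= A -> 0 <= A' ->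
  (forall k, nle (h k) u v K) -> (forall k, nle (h' k) u v K') ->
  (forall s t, u <= s -> s <= t -> t <= v ->
     `|incr g s t| <= A * (\sum_k `|incr (h k) s t|) + A' * \sum_k `|incr (h' k) s t|) ->
  (forall t, u <= t -> t <= v -> `|g t| <= S) ->
  A * (n%:R * K) + A' * (n%:R * K') <= S -> nle g u v S.
Proof.
move=> A0 A'0 hh hh' hg hS KS.
have sumK (x : R) : \sum_(k < n) x = n%:R * x by rewrite sumr_const card_ord mulr_natl.
have main P rel : 1 <= P -> (forall k, vle P rel (incr (h k)) u v K) ->
    (forall k, vle P rel (incr (h' k)) u v K') -> vle P rel (incr g) u v S.
  move=> P1 a b; apply: (vle_le (le_trans ler01 P1) KS).
  apply: (@vle_add _ P rel _ (fun s t => A * \sum_k `|incr (h k) s t|)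
     (fun s t => A' * \sum_k `|incr (h' k) s t|)) => //.
  - move=> s t us st tv _; apply: (le_trans (hg s t us st tv)).
    by apply: lerD; exact: ler_norm.
  - apply: (@vle_scale _ P rel _ (fun s t => \sum_k `|incr (h k) s t|)) => //.
      by move=> s t *; rewrite normrM (ger0_norm A0).
    rewrite -sumK; apply: (vle_sum P1 _ a) => s t *.
    by rewrite ger0_norm // sumr_ge0.
  - apply: (@vle_scale _ P rel _ (fun s t => \sum_k `|incr (h' k) s t|)) => //.
      by move=> s t *; rewrite normrM (ger0_norm A'0).
    rewrite -sumK; apply: (vle_sum P1 _ b) => s t *.
    by rewrite ger0_norm // sumr_ge0.
split => //.
- by apply: main => // k; [have [] := hh k|have [] := hh' k].
- by apply: main => // k; [have [] := hh k|have [] := hh' k].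
Qed.

Lemma norm_le_add g h f u v K K' : (forall t, u <= t -> t <= v -> `|f t| <= `|g t| + `|h t|) ->
  (forall s t, u <= s -> s <= t -> t <= v -> `|incr f s t| <= `|incr g s t| + `|incr h s t|) ->
  nle g u v K -> nle h u v K' -> nle f u v (K + K').
Proof.
move=> hs hi hg hh; apply: (@norm_le_dom 1 (fun=> g) (fun=> h) f u v 1 1 K K') => //.
- by move=> s t us st tv; rewrite !big_ord1 !mul1r; exact: hi.
- move=> t ut tv; apply: (le_trans (hs t ut tv)); have [_ _ a] := hg; have [_ _ b] := hh.
  by apply: lerD; [exact: a|exact: b].
- by rewrite !mul1r.
Qed.

Lemma norm_le_eq g h u v K : (forall t, u <= t -> t <= v -> g t = h t) ->
  nle h u v K -> nle g u v K.
Proof.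
move=> gh hh; apply: (@norm_le_dom 1 (fun=> h) (fun=> h) g u v 1 0 K K) => //.
- move=> s t us st tv; rewrite !big_ord1 mul1r mul0r addr0 /incr.
  by rewrite !gh // ?(le_trans us) // (le_trans st).
- by move=> t ut tv; rewrite gh //; have [_ _] := hh; exact.
- by rewrite mul0r addr0 !mul1r.
Qed.

Lemma norm_le_sum n (h : 'I_n -> R -> R) u v K : 0 <= K -> (forall k, nle (h k) u v K) ->
  nle (fun t => \sum_k h k t) u v (n%:R * K).
Proof.
move=> K0 hh; apply: (@norm_le_dom n h h _ u v 1 0 K K) => //.
- move=> s t *; rewrite mul1r mul0r addr0 /incr -sumrB; exact: ler_norm_sum.
- move=> t ut tv; apply: (le_trans (ler_norm_sum _ _ _)).
  apply: (@le_trans _ _ (\sum_(k < n) K)); last by rewrite sumr_const card_ord mulr_natl.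
  by apply: ler_sum => k _; have [_ _] := hh k; exact.
- by rewrite mul0r addr0 !mul1r.
Qed.

Lemma norm_le_cst (a : R) u v K : `|a| <= K -> nle (fun=> a) u v K.
Proof.
move=> aK; apply: (@norm_le_dom 0 (fun=> id) (fun=> id) _ u v 0 0 0 0) => //.
- by case.
- by case.
- by move=> s t *; rewrite /incr subrr normr0 !mul0r addr0.
- by rewrite !mul0r addr0 (le_trans _ aK).
Qed.

Lemma norm_le_lim (gn : nat -> R -> R) g u v K :
  (forall t, u <= t -> t <= v -> gn n t @[n --> \oo] --> g t) ->
  (exists N, forall n, (N <= n)%N -> nle (gn n) u v K) -> nle g u v K.
Proof.
move=> hg [N hn].
have hi s t : u <= s -> s <= t -> t <= v -> incr (gn n) s t @[n --> \oo] --> incr g s t.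
  by move=> us st tv; apply: cvgB; apply: hg => //; [exact: le_trans st|exact: le_trans tv].
split.
- by apply: vle_lim hi _ => //; exists N => n /hn[].
- by apply: vle_lim hi _ => //; exists N => n /hn[].
- move=> t ut tv; have cv : `|gn n t| @[n --> \oo] --> `|g t| by apply: cvg_norm; exact: hg.
  rewrite -(cvg_lim (@Rhausdorff R) cv); apply: limr_le; first exact: cvgP cv.
  by exists N => // n /= /hn[_ _]; exact.
Qed.

Lemma norm_le_glue g u w v K1 K2 : u <= w -> w <= v -> nle g u w K1 -> nle g w v K2 ->
  exists K, nle g u v K.
Proof.
move=> uw wv h1 h2; pose M := Num.max K1 K2.
have gM t : u <= t -> t <= v -> `|g t| <= M.
  move=> ut tv; rewrite le_max; have [tw|/ltW wt] := leP t w.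
    by have [_ _ ->] := h1.
  by have [_ _ ->] := h2 => //; rewrite orbT.
have dM s t : u <= s -> s <= t -> t <= v -> `|incr g s t| <= M + M.
  move=> us st tv; apply: (le_trans (ler_normB _ _)); apply: lerD; apply: gM => //.
  - exact: le_trans st.
  - exact: le_trans tv.
have [a1 b1 _] := h1; have [a2 b2 _] := h2.
have h3 := vle_glue p1 uw wv dM a1 a2; have h4 := vle_glue q1 uw wv dM b1 b2.
set X := _ `^ p^-1 in h3; set Y := _ `^ q^-1 in h4.
move: X Y h3 h4 => X Y h3 h4.
exists (Num.max M (Num.max X Y)); split.
- by apply: (vle_le p0 _ h3); rewrite !le_max lexx orbT.
- by apply: (vle_le q0 _ h4); rewrite !le_max lexx !orbT.
- by move=> t ut tv; rewrite le_max gM.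
Qed.

Lemma norm_le_geometric g u v K : (forall n, nle g u v (K / 2 ^+ n)) ->
  forall t, u <= t -> t <= v -> g t = 0.
Proof.
move=> hg t ut tv; apply/eqP; rewrite -normr_eq0 eq_le normr_ge0 andbT.
apply/ler_addgt0Pr => e e0; rewrite add0r.
have [N hN] := geometric_small K e0.
by have [_ _ /(_ t ut tv)/le_trans] := hg N; apply; exact: hN.
Qed.

End NormLe.

(** * Integration as an operator on B *)

Section Tame.
Context {R : realType}.
Variables (p q : R) (omega : R -> R).
Implicit Types (theta : cpath R R) (rho : R -> R) (u v w s t K A P kappa : R).
Local Notation nle := (norm_le p q omega).

(* Integration against theta, of finite P-variation, acts on the space B *)
Definition tame theta P A : Prop := forall u v kappa rho K, 0 <= u -> u <= v -> v <= 1 ->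
  vle P anyrel (incr theta) u v kappa -> nle rho u v K ->
  (forall s t, u <= s -> s <= t -> t <= v -> tree_integrable theta (cutoff rho s t)) /\
  nle (tint theta rho u) u v (A * K * kappa).

Lemma tintxx theta rho u : tint theta rho u u = 0.
Proof.
have -> : tint theta rho u u = tree_integral theta (fun=> 0).
  by congr (tree_integral theta _); apply/funext => r; rewrite cutoffE ltNge andNb.
rewrite /tree_integral; have -> : jump theta (fun=> 0) = fun=> 0.
  by apply/funext => tau; rewrite /jump; rewrite !if_same subrr.
by rewrite /Rintegral integral0_eq.
Qed.

Lemma tint_add theta rho s u t : s <= u -> u <= t ->
  tree_integrable theta (cutoff rho s u) -> tree_integrable theta (cutoff rho u t) ->
  tint theta rho s t = tint theta rho s u + tint theta rho u t.
Proof.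
by move=> su ut h1 h2; rewrite /tint (cutoff_split rho su ut) (tree_integralD h1 h2).2.
Qed.

Lemma tint_sub theta rho rho' s t :
  tree_integrable theta (cutoff rho s t) -> tree_integrable theta (cutoff rho' s t) ->
  tint theta (rho \- rho') s t = tint theta rho s t - tint theta rho' s t.
Proof. by move=> h1 h2; rewrite /tint cutoffB tree_integralB. Qed.

Lemma eq_tint theta rho rho' s t : (forall r, s < r -> r <= t -> rho r = rho' r) ->
  tint theta rho s t = tint theta rho' s t.
Proof. by move=> h; rewrite /tint (eq_cutoff h). Qed.

Hypotheses (p1 : 1 <= p) (q1 : 1 <= q) (hpq : 1 < p^-1 + q^-1) (qp : q <= p).

Let p0 : 0 < p. Proof. exact: lt_le_trans p1. Qed.
Let q0 : 0 < q. Proof. exact: lt_le_trans q1. Qed.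

(** Here (P, Q) = (p, q): the integrator is omega itself, so that its levels are those in the
    definition of B. *)
Lemma tame_omega theta : omega = theta -> tame theta p (2 * tcst p q).
Proof.
move=> oE u v kappa rho K u0 uv v1 hth [h1 h2 h3]; rewrite oE in h2 *.
split; first exact: (tint_ok p1 q1 hpq u0 v1 hth h2 h3 p1 h1).
have t1 := tint_vle p1 q1 hpq u0 uv v1 hth h2 h3 p1 h1.
have t2 := tint_cond_vle p1 q1 hpq u0 uv v1 hth h2 h3 p1 h1.
have C0 := tcst_ge0 p1 q1 hpq; have K0 := h1.1; have k0 := hth.1.
split => //.
  apply: vle_le t2; first exact: ltW.
  rewrite -[leRHS]mulrA [K * kappa]mulrC mulrA ler_wpM2r // -mulrA ler_peMl ?mulr_ge0 //.
  by rewrite ler1n.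
move=> t ut tv; have := vle_incr p0 t1 (lexx u) ut tv I.
by rewrite /incr tintxx subr0.
Qed.

(** Here (P, Q) = (q, p). The q-variation of the integral bounds its variation at equal levels of
    omega and, since q <= p, also its p-variation; the p-variation of [rho] bounds its variation at
    equal levels of [theta]. *)
Lemma tame_young theta : tame theta q (2 * tcst q p).
Proof.
have hqp : 1 < q^-1 + p^-1 by rewrite addrC.
move=> u v kappa rho K u0 uv v1 hth [h1 _ h3].
have h2 : vle p (lev theta) (incr rho) u v K by apply: vle_sub h1.
split; first exact: (tint_ok q1 p1 hqp u0 v1 hth h2 h3 p1 h1).
have t1 := tint_vle q1 p1 hqp u0 uv v1 hth h2 h3 p1 h1.
split => //.
- exact: vle_exponent t1.
- by apply: vle_sub t1.
- move=> t ut tv; have := vle_incr q0 t1 (lexx u) ut tv I.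
  by rewrite /incr tintxx subr0.
Qed.

End Tame.

(** * The differential equation *)

Lemma cvg_of_geometric {R : realType} (a : nat -> R) (C : R) :
  (forall m k, `|a (m + k)%N - a m| <= C / 2 ^+ m) -> cvgn a.
Proof.
move=> h; apply/cauchy_cvgP; apply/cauchy_exP => e e0.
have [N hN] := geometric_small C (divr_gt0 e0 (ltr0n R 2)).
exists (a N); exists N => // m /= Nm; rewrite /ball /= distrC -(subnKC Nm).
apply: le_lt_trans (h N (m - N)%N) _; apply: (le_lt_trans (hN N (leqnn N))); lra.
Qed.

Lemma divr_exp2S {R : realType} (z : R) m : z / 2 ^+ m.+1 = z / 2 ^+ m / 2.
Proof. by rewrite exprSr invfM mulrA. Qed.

Section Equation.
Context {R : realType}.
Variables (p q : R) (omega : R -> R) (n d : nat).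
Variables (theta : 'I_d -> cpath R R) (P : 'I_d -> R) (A L : R).
Variables (f : 'cV[R]_n -> 'M[R]_(n, d)) (x0 : 'cV[R]_n).
Hypotheses (p1 : 1 <= p) (q1 : 1 <= q) (A0 : 0 <= A) (L0 : 0 <= L) (P1 : forall j, 1 <= P j).
Hypothesis htame : forall j, tame p q omega (theta j) (P j) A.
Hypothesis hL : entry_bounds f L.
Implicit Types (x y z : R -> 'cV[R]_n) (u v w s t K D B kappa : R).
Local Notation nle := (norm_le p q omega).

Definition vec_norm_le x u v K : Prop := 0 <= K /\ forall i, nle (fun t => x t i ord0) u v K.

Definition small_driver u v kappa : Prop :=
  forall j, vle (P j) anyrel (incr (theta j)) u v kappa.

(** [f] has bounded derivatives but may be unbounded: [M0] is the constant term of its affine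
    growth. *)
Let M0 := \sum_i \sum_j `|f 0 i j|.

Let M00 : 0 <= M0.
Proof. by apply: sumr_ge0 => i _; apply: sumr_ge0. Qed.

Let fM0 i j : `|f 0 i j| <= M0.
Proof.
rewrite /M0 (bigD1 i) //= (bigD1 j) //= -addrA lerDl addr_ge0 ?sumr_ge0 //.
by move=> *; apply: sumr_ge0.
Qed.

Let sumK K : \sum_(k < n) K = n%:R * K.
Proof. by rewrite sumr_const card_ord mulr_natl. Qed.

Lemma vec_norm_le_le x u v K K' : K <= K' -> vec_norm_le x u v K -> vec_norm_le x u v K'.
Proof.
by move=> KK [K0 h]; split => [|i]; [exact: le_trans KK|exact: norm_le_le (h i)].
Qed.

Lemma vec_norm_le_sub x u v u' v' K : u <= u' -> v' <= v ->
  vec_norm_le x u v K -> vec_norm_le x u' v' K.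
Proof. by move=> uu vv [K0 h]; split => // i; exact: norm_le_sub (h i). Qed.

Lemma vec_norm_le_eq x y u v K : (forall t, u <= t -> t <= v -> x t = y t) ->
  vec_norm_le y u v K -> vec_norm_le x u v K.
Proof.
move=> xy [K0 h]; split => // i; apply: norm_le_eq (h i) => // t ut tv.
by rewrite xy.
Qed.

Lemma vec_norm_le_add x y u v K K' : vec_norm_le x u v K -> vec_norm_le y u v K' ->
  vec_norm_le (fun t => x t + y t) u v (K + K').
Proof.
move=> [K0 h] [K'0 h']; split => [|i]; first exact: addr_ge0.
apply: norm_le_add (h i) (h' i) => // [t *|s t *].
  by rewrite mxE ler_normD.
rewrite /incr !mxE; apply: le_trans (ler_normD _ _).
by rewrite opprD addrACA.
Qed.

Lemma vec_norm_le_diff x y u v K K' : vec_norm_le x u v K -> vec_norm_le y u v K' ->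
  vec_norm_le (fun t => x t - y t) u v (K + K').
Proof.
move=> [K0 h] [K'0 h']; split => [|i]; first exact: addr_ge0.
apply: norm_le_add (h i) (h' i) => // [t *|s t *].
  by rewrite !mxE ler_normB.
rewrite /incr !mxE; apply: le_trans (ler_normB _ _).
by rewrite !opprD !opprK addrACA.
Qed.

Lemma vec_norm_le_cst (a : 'cV[R]_n) u v K : 0 <= K -> (forall i, `|a i ord0| <= K) ->
  vec_norm_le (fun=> a) u v K.
Proof. by move=> K0 h; split => // i; exact: norm_le_cst. Qed.

(** The bound is affine in [K] because [f] is Lipschitz; the a priori bound on solutions rests on
    this. *)
Lemma coef_norm_le x u v K i j : vec_norm_le x u v K ->
  nle (fun s => f (x s) i j) u v (M0 + L * (n%:R * K)).
Proof.
move=> [K0 h]; have [hl _] := hL i j.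
apply: (@norm_le_dom _ _ _ _ p1 q1 n (fun k t => x t k ord0) (fun k t => x t k ord0) _ u v L 0 K K) => //.
- by move=> s t *; rewrite mul0r addr0; exact: hl.
- move=> t ut tv; rewrite -[f (x t) i j](subrKC (f 0 i j)).
  apply: (le_trans (ler_normD _ _)); apply: lerD => //.
  apply: (le_trans (hl _ _)); rewrite ler_wpM2l // -sumK; apply: ler_sum => k _.
  by rewrite mxE subr0; have [_ _] := h k; exact.
- by rewrite mul0r addr0 lerDr.
Qed.

(** The four-point bound is linear in the difference [D]; its second-order part involves the
    increments of [y], whence the factor 1 + K. *)
Lemma coef_diff_norm_le x y u v K D i j : vec_norm_le y u v K ->
  vec_norm_le (fun t => x t - y t) u v D ->
  nle ((fun s => f (x s) i j) \- (fun s => f (y s) i j)) u v (L * (n%:R * D) * (1 + K)).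
Proof.
move=> [K0 hy] [D0 h]; have [hl hl2] := hL i j.
have hD t k : u <= t -> t <= v -> `|x t k ord0 - y t k ord0| <= D.
  by move=> ut tv; have [_ _ /(_ t ut tv)] := h k; rewrite !mxE.
apply: (@norm_le_dom _ _ _ _ p1 q1 n (fun k t => (x t - y t) k ord0) (fun k t => y t k ord0) _ u v L (L * D) D K) => //.
- exact: mulr_ge0.
- move=> s t us st tv; rewrite /incr /=.
  have -> : f (x t) i j - f (y t) i j - (f (x s) i j - f (y s) i j) =
    f (x t) i j - f (x s) i j - (f (y t) i j - f (y s) i j) by lra.
  apply: (le_trans (hl2 D _ _ _ _ D0 _ _)) => [k|k|].
  + by apply: hD => //; exact: le_trans st.
  + by apply: hD => //; exact: le_trans tv.
  + rewrite lerD2r ler_wpM2l // le_eqVlt; apply/orP; left; apply/eqP.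
    by apply: eq_bigr => k _; rewrite !mxE; congr (`|_|); lra.
- move=> t ut tv /=; apply: (le_trans (hl _ _)).
  apply: (@le_trans _ _ (L * (n%:R * D))).
    by rewrite ler_wpM2l // -sumK; apply: ler_sum => k _; exact: hD.
  by rewrite ler_peMr ?mulr_ge0 // lerDl.
- by rewrite le_eqVlt; apply/orP; left; apply/eqP; ring.
Qed.

Definition integral_map x u t : 'cV[R]_n :=
  \col_i \sum_j tint (theta j) (fun s => f (x s) i j) u t.

Section OnInterval.
Variables (u v kappa : R).
Hypotheses (u0 : 0 <= u) (uv : u <= v) (v1 : v <= 1) (kappa0 : 0 <= kappa).
Hypothesis (hsmall : small_driver u v kappa).

Lemma coef_integrable x K s t i j : vec_norm_le x u v K -> u <= s -> s <= t -> t <= v ->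
  tree_integrable (theta j) (cutoff (fun s => f (x s) i j) s t).
Proof.
by move=> hx us st tv; apply: (htame u0 uv v1 (hsmall j) (coef_norm_le i j hx)).1.
Qed.

Lemma integral_map_norm_le x K : vec_norm_le x u v K ->
  vec_norm_le (integral_map x u) u v (d%:R * (A * (M0 + L * (n%:R * K)) * kappa)).
Proof.
move=> hx; have K0 := hx.1.
have h0 : 0 <= A * (M0 + L * (n%:R * K)) by rewrite mulr_ge0 // addr_ge0 // !mulr_ge0.
split => [|i]; first by rewrite mulr_ge0 // mulr_ge0.
apply: (@norm_le_eq _ _ _ _ p1 q1 _ (fun t => \sum_j tint (theta j) (fun s => f (x s) i j) u t)).
  by move=> t *; rewrite mxE.
apply: norm_le_sum => //; first exact: mulr_ge0.
by move=> j; exact: (htame u0 uv v1 (hsmall j) (coef_norm_le i j hx)).2.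
Qed.

Lemma integral_map_diff_norm_le x y Kx K D : vec_norm_le x u v Kx -> vec_norm_le y u v K ->
  vec_norm_le (fun t => x t - y t) u v D ->
  vec_norm_le (fun t => integral_map x u t - integral_map y u t) u v
    (d%:R * (A * (L * (n%:R * D) * (1 + K)) * kappa)).
Proof.
move=> hx hy hD; have K0 := hy.1; have D0 := hD.1.
have h0 : 0 <= A * (L * (n%:R * D) * (1 + K)) by rewrite !mulr_ge0 // addr_ge0.
split => [|i]; first by rewrite mulr_ge0 // mulr_ge0.
apply: (@norm_le_eq _ _ _ _ p1 q1 _ (fun t => \sum_j tint (theta j)
    ((fun s => f (x s) i j) \- (fun s => f (y s) i j)) u t)).
  move=> t ut tv; rewrite !mxE -sumrB; apply: eq_bigr => j _.
  by rewrite tint_sub //; [exact: (coef_integrable i j hx)|exact: (coef_integrable i j hy)].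
apply: norm_le_sum => //; first exact: mulr_ge0.
by move=> j; exact: (htame u0 uv v1 (hsmall j) (coef_diff_norm_le i j hy hD)).2.
Qed.

Lemma integral_map_split x K s t : vec_norm_le x u v K -> u <= s -> s <= t -> t <= v ->
  integral_map x u t = integral_map x u s + integral_map x s t.
Proof.
move=> hx us st tv; apply/colP => i; rewrite !mxE -big_split /=; apply: eq_bigr => j _.
apply: tint_add => //; first exact: (coef_integrable i j hx (lexx u) us (le_trans st tv)).
exact: (coef_integrable i j hx us st tv).
Qed.

End OnInterval.

Lemma eq_integral_map x y s t : (forall r, s < r -> r <= t -> x r = y r) ->
  integral_map x s t = integral_map y s t.
Proof.
move=> xy; apply/colP => i; rewrite !mxE; apply: eq_bigr => j _.
by apply: eq_tint => r sr rt; rewrite xy.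
Qed.

Lemma integral_mapxx x s : integral_map x s s = 0.
Proof. by apply/colP => i; rewrite !mxE big1 // => j _; exact: tintxx. Qed.

Variable Kt : R.
Hypothesis hKt : small_driver 0 1 Kt.

Lemma driver_ind (Pr : R -> Prop) kappa : 0 < kappa -> Pr 0 ->
  (forall u v, 0 <= u -> u <= v -> v <= 1 -> small_driver u v kappa -> Pr u -> Pr v) -> Pr 1.
Proof.
move=> k0 Pr0 step.
have E j s t : 0 <= s -> s <= t -> t <= 1 -> incr (ctheta (theta j)) s t = incr (theta j) s t.
  move=> s0 st t1; rewrite /incr !cthetaE // in_itv /= ?s0 ?t1 ?andbT ?(le_trans s0) //.
  exact: le_trans st t1.
apply: (@small_variation_ind _ _ P (fun j => ctheta (theta j)) (fun=> Kt) kappa) => //.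
- by move=> j; exact: ctheta_continuous.
- move=> j; rewrite -[Kt]mul1r; apply: (vle_scale (P1 j) ler01 _ (hKt j)) => s t s0 st t1 _.
  by rewrite E // mul1r.
- move=> u v u0 uv v1 hs; apply: step => // j.
  rewrite -[kappa]mul1r; apply: (vle_scale (P1 j) ler01 _ (hs j)) => s t us st tv _.
  by rewrite E ?mul1r //; [exact: le_trans us|exact: le_trans v1].
Qed.

(** Finiteness of the norm belongs to the notion because the halving arguments below start from
    it. *)
Definition solves w x : Prop :=
  (exists K, vec_norm_le x 0 w K) /\
  forall t, 0 <= t -> t <= w -> x t = x0 + integral_map x 0 t.

Let small_factor (a : R) : 0 <= a -> exists2 kappa, 0 < kappa & a * kappa <= 2^-1.
Proof.
move=> a0; have a1 : 0 < 2 * (a + 1) by lra.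
exists (2 * (a + 1))^-1; first by rewrite invr_gt0.
rewrite invfM mulrCA ler_piMr // ?invr_ge0 // ler_pdivrMr; lra.
Qed.

Lemma solves_increment w x u t : w <= 1 -> solves w x -> 0 <= u -> u <= t -> t <= w ->
  x t = x u + integral_map x u t.
Proof.
move=> w1 [[K hK] hx] u0 ut tw.
have w0 := le_trans u0 (le_trans ut tw).
have hs : small_driver 0 w Kt by move=> j; apply: vle_sub (hKt j).
rewrite (hx t (le_trans u0 ut) tw) (hx u u0 (le_trans ut tw)).
by rewrite (integral_map_split (lexx 0) w0 w1 hs hK u0 ut tw) addrA.
Qed.

(** [B] is chosen before [w] and [x]: partial solutions have to be covered, since they are the ones
    that Picard's iteration extends. *)
Lemma solution_apriori_bound : exists2 B, 0 <= B &
  forall w x, 0 <= w -> w <= 1 -> solves w x ->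
  forall t i, 0 <= t -> t <= w -> `|x t i ord0| <= B.
Proof.
pose c := d%:R * A * (M0 + L * n%:R).
have c0 : 0 <= c by rewrite /c !mulr_ge0 // addr_ge0 // mulr_ge0.
have [kappa k0 hk] := small_factor c0.
suff [B B0 hB] : exists2 B, 0 <= B & forall w x, 0 <= w -> w <= 1 -> solves w x ->
    forall t i, 0 <= t -> t <= w -> t <= 1 -> `|x t i ord0| <= B.
  by exists B => // w x w0 w1 hx t i t0 tw; apply: (hB w) => //; exact: le_trans w1.
apply: (@driver_ind (fun u => exists2 B, 0 <= B & forall w x, 0 <= w -> w <= 1 -> solves w x ->
    forall t i, 0 <= t -> t <= w -> t <= u -> `|x t i ord0| <= B) kappa) => //.
  exists (\sum_i `|x0 i ord0|); first exact: sumr_ge0.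
  move=> w x w0 w1 [_ hx] t i t0 tw t1; have -> : t = 0 by apply/le_anti; rewrite t1.
  rewrite hx // integral_mapxx addr0 (bigD1 i) //= lerDl; exact: sumr_ge0.
(* On a small interval, a bound [K'] of the norm improves to B + 1/2 + K'/2, whose fixed point is 2
   B + 1. The remainder K / 2^m is finally at most 1. *)
move=> u v u0 uv v1 hs [B B0 hB]; exists (2 * B + 2); first lra.
move=> w x w0 w1 hx t i t0 tw tv.
have [tu|ut] := leP t u; first by have := hB w x w0 w1 hx t i t0 tw tu; lra.
have uw : u <= w by exact: le_trans (ltW ut) tw.
(* The solution may stop before [v]. *)
pose b := Num.min v w; have ub : u <= b by rewrite le_min uv.
have bv : b <= v by rewrite ge_min lexx.
have bw : b <= w by rewrite ge_min lexx orbT.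
have b1 : b <= 1 := le_trans bv v1.
have hsb : small_driver u b kappa by move=> j; apply: vle_sub (hs j).
have [[K hK] _] := hx.
have step K' : vec_norm_le x u b K' -> vec_norm_le x u b (B + (2^-1 + K' / 2)).
  move=> hK'; have K'0 := hK'.1.
  apply: (@vec_norm_le_eq _ (fun t => x u + integral_map x u t)).
    by move=> s us sb; apply: (solves_increment w1 hx) => //; exact: le_trans bw.
  apply: vec_norm_le_add.
    by apply: vec_norm_le_cst => // k; exact: (hB w).
  apply: vec_norm_le_le (integral_map_norm_le u0 ub b1 (ltW k0) hsb hK').
  have -> : d%:R * (A * (M0 + L * (n%:R * K')) * kappa) =
    (d%:R * A * kappa) * M0 + (d%:R * A * kappa * (L * n%:R)) * K' by ring.
  have e : c * kappa = d%:R * A * kappa * M0 + d%:R * A * kappa * (L * n%:R) by rewrite /c; ring.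
  have e1 : 0 <= d%:R * A * kappa by rewrite !mulr_ge0 // ltW.
  have e2 : 0 <= d%:R * A * kappa * M0 by rewrite mulr_ge0.
  have e3 : 0 <= d%:R * A * kappa * (L * n%:R) by rewrite mulr_ge0 // mulr_ge0.
  have e4 : d%:R * A * kappa * (L * n%:R) * K' <= 2^-1 * K' by rewrite ler_wpM2r //; lra.
  by apply: lerD; lra.
have iter m : vec_norm_le x u b (2 * B + 1 + K / 2 ^+ m).
  elim: m => [|m IH].
    apply: vec_norm_le_le (vec_norm_le_sub u0 bw hK); rewrite expr0 divr1; lra.
  apply: vec_norm_le_le (step _ IH).
  by rewrite divr_exp2S; set z := K / _; lra.
have [m hm] := geometric_small K ltr01.
have [_ _ /(_ t (ltW ut))h] := (iter m).2 i.
have tb : t <= b by rewrite le_min tv tw.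
by have := h tb; have := hm m (leqnn m); lra.
Qed.

(** On a small interval after a time up to which the solutions agree, any bound of the norm of their
    difference can be halved; [kappa] may depend on [y], since both solutions are given. *)
Lemma solution_unique x y : solves 1 x -> solves 1 y -> forall t, 0 <= t -> t <= 1 -> x t = y t.
Proof.
move=> hx hy; have [[Kx hKx] ex] := hx; have [[Ky hKy] ey] := hy; have Ky0 := hKy.1.
pose c := d%:R * A * (L * n%:R * (1 + Ky)).
have c0 : 0 <= c by rewrite /c !mulr_ge0 // addr_ge0.
have [kappa k0 hk] := small_factor c0.
apply: (@driver_ind (fun u => forall t, 0 <= t -> t <= u -> x t = y t) kappa) => //.
  move=> t t0 t1; have -> : t = 0 by apply/le_anti; rewrite t1.
  by rewrite ex // ey // !integral_mapxx.
move=> u v u0 uv v1 hs hxy t t0 tv.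
have [tu|/ltW ut] := leP t u; first exact: hxy.
have hxu := vec_norm_le_sub u0 v1 hKx; have hyu := vec_norm_le_sub u0 v1 hKy.
have main m : vec_norm_le (fun t => x t - y t) u v ((Kx + Ky) / 2 ^+ m).
  elim: m => [|m IH]; first by rewrite expr0 divr1; exact: vec_norm_le_diff.
  apply: (@vec_norm_le_eq _ (fun t => integral_map x u t - integral_map y u t)).
    move=> s us sv; have s1 := le_trans sv v1.
    rewrite (solves_increment (lexx 1) hx u0 us s1) (solves_increment (lexx 1) hy u0 us s1).
    by rewrite hxy // opprD addrACA subrr add0r.
  apply: vec_norm_le_le (integral_map_diff_norm_le u0 uv v1 (ltW k0) hs hxu hyu IH).
  rewrite divr_exp2S; have := IH.1; set z := (Kx + Ky) / _ => z0.
  have -> : d%:R * (A * (L * (n%:R * z) * (1 + Ky)) * kappa) = (c * kappa) * z by rewrite /c; ring.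
  by rewrite mulrC ler_wpM2l.
apply/colP => i; apply/eqP; rewrite -subr_eq0; apply/eqP.
have := norm_le_geometric (fun m => (main m).2 i) ut tv.
by rewrite !mxE.
Qed.

(** [kappa] depends on the bound [B] of the initial value, but neither on this value nor on the
    interval. *)
Lemma picard_on_interval B : 0 <= B -> exists2 kappa, 0 < kappa &
  forall u v (a : 'cV[R]_n), 0 <= u -> u <= v -> v <= 1 -> small_driver u v kappa ->
  (forall i, `|a i ord0| <= B) ->
  exists y, vec_norm_le y u v (B + 1) /\ forall t, u <= t -> t <= v -> y t = a + integral_map y u t.
Proof.
move=> B0; set r := B + 1; have r0 : 0 <= r by rewrite /r; lra.
pose c1 := d%:R * A * (M0 + L * (n%:R * r)); pose c2 := d%:R * A * (L * n%:R * (1 + r)).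
have c10 : 0 <= c1 by rewrite /c1 mulr_ge0 // ?addr_ge0 // mulr_ge0 // mulr_ge0.
have c20 : 0 <= c2 by rewrite /c2 !mulr_ge0 // addr_ge0.
(* [c1] governs the invariance of the ball of radius [r] and [c2] the contraction; their sum serves
   both. *)
have [kappa k0 hk] := small_factor (addr_ge0 c10 c20).
have hk1 : c1 * kappa <= 1.
  by have := mulr_ge0 c20 (ltW k0); move: hk; rewrite mulrDl; lra.
have hk2 : c2 * kappa <= 2^-1.
  by have := mulr_ge0 c10 (ltW k0); move: hk; rewrite mulrDl; lra.
exists kappa => // u v a u0 uv v1 hs aB.
pose Phi x t := a + integral_map x u t.
pose xm m := iter m Phi (fun=> a).
have nPhi x : vec_norm_le x u v r -> vec_norm_le (Phi x) u v r.
  move=> hx; apply: vec_norm_le_add; first exact: vec_norm_le_cst.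
  apply: vec_norm_le_le (integral_map_norm_le u0 uv v1 (ltW k0) hs hx).
  by apply: le_trans hk1; rewrite /c1 le_eqVlt; apply/orP; left; apply/eqP; ring.
have nxm m : vec_norm_le (xm m) u v r.
  elim: m => [|m IH]; last exact: nPhi.
  by apply: vec_norm_le_cst => // i; apply: (le_trans (aB i)); rewrite /r; lra.
have dPhi x y D : vec_norm_le x u v r -> vec_norm_le y u v r ->
    vec_norm_le (fun t => x t - y t) u v D -> vec_norm_le (fun t => Phi x t - Phi y t) u v (D / 2).
  move=> hx hy hD; have D0 := hD.1.
  apply: (@vec_norm_le_eq _ (fun t => integral_map x u t - integral_map y u t)).
    by move=> s *; rewrite /Phi opprD addrACA subrr add0r.
  apply: vec_norm_le_le (integral_map_diff_norm_le u0 uv v1 (ltW k0) hs hx hy hD).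
  have -> : d%:R * (A * (L * (n%:R * D) * (1 + r)) * kappa) = (c2 * kappa) * D by rewrite /c2; ring.
  by rewrite mulrC ler_wpM2l.
have dxm m : vec_norm_le (fun t => xm m.+1 t - xm m t) u v ((r + r) / 2 ^+ m).
  elim: m => [|m IH]; first by rewrite expr0 divr1; exact: vec_norm_le_diff.
  by rewrite divr_exp2S; exact: (dPhi _ _ _ (nxm m.+1) (nxm m) IH).
(* The bounds (r + r) / 2^m on the successive differences sum to C / 2^m, and [cauchy] states the
   exact partial sums so that the induction closes. *)
pose C := 4 * r.
have cauchy m k : vec_norm_le (fun t => xm (m + k)%N t - xm m t) u v (C / 2 ^+ m - C / 2 ^+ (m + k)).
  elim: k => [|k IH].
    rewrite addn0 subrr; apply: (@vec_norm_le_eq _ (fun=> 0)); first by move=> *; rewrite subrr.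
    by apply: vec_norm_le_cst => // i; rewrite mxE normr0.
  apply: (@vec_norm_le_eq _ (fun t => (xm (m + k).+1 t - xm (m + k)%N t) + (xm (m + k)%N t - xm m t))).
    by move=> s *; rewrite addnS addrA subrK.
  apply: vec_norm_le_le (vec_norm_le_add (dxm (m + k)%N) IH).
  rewrite addnS divr_exp2S; set z := C / 2 ^+ m.
  have -> : (r + r) / 2 ^+ (m + k) = C / 2 ^+ (m + k) / 2 by rewrite /C; field; rewrite expf_neq0.
  by set z' := C / 2 ^+ (m + k); lra.
have cauchy' m k : vec_norm_le (fun t => xm (m + k)%N t - xm m t) u v (C / 2 ^+ m).
  apply: vec_norm_le_le (cauchy m k); rewrite gerBl divr_ge0 ?exprn_ge0 //.
  by rewrite /C mulr_ge0.
(* The limit is pointwise; the bounds of the norms pass to it by lower semicontinuity, which takes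
   the place of the completeness of B. *)
pose x t : 'cV[R]_n := \col_i limn (fun m => xm m t i ord0).
have cvx i t : u <= t -> t <= v -> (fun m => xm m t i ord0) @ \oo --> x t i ord0.
  move=> ut tv; rewrite mxE; apply: (cvg_of_geometric (C := C)) => m k.
  by have [_ _ /(_ t ut tv)] := (cauchy' m k).2 i; rewrite !mxE.
have nx : vec_norm_le x u v r.
  split=> // i; apply: (@norm_le_lim _ _ _ _ p1 q1 (fun m t => xm m t i ord0)).
    by move=> t; exact: cvx.
  by exists 0 => m _; exact: (nxm m).2.
have dx m : vec_norm_le (fun t => x t - xm m t) u v (C / 2 ^+ m).
  split=> [|i]; first exact: (cauchy' m 0).1.
  apply: (@norm_le_lim _ _ _ _ p1 q1 (fun k t => (xm k t - xm m t) i ord0)).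
    have sE (b c : 'cV[R]_n) : (b - c) i ord0 = b i ord0 - c i ord0 by rewrite !mxE.
    move=> t ut tv; rewrite sE; under eq_fun do rewrite sE.
    by apply: cvgB; [exact: cvx|exact: cvg_cst].
  by exists m => k mk; rewrite -(subnKC mk); exact: (cauchy' m _).2.
exists x; split => // t ut tv.
have fin m : vec_norm_le (fun t => x t - Phi x t) u v (C / 2 ^+ m).
  apply: (@vec_norm_le_eq _ (fun t => (x t - xm m.+1 t) - (Phi x t - xm m.+1 t))).
    by move=> s *; rewrite opprB addrA subrK.
  apply: vec_norm_le_le (vec_norm_le_diff (dx m.+1) (dPhi _ _ _ nx (nxm m) (dx m))).
  by rewrite divr_exp2S; set z := C / _; lra.
apply/colP => i; apply/eqP; rewrite -subr_eq0; apply/eqP.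
have := norm_le_geometric (fun m => (fin m).2 i) ut tv.
by rewrite !mxE.
Qed.

(** The a priori bound keeps [x u] in the range for which [kappa] was chosen, so that the extension
    by gluing never requires a smaller step. *)
Lemma solution_exists : exists x, solves 1 x.
Proof.
have [B B0 hB] := solution_apriori_bound.
have [kappa k0 hk] := picard_on_interval B0.
apply: (@driver_ind (fun u => exists x, solves u x) kappa) => //.
  exists (fun=> x0); split.
    exists (\sum_i `|x0 i ord0|); apply: vec_norm_le_cst; first exact: sumr_ge0.
    by move=> i; rewrite (bigD1 i) //= lerDl; exact: sumr_ge0.
  move=> t t0 t1; have -> : t = 0 by apply/le_anti; rewrite t1.
  by rewrite integral_mapxx addr0.
move=> u v u0 uv v1 hs [x hx]; have u1 := le_trans uv v1.
have [y [ny ey]] := hk u v (x u) u0 uv v1 hs (fun i => hB u x u0 u1 hx u i u0 (lexx u)).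
have yu : y u = x u by rewrite ey // integral_mapxx addr0.
pose z t := if t <= u then x t else y t.
have zx t : t <= u -> z t = x t by rewrite /z => ->.
have zy t : u <= t -> z t = y t.
  rewrite le_eqVlt => /orP[/eqP <-|ut]; first by rewrite zx.
  by rewrite /z leNgt ut.
have [[K hK] ex] := hx.
have nz1 : vec_norm_le z 0 u K by apply: vec_norm_le_eq hK => t _; exact: zx.
have nz2 : vec_norm_le z u v (B + 1) by apply: vec_norm_le_eq ny => t ut _; exact: zy.
have nz : exists K, vec_norm_le z 0 v K.
  have /choice[k hkk] : forall i, exists k, nle (fun t => z t i ord0) 0 v k.
    by move=> i; exact: norm_le_glue u0 uv (nz1.2 i) (nz2.2 i).
  have k_ge0 i : 0 <= k i by exact: norm_le_ge0 (hkk i).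
  exists (\sum_i k i); split => [|i]; first exact: sumr_ge0.
  by apply: norm_le_le (hkk i) => //; rewrite (bigD1 i) //= lerDl; exact: sumr_ge0.
exists z; split => // t t0 tv; have [tu|/ltW ut] := leP t u.
  rewrite zx // ex //; congr (_ + _); apply: eq_integral_map => s _ st.
  by rewrite zx // (le_trans st).
have [K' hK'] := nz.
have v0 := le_trans u0 uv.
have hs1 : small_driver 0 v Kt by move=> j; apply: vle_sub (hKt j).
rewrite (integral_map_split (lexx 0) v0 v1 hs1 hK' u0 ut tv) addrA.
rewrite zy // ey //; congr (_ + _).
  by rewrite ex //; congr (_ + _); apply: eq_integral_map => s _ su; rewrite zx.
by apply: eq_integral_map => s us st; rewrite zy // ltW.
Qed.

End Equation.

(** * The components of (omega, eta) and the conclusion *)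

Section JointPath.
Context {R : realType}.
Variables (p q : R) (m : nat) (omega : cpath R R) (eta : cpath R 'cV[R]_m).

Lemma joint_path_omega (j : 'I_(1 + m)) : (j < 1)%N ->
  (omega : R -> R) = coord_path (joint_path omega eta) j :> (R -> R).
Proof.
move=> j1; apply/funext => t.
change (omega t = col_mx (omega t)%:M (eta t) j ord0); rewrite mxE; case: splitP => k hk; last first.
  by move: j1; rewrite hk.
by rewrite (ord1 k) !mxE.
Qed.

Lemma joint_path_eta (j : 'I_(1 + m)) (k : 'I_m) : j = (1 + k)%N :> nat ->
  (coord_path (joint_path omega eta) j : R -> R) = (fun t => eta t k ord0).
Proof.
move=> hj; apply/funext => t.
change (col_mx (omega t)%:M (eta t) j ord0 = eta t k ord0); rewrite mxE; case: splitP => i hi.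
  by move: (ltn_ord i); rewrite -hi hj.
congr (eta t _ ord0); apply/val_inj/eqP; rewrite -(eqn_add2l 1) -[X in _ == X]hj /=.
by rewrite hi.
Qed.

End JointPath.

Theorem theorem4p8 (R : realType) (p q : R) (hp : 1 <= p) (hq : 1 <= q)
    (hpq : 1 < p^-1 + q^-1) (hqp : q <= p)
    (n m : nat) (omega : cpath R R) (homega : (pvariation p omega < +oo)%E)
    (eta : cpath R 'cV[R]_m) (heta : (pvariation q eta < +oo)%E)
    (f : 'cV[R]_n -> 'M[R]_(n, 1 + m)) (hf : C2_bounded_derivatives f)
    (x0 : 'cV[R]_n) :
  exists x : R -> 'cV[R]_n,
    [/\ spaceBn p q omega x,
        is_solution (joint_path omega eta) f x0 x
      & forall y : R -> 'cV[R]_n,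
          spaceBn p q omega y -> is_solution (joint_path omega eta) f x0 y ->
          forall t, t \in `[0, 1] -> y t = x t].
Proof.
pose theta j := coord_path (joint_path omega eta) j.
(* The component of index 0 is omega, with exponent p; the others are those of eta, with exponent
   q. *)
pose P (j : 'I_(1 + m)) := if (j < 1)%N then p else q.
pose A := Num.max (2 * tcst p q) (2 * tcst q p).
have p0 : 0 < p by exact: lt_le_trans hp.
have q0 : 0 < q by exact: lt_le_trans hq.
have hqp' : 1 < q^-1 + p^-1 by rewrite addrC.
have A0 : 0 <= A by rewrite le_max mulr_ge0 ?tcst_ge0.
have P1 j : 1 <= P j by rewrite /P; case: ifP.
have htame j : tame p q omega (theta j) (P j) A.
  have lift A' : A' <= A -> tame p q omega (theta j) (P j) A' -> tame p q omega (theta j) (P j) A.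
    move=> AA h u v kappa rho K u0 uv v1 hth hrho; have [h1 h2] := h u v kappa rho K u0 uv v1 hth hrho.
    split => //; apply: norm_le_le h2 => //.
    have K0 := norm_le_ge0 hrho; have k0 := hth.1.
    by rewrite -!mulrA ler_wpM2r // mulr_ge0.
  rewrite /P in lift *; case: ifP lift => j1 lift.
    by apply: lift (tame_omega hp hq hpq _); [rewrite le_max lexx|exact: joint_path_omega].
  by apply: (lift _ _ (@tame_young R p q omega hp hq hpq hqp (theta j))); rewrite le_max lexx orbT.
have [L L0 hL] := C2_entry_bounds hf.
have [K1 h1] := pvariation_vle hp homega.
have [K2 h2] := pvariation_vle hq heta.
have hK : small_driver theta P 0 1 (Num.max K1 K2).
  move=> j; rewrite /P; case: ifP => j1.
    apply: (@vle_le _ _ _ _ _ _ K1); rewrite ?le_max ?lexx ?(ltW p0) //.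
    rewrite -[K1]mul1r; apply: (vle_scale hp ler01 _ h1) => s t *.
    by rewrite mul1r normr_id /incr -(@joint_path_omega R m omega eta j j1).
  apply: (@vle_le _ _ _ _ _ _ K2); rewrite ?le_max ?lexx ?orbT ?(ltW q0) //.
  have jm : (j.-1 < m)%N by case: (j) j1 => -[].
  have jE : j = (1 + Ordinal jm)%N :> nat 
    by rewrite -[LHS]prednK //; move: j1; case: (nat_of_ord j).
  rewrite -[K2]mul1r; apply: (vle_scale hq ler01 _ h2) => s t *.
  rewrite mul1r normr_id /incr (@joint_path_eta R m omega eta j (Ordinal jm) jE).
  by have := entry_le_norm (eta t - eta s) (Ordinal jm) ord0; rewrite !mxE.
have BE x : spaceBn p q omega x <-> exists K, vec_norm_le p q omega x 0 1 K.
  split.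
    move=> hx; have /choice[k hk] : forall i, exists k, norm_le p q omega (fun t => x t i ord0) 0 1 k.
      by move=> i; exact/(spaceBP _ _ hp hq)/hx.
    have k_ge0 i : 0 <= k i by exact: norm_le_ge0 (hk i).
    exists (\sum_i k i); split => [|i]; first exact: sumr_ge0.
    apply: norm_le_le (hk i) => //; rewrite (bigD1 i) //= lerDl; exact: sumr_ge0.
  by move=> [K [K0 hx]] i; apply/(spaceBP _ _ hp hq); exists K.
(* The integrals of g 1_(0, t] are those of the cutoffs from 0. The integrability that [is_solution]
   also asks for holds for every element of B. *)
have solE x : spaceBn p q omega x -> is_solution (joint_path omega eta) f x0 x <->
    solves p q omega theta f x0 1 x.
  move=> hB; split=> [hx|[[K hx] e]].
    split; first exact/BE.
    by move=> t t0 t1; have [|_] := hx t; rewrite ?in_itv /= ?t0.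
  move=> t; rewrite in_itv /= => /andP[t0 t1]; split; last exact: e.
  move=> i j.
  exact: (coef_integrable hp hq L0 htame hL (lexx 0) ler01 (lexx 1) hK i j hx (lexx 0) t0 t1).
have [x hx] := solution_exists x0 hp hq A0 L0 P1 htame hL hK.
have xB : spaceBn p q omega x by apply/BE; case: hx.
exists x; split => //; first exact/solE.
move=> y yB /(solE y yB) hy t; rewrite in_itv /= => /andP[t0 t1].
exact: (solution_unique hp hq A0 L0 P1 htame hL hK hy hx).
Qed.
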